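(* Let $\delta L:H_{SL}(\mathcal D)\to H^-_{SL}(\mathcal D)$ be a compact operator and let the operator $Q_1=\iota'\iota L_0^{-1}:H^-_{SL}(\mathcal D)\to H^-_{SL}(\mathcal D)$ be of finite order. Let $T$ be the closed operator in $H^-_{SL}(\mathcal D)$ corresponding to $L=L_0+\delta L$, i.e. the unbounded operator with domain $H_{SL}(\mathcal D)$ and $Tu=Lu$. Then the spectrum of $T$ is different from $\mathbb C$, and the system of root functions of $T$ is complete in the spaces $H^-_{SL}(\mathcal D)$, $L^2(\mathcal D)$ and $H_{SL}(\mathcal D)$. Moreover, for any $\varepsilon>0$, all eigenvalues of $T$ (except for a finite number) belong to the corner $|\arg\lambda|<\varepsilon$.
   Context: Setting. $\mathcal D\subset\mathbb R^n$ is a bounded domain with Lipschitz boundary; functions are complex-valued. $S\subset\partial\mathcal D$ is an open connected (possibly empty) subset with piecewise smooth boundary. The functions $a_{i,j}\in L^\infty(\mathcal D)$ ($i,j=1,\dots,n$) form a Hermitian matrix with $\sum_{i,j}a_{i,j}(x)\xi_i\xi_j\ge m|\xi|^2$ for all $x\in\mathcal D$, $\xi\in\mathbb R^n\setminus\{0\}$, with a constant $m>0$. $b_1\in L^\infty(\partial\mathcal D)$ vanishes on $S$, $b_1\neq0$ a.e. on $\partial\mathcal D\setminus S$, $1/b_1\in L^1(\partial\mathcal D\setminus S)$. $a_{0,0}\ge0$ is a bounded function on $\mathcal D$ and $b_{0,0}$ a bounded function on $\partial\mathcal D$ with $b_{0,0}/b_1\ge0$. Spaces. $H^1(\mathcal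 D,S)$ is the subspace of $H^1(\mathcal D)$ of functions whose trace vanishes on $S$. Put $$(u,v)_{SL}=\int_{\mathcal D}\sum_{i,j}a_{i,j}\,\partial_ju\,\overline{\partial_iv}\,dx+(a_{0,0}u,v)_{L^2(\mathcal D)}+(b_{0,0}b_1^{-1}u,v)_{L^2(\partial\mathcal D\setminus S)},\qquad \|u\|_{SL}=\sqrt{(u,u)_{SL}}.$$ Standing assumptions: $\|\cdot\|_{SL}$ is a norm on $H^1(\mathcal D,S)$; $H_{SL}(\mathcal D)$ denotes the completion of $H^1(\mathcal D,S)$ in this norm (a Hilbert space); $H_{SL}(\mathcal D)$ is continuously embedded into $L^2(\mathcal D)$, and $\iota:H_{SL}(\mathcal D)\hookrightarrow L^2(\mathcal D)$ denotes the inclusion. $H^-_{SL}(\mathcal D)$ is the completion of $H^1(\mathcal D,S)$ in the norm $\|u\|_{H^-_{SL}}=\sup_{0\ne v\in H^1(\mathcal D,S)}|(v,u)_{L^2(\mathcal D)}|/\|v\|_{SL}$. The sesquilinear pairing $(v,u)=\lim_\nu(v,u_\nu)_{L^2(\mathcal D)}$ for $v\in H_{SL}(\mathcal D)$, $u\in H^-_{SL}(\mathcal D)$, with $H^1(\mathcal D,S)\ni u_\nu\to u$ in $H^-_{SL}(\mathcal D)$, identifies $H^-_{SL}(\mathcal D)$ (conjugate-linearly, isometrically) with the dual of $H_{SL}(\mathcal D)$. $\iota':L^2(\mathcal D)\hookrightarrow H^-_{SL}(\mathcal D)$ is the induced continuous embedding; $H_{SL}(\mathcal D)$ is regarded as a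 (dense) subspace of $H^-_{SL}(\mathcal D)$ via $\iota'\iota$. Operator. $L_0:H_{SL}(\mathcal D)\to H^-_{SL}(\mathcal D)$ is defined by $(v,L_0u)=(v,u)_{SL}$ for all $u,v\in H_{SL}(\mathcal D)$; it is an isometric isomorphism. $H^-_{SL}(\mathcal D)$ carries the scalar product $(u,v)_{H^-_{SL}}:=(L_0^{-1}u,v)$, which induces its norm. Terminology. A compact operator $K$ on a Hilbert space is in the Schatten class $\mathfrak S_p$ ($0<p<\infty$) if its $s$-numbers (eigenvalues of $(K^*K)^{1/2}$) satisfy $\sum_\nu s_\nu(K)^p<\infty$; a compact operator is of finite order if it belongs to some $\mathfrak S_p$. A root function of $T$ corresponding to an eigenvalue $\lambda$ is an element $u$ of the domain of $T$ such that $(T-\lambda I)^ju$ lies in the domain of $T$ for $j=1,\dots,m-1$ and $(T-\lambda I)^mu=0$, for some natural $m$. A system is complete in a space if its linear span is dense in that space. *)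

(* Defs.v *)
From HB Require Import structures.
From mathcomp Require Import all_boot all_order all_algebra.
From mathcomp Require Import complex.
From mathcomp Require Import all_classical all_reals all_analysis.

Set Implicit Arguments.
Unset Strict Implicit.
Unset Printing Implicit Defensive.

Import Order.TTheory GRing.Theory Num.Theory.
Import numFieldNormedType.Exports.

Local Open Scope classical_set_scope.
Local Open Scope ring_scope.

(* Inner products and sesquilinear pairings are linear in the first argument
   and conjugate-linear in the second one. *)

Section covering.
Context {R : realType} {T : Type}.
Local Open Scope ereal_scope.

Definition covering_outer (tau : set T -> \bar R) (A : set T) : \bar R :=
  ereal_inf [set \sum_(k <oo) tau (F k) |
             F in [set F : (set T)^nat | A `<=` \bigcup_k F k]].

End covering.

Section covering_lemmas.
Context {R : realType} {T : pointedType}.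
Local Open Scope ereal_scope.
Variable tau : set T -> \bar R.
Hypothesis tau0 : tau set0 = 0.
Hypothesis tau_ge0 : forall X, 0 <= tau X.

Let full := g_sigma_algebraType [set: set T].

Lemma covering_outerE : covering_outer tau = @mu_ext _ full R tau.
Proof.
apply/funext => A; rewrite /covering_outer /mu_ext; congr ereal_inf.
apply/seteqP; split=> _ [F AF <-]; exists F => //.
  by split=> // i; exact: sub_gen_smallest.
by case: AF.
Qed.

Lemma covering_outer0 : covering_outer tau set0 = 0.
Proof. by rewrite covering_outerE; exact: (@mu_ext0 _ full). Qed.

Lemma covering_outer_ge0 A : 0 <= covering_outer tau A.
Proof. by rewrite covering_outerE; exact: (@mu_ext_ge0 _ full). Qed.

Lemma le_covering_outer : {homo covering_outer tau : A B / A `<=` B >-> A <= B}.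
Proof. by rewrite covering_outerE; exact: (@le_mu_ext _ full). Qed.

Lemma covering_outer_sigma_subadditive : sigma_subadditive (covering_outer tau).
Proof.
by rewrite covering_outerE; exact: (@mu_ext_sigma_subadditive _ full).
Qed.

End covering_lemmas.

Section euclidean.
Context {R : realType}.

Definition enorm n (x : 'rV[R]_n) : R := Num.sqrt (\sum_i x 0 i ^+ 2).

Definition box n (a b : 'rV[R]_n) : set 'rV[R]_n :=
  [set x | forall i, a 0 i <= x 0 i <= b 0 i].

Definition box_volume n (a b : 'rV[R]_n) : R :=
  \prod_i Num.max 0 (b 0 i - a 0 i).

(* The volume of the bounding box of F (+oo if F is unbounded); covering by
   sets with this gauge amounts to covering by boxes. *)
Definition box_gauge n (F : set 'rV[R]_n) : \bar R :=
  ereal_inf [set v | exists a b, F `<=` box a b /\ v = (box_volume a b)%:E].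

Definition lebesgue_outer n : set 'rV[R]_n.+1 -> \bar R :=
  covering_outer (@box_gauge n.+1).

(* Volume of the unit ball of R^n, by the recursion in steps of two. *)
Fixpoint ball_volume (n : nat) : R :=
  match n with
  | 0 => 1
  | 1 => 2
  | (m.+1 as k).+1 => 2 * pi / k.+1%:R * ball_volume m
  end.

Definition ediam n (F : set 'rV[R]_n) : \bar R :=
  ereal_sup [set (enorm (x - y))%:E | x in F & y in F].

Definition hausdorff_gauge n (s : nat) (delta : R) (F : set 'rV[R]_n) : \bar R :=
  if F == set0 then 0%E
  else if (ediam F <= delta%:E)%E
       then (ball_volume s / 2 ^+ s * fine (ediam F) ^+ s)%:E
       else +oo%E.

(* Normalised so that it agrees with surface area on s-dimensional surfaces. *)
Definition hausdorff_outer n (s : nat) (A : set 'rV[R]_n.+1) : \bar R :=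
  ereal_sup [set covering_outer (@hausdorff_gauge n.+1 s delta) A |
             delta in [set delta : R | 0 < delta]].

End euclidean.

Section outer_instances.
Context {R : realType}.
Local Open Scope ereal_scope.

Lemma box_gauge_ge0 n (F : set 'rV[R]_n) : 0 <= box_gauge F.
Proof.
apply: le_ereal_inf_tmp => _ [a [b [_ ->]]]; rewrite lee_fin.
by apply: prodr_ge0 => i _; rewrite le_max lexx.
Qed.

Lemma box_gauge0 n : box_gauge (set0 : set 'rV[R]_n.+1) = 0.
Proof.
apply/eqP; rewrite eq_le box_gauge_ge0 andbT; apply: ereal_inf_lbound.
exists 0%R, 0%R; split=> //; congr (_%:E).
by rewrite /box_volume (bigD1 ord0) //= subrr maxxx mul0r.
Qed.

Lemma ball_volume_ge0 n : (0 <= ball_volume n :> R)%R.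
Proof.
suff: (0 <= ball_volume n :> R)%R /\ (0 <= ball_volume n.+1 :> R)%R by case.
elim: n => [|n [ih1 ih2]]; first by split.
split => //=; apply: mulr_ge0 => //; apply: divr_ge0 => //.
by rewrite mulr_ge0 // pi_ge0.
Qed.

Lemma hausdorff_gauge0 n s d : hausdorff_gauge s d (set0 : set 'rV[R]_n) = 0.
Proof. by rewrite /hausdorff_gauge eqxx. Qed.

Lemma hausdorff_gauge_ge0 n s d (F : set 'rV[R]_n) : 0 <= hausdorff_gauge s d F.
Proof.
rewrite /hausdorff_gauge; case: ifPn => // /set0P[x Fx]; case: ifPn => // _.
rewrite lee_fin mulr_ge0 ?divr_ge0 ?ball_volume_ge0 //.
rewrite exprn_ge0 // fine_ge0 //.
apply: le_trans (ereal_sup_ubound _); last by exists x => //; exists x.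
by rewrite lee_fin sqrtr_ge0.
Qed.

HB.instance Definition _ n := isOuterMeasure.Build R 'rV[R]_n.+1
  (@lebesgue_outer R n)
  (covering_outer0 (box_gauge0 n) (@box_gauge_ge0 n.+1))
  (covering_outer_ge0 (@box_gauge_ge0 n.+1))
  (@le_covering_outer _ _ (@box_gauge R n.+1))
  (covering_outer_sigma_subadditive (@box_gauge_ge0 n.+1)).

Section hausdorff.
Variables n s : nat.
Let H := @hausdorff_outer R n s.
Let g d := @hausdorff_gauge R n.+1 s d.

Let H_ge A d : (0 < d)%R -> covering_outer (g d) A <= H A.
Proof. by move=> d0; apply: ereal_sup_ubound; exists d. Qed.

Lemma hausdorff_outer0 : H set0 = 0.
Proof.
have c0 d : covering_outer (g d) set0 = 0.
  exact: (covering_outer0 (hausdorff_gauge0 n.+1 s d) (hausdorff_gauge_ge0 s d)).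
apply/eqP; rewrite eq_le; apply/andP; split.
  by apply: ge_ereal_sup => _ [d _ <-]; rewrite -/(g d) c0.
by rewrite -(c0 1%R) H_ge.
Qed.

Lemma hausdorff_outer_ge0 A : 0 <= H A.
Proof.
apply: le_trans (H_ge A ltr01).
exact: (covering_outer_ge0 (hausdorff_gauge_ge0 s 1)).
Qed.

Lemma le_hausdorff_outer : {homo H : A B / A `<=` B >-> A <= B}.
Proof.
move=> A B AB; apply: ge_ereal_sup => _ [d d0 <-].
by apply: le_trans (H_ge B d0); exact: le_covering_outer.
Qed.

Lemma hausdorff_outer_sigma_subadditive : sigma_subadditive H.
Proof.
move=> F; apply: ge_ereal_sup => _ [d d0 <-].
apply: le_trans (_ : \sum_(i <oo) covering_outer (g d) (F i) <= _).
  exact: (covering_outer_sigma_subadditive (hausdorff_gauge_ge0 s d)).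
apply: lee_nneseries => [i _ _|i _]; last exact: H_ge.
exact: (covering_outer_ge0 (hausdorff_gauge_ge0 s d)).
Qed.

HB.instance Definition _ := isOuterMeasure.Build R 'rV[R]_n.+1 H
  hausdorff_outer0 hausdorff_outer_ge0 le_hausdorff_outer
  hausdorff_outer_sigma_subadditive.

End hausdorff.
End outer_instances.

Definition lebesgue_outer_measure (R : realType) n :
  {outer_measure set 'rV[R]_n.+1 -> \bar R} := @lebesgue_outer R n.
Definition area_outer_measure (R : realType) n :
  {outer_measure set 'rV[R]_n.+1 -> \bar R} := @hausdorff_outer R n n.

(* Lebesgue measure and surface measure in R^(n+1): the two outer measures on
   their Caratheodory-measurable sets. *)
Definition vol (R : realType) n :
    {measure set (caratheodory_type (@lebesgue_outer_measure R n)) -> \bar R} :=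
  (lebesgue_outer_measure R n
   : set (caratheodory_type (lebesgue_outer_measure R n)) -> \bar R).
Definition area (R : realType) n :
    {measure set (caratheodory_type (@area_outer_measure R n)) -> \bar R} :=
  (area_outer_measure R n
   : set (caratheodory_type (area_outer_measure R n)) -> \bar R).

Section complex_integration.
Context d (T : measurableType d) (R : realType).
Variables (mu : {measure set T -> \bar R}) (A : set T).
Implicit Types f g : T -> R[i].

Definition abs2 (z : R[i]) : R := complex.Re z ^+ 2 + complex.Im z ^+ 2.

Definition cmeasurable f :=
  measurable_fun A (fun x => complex.Re (f x)) /\
  measurable_fun A (fun x => complex.Im (f x)).

Definition cintegrable f :=
  mu.-integrable A (fun x => (complex.Re (f x))%:E) /\
  mu.-integrable A (fun x => (complex.Im (f x))%:E).

Definition cint f : R[i] :=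
  Complex (\int[mu]_(x in A) complex.Re (f x))
          (\int[mu]_(x in A) complex.Im (f x)).

Definition ae_on (P : T -> Prop) := {ae mu, forall x, A x -> P x}.

(* The squared L^2 norm. *)
Definition sqnorm2 f : \bar R := (\int[mu]_(x in A) (abs2 (f x))%:E)%E.

(* Elements of L^p(A) are represented by functions; equality in L^p(A) is
   equality almost everywhere on A. *)
Definition L2 f := cmeasurable f /\ (sqnorm2 f < +oo)%E.

Definition Linfty f :=
  cmeasurable f /\ exists M : R, ae_on (fun x => `|f x| <= M%:C%C).

Definition bounded_measurable f :=
  Linfty f /\ exists M : R, forall x, A x -> `|f x| <= M%:C%C.

Definition L2dot f g : R[i] := cint (fun x => f x * (g x)^*).

End complex_integration.

Section domains.
Context {R : realType} {n : nat}.
Notation E := 'rV[R]_n.+1.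

Definition bd (D : set E) : set E := closure D `\` interior D.

(* Near each boundary point, in suitable Cartesian coordinates, D is the set of
   points lying above the graph of a Lipschitz function. *)
Definition lipschitz_boundary (D : set E) :=
  forall p, bd D p ->
  exists (Q : 'M[R]_n.+1) (psi : 'rV[R]_n -> R) (k : R) (U : set E),
    [/\ Q *m Q^T = 1%:M,
        forall y z, `|psi y - psi z| <= k * enorm (y - z),
        open U, U p
      & forall x, U x ->
          (D x <-> psi (col' ord0 (x *m Q)) < (x *m Q) 0 ord0)].

Definition lipschitz_domain (D : set E) :=
  [/\ D !=set0, open D, connected D, bounded_set D & lipschitz_boundary D].

Definition cube k : set 'rV[R]_k := [set t | forall i, 0 <= t 0 i <= 1].

(* The image of a closed k-dimensional cube under an injective C^1 immersion
   defined in a neighbourhood of the cube. *)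
Definition C1_patch k (G : set E) :=
  exists (gam : 'rV[R]_k -> E) (U : set 'rV[R]_k),
  [/\ open U /\ @cube k `<=` U,
      forall i t, U t -> derivable gam t (delta_mx 0 i) /\
        {for t, continuous (fun s => 'D_(delta_mx 0 i) gam s)},
      {in @cube k &, injective gam},
      forall t, @cube k t ->
        row_free (\matrix_(i < k) 'D_(delta_mx 0 i) gam t)
    & G = gam @` @cube k].

Definition piecewise_smooth k (B : set E) :=
  exists (N : nat) (G : 'I_N -> set E),
    (forall i, C1_patch k (G i)) /\ B = \bigcup_(i in setT) G i.

(* closure S `\` S is the boundary of S relative to bd D: S is relatively open
   and bd D is closed. *)
Definition boundary_part (D S : set E) :=
  [/\ exists2 U, open U & S = U `&` bd D,
      connected S
    & piecewise_smooth n.-1 (closure S `\` S)].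

End domains.

Section sobolev.
Context {R : realType} {n : nat}.
Notation E := 'rV[R]_n.+1.
Notation C := R[i].

Definition partial (j : 'I_n.+1) (f : E -> R) : E -> R :=
  fun x => 'D_(delta_mx 0 j) f x.

Definition cpartial (j : 'I_n.+1) (f : E -> C) : E -> C :=
  fun x => Complex (partial j (fun y => complex.Re (f y)) x)
                   (partial j (fun y => complex.Im (f y)) x).

Definition smooth (f : E -> R) := forall s : seq 'I_n.+1,
  let g := foldr partial f s in
  continuous g /\ forall j x, derivable g x (delta_mx 0 j).

Definition csmooth (f : E -> C) :=
  smooth (fun x => complex.Re (f x)) /\ smooth (fun x => complex.Im (f x)).

Definition test_function (D : set E) (phi : E -> R) :=
  smooth phi /\
  exists K, [/\ compact K, K `<=` D & forall x, ~ K x -> phi x = 0].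

Variable D : set E.

Definition weak_partial (j : 'I_n.+1) (u g : E -> C) :=
  forall phi, test_function D phi ->
    cint (vol R n) D (fun x => u x * (partial j phi x)%:C%C) =
    - cint (vol R n) D (fun x => g x * (phi x)%:C%C).

Definition H1 (u : E -> C) :=
  L2 (vol R n) D u /\
  forall j, exists2 g, L2 (vol R n) D g & weak_partial j u g.

(* A representative of the weak derivative, unique up to null sets. *)
Definition pd (j : 'I_n.+1) (u : E -> C) : E -> C :=
  xget (fun=> 0) [set g | L2 (vol R n) D g /\ weak_partial j u g].

(* The trace on bd D is the continuous extension to H^1(D) -> L^2(bd D) of the
   restriction of smooth functions. *)
Definition is_trace (u g : E -> C) :=
  L2 (area R n) (bd D) g /\
  exists phi : nat -> E -> C,
  [/\ forall k, csmooth (phi k),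
      (fun k => sqnorm2 (vol R n) D (fun x => phi k x - u x)) @ \oo --> 0%E,
      forall j, (fun k => sqnorm2 (vol R n) D
        (fun x => cpartial j (phi k) x - pd j u x)) @ \oo --> 0%E
    & (fun k => sqnorm2 (area R n) (bd D) (fun x => phi k x - g x)) @ \oo
        --> 0%E].

Definition tr (u : E -> C) : E -> C := xget (fun=> 0) (is_trace u).

Definition H1_vanishing (S : set E) (u : E -> C) :=
  H1 u /\ ae_on (area R n) S (fun x => tr u x = 0).

End sobolev.

Section SL.
Context {R : realType} {n : nat}.
Notation E := 'rV[R]_n.+1.
Notation C := R[i].

Record SL_data := {
  dom : set E;
  part : set E;
  acoef : 'I_n.+1 -> 'I_n.+1 -> E -> C;
  a00 : E -> C;
  b1 : E -> C;
  b00 : E -> C }.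

Variable P : SL_data.
Notation D := (dom P).
Notation S := (part P).
Notation vol := (vol R n).
Notation area := (area R n).

Definition H1S : set (E -> C) := H1_vanishing D S.

Definition null_on (u : E -> C) := ae_on vol D (fun x => u x = 0).

Definition SLdot (u v : E -> C) : C :=
  cint vol D (fun x => \sum_i \sum_j acoef P i j x * pd D j u x * (pd D i v x)^*)
  + L2dot vol D (fun x => a00 P x * u x) v
  + L2dot area (bd D `\` S)
      (fun x => b00 P x / b1 P x * tr D u x) (tr D v).

Definition SLnorm (u : E -> C) : R := Num.sqrt (complex.Re (SLdot u u)).

Record SL_coefficients : Prop := {
  SL_domain : lipschitz_domain D;
  SL_part : boundary_part D S;
  SL_a_bounded : forall i j, Linfty vol D (acoef P i j);
  SL_a_hermitian : forall i j x, D x -> acoef P i j x = (acoef P j i x)^*;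
  SL_a_elliptic : exists2 m : R, 0 < m &
    forall x (xi : 'rV[R]_n.+1), D x -> xi != 0 ->
      (m * enorm xi ^+ 2)%:C%C <=
      \sum_i \sum_j acoef P i j x * (xi 0 i)%:C%C * (xi 0 j)%:C%C;
  SL_b1_bounded : Linfty area (bd D) (b1 P);
  SL_b1_S : ae_on area S (fun x => b1 P x = 0);
  SL_b1_neq0 : ae_on area (bd D `\` S) (fun x => b1 P x != 0);
  SL_b1_inv : cintegrable area (bd D `\` S) (fun x => (b1 P x)^-1);
  SL_a00_bounded : bounded_measurable vol D (a00 P);
  SL_a00_ge0 : forall x, D x -> 0 <= a00 P x;
  SL_b00_bounded : bounded_measurable area (bd D) (b00 P);
  SL_b00_ge0 : ae_on area (bd D `\` S) (fun x => 0 <= b00 P x / b1 P x) }.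

(* The coefficient b00 / b1 is only integrable, so that the finiteness of the
   boundary term on H^1(D, S) is part of the assumption that SLnorm is a norm. *)
Record SL_norm : Prop := {
  SL_norm_finite : forall u, H1S u ->
    cintegrable area (bd D `\` S)
      (fun x => b00 P x / b1 P x * tr D u x * (tr D u x)^*);
  SL_norm_ge0 : forall u, H1S u -> 0 <= SLdot u u;
  SL_norm_definite : forall u, H1S u -> SLnorm u = 0 -> null_on u;
  SL_norm_homogeneous : forall (c : C) u, H1S u ->
    SLnorm (fun x => c * u x) = Num.sqrt (abs2 c) * SLnorm u;
  SL_norm_triangle : forall u v, H1S u -> H1S v ->
    SLnorm (fun x => u x + v x) <= SLnorm u + SLnorm v }.

Definition negnorm (u : E -> C) : R :=
  sup [set Num.sqrt (abs2 (L2dot vol D v u)) / SLnorm v |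
       v in [set v | H1S v /\ ~ null_on v]].

End SL.

Arguments SL_data : clear implicits.

Record hilbert (R : realType) := Hilbert {
  hcarrier :> completeNormedModType R[i];
  hdot : {dot hcarrier for @Num.conj R[i]};
  hdotE : forall x : hcarrier, `|x| ^+ 2 = hdot x x }.

Section operators.
Context {R : realType}.
Notation C := R[i].

Definition span {K : nzRingType} {V : lmodType K} (A : set V) : set V :=
  [set x | exists (k : nat) (c : 'I_k -> K) (v : 'I_k -> V),
     (forall i, A (v i)) /\ x = \sum_i c i *: v i].

Definition compact_operator (X Y : hilbert R) (K : X -> Y) :=
  linear K /\ compact (closure (K @` [set x | `|x| <= 1])).

Definition has_dim (X : lmodType C) (V : set X) (k : nat) :=
  exists v : 'I_k -> X,
    (forall c : 'I_k -> C, \sum_i c i *: v i = 0 -> forall i, c i = 0) /\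
    V = [set x | exists c : 'I_k -> C, x = \sum_i c i *: v i].

Definition adjoint (X : hilbert R) (K Ka : X -> X) :=
  forall x y, hdot X (K x) y = hdot X x (Ka y).

Definition positive_sqrt (X : hilbert R) (B : X -> X) (A : {linear X -> X}) :=
  [/\ continuous A, adjoint A A, forall x, 0 <= hdot X (A x) x
    & forall x, A (A x) = B x].

(* s enumerates, with multiplicities and in nonincreasing order, the nonzero
   eigenvalues of (K* K)^(1/2); it is padded with zeros if there are finitely
   many of them. *)
Definition s_numbers (X : hilbert R) (K : X -> X) (s : nat -> R) :=
  exists Ka A : {linear X -> X},
  [/\ adjoint K Ka, positive_sqrt (fun x => Ka (K x)) A,
      forall k, 0 <= s k.+1 <= s k
    & forall lam : R, 0 < lam -> exists2 m : nat,
        has_dim [set x | A x = lam%:C%C *: x] m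
      & ([set k | s k = lam] #= `I_m)%card].

Definition schatten (p : R) (X : hilbert R) (K : X -> X) :=
  compact_operator K /\
  exists2 s, s_numbers K s & (\sum_(0 <= k <oo) (s k `^ p)%:E < +oo)%E.

Definition finite_order (X : hilbert R) (K : X -> X) :=
  exists2 p : R, 0 < p & schatten p K.

(* Only the values of op on op_dom are meaningful. *)
Record unbounded (X : hilbert R) := {
  op_dom : set X;
  op :> X -> X }.

Section unbounded.
Variables (X : hilbert R) (T : unbounded X).

Definition resolvent_set : set C :=
  [set lam | exists2 B : {linear X -> X}, continuous B &
     (forall y, op_dom T (B y) /\ T (B y) - lam *: B y = y) /\
     (forall x, op_dom T x -> B (T x - lam *: x) = x)].

Definition spectrum : set C := ~` resolvent_set.

Definition eigenvalues : set C :=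
  [set lam | exists x, [/\ op_dom T x, x != 0 & T x = lam *: x]].

Definition root_function (lam : C) (u : X) :=
  let N := fun x => T x - lam *: x in
  op_dom T u /\
  exists m : nat, [/\ (0 < m)%N,
    forall j, (0 < j < m)%N -> op_dom T (iter j N u) & iter m N u = 0].

Definition root_functions : set X :=
  [set u | exists2 lam, eigenvalues lam & root_function lam u].

End unbounded.

Definition complete_system (X : hilbert R) (A : set X) :=
  closure (span A) = [set: X].

Definition complete_in_L2 d (T : measurableType d)
    (mu : {measure set T -> \bar R}) (D : set T) (A : set (T -> C^o)) :=
  forall f, L2 mu D f -> forall eps : R, 0 < eps ->
    exists2 g, span A g & (sqnorm2 mu D (fun x => f x - g x)%R < eps%:E)%E.

Definition corner (eps : R) : set C :=
  [set lam | exists r theta : R,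
     [/\ 0 < r, `|theta| < eps & lam = Complex (r * cos theta) (r * sin theta)]].

End operators.

Section spaces.
Context {R : realType} {n : nat}.
Variable P : SL_data R n.
Notation E := 'rV[R]_n.+1.
Notation C := R[i].
Notation D := (dom P).
Notation vol := (vol R n).

Definition linear_on (X : lmodType C) (A : set (E -> C)) (f : (E -> C) -> X) :=
  forall (c : C) u v, A u -> A v ->
    f (fun x => c * u x + v x) = c *: f u + f v.

(* H is a completion of H^1(D, S) in the norm SLnorm, with canonical map j:
   complete, with H^1(D, S) isometrically mapped onto a dense subspace.  Such an
   (H, j) is unique up to a unique isometric isomorphism; likewise for Hm. *)
Record SL_completion (H : hilbert R) (j : (E -> C) -> H) : Prop := {
  SLc_linear : linear_on (H1S P) j;
  SLc_dot : forall u v, H1S P u -> H1S P v -> hdot H (j u) (j v) = SLdot P u v;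
  SLc_dense : closure (j @` H1S P) = [set: H] }.

(* iota is the inclusion of H into L^2(D). *)
Record L2_inclusion (H : hilbert R) (j : (E -> C) -> H) (iota : H -> E -> C)
    : Prop := {
  L2i_L2 : forall v, L2 vol D (iota v);
  L2i_linear : forall (c : C) v w,
    ae_on vol D (fun x => iota (c *: v + w) x = c * iota v x + iota w x);
  L2i_H1 : forall u, H1S P u -> ae_on vol D (fun x => iota (j u) x = u x);
  L2i_bounded : exists M : R, forall v,
    (sqnorm2 vol D (iota v) <= (M * complex.Re `|v| ^+ 2)%:E)%E;
  L2i_injective : forall v, null_on P (iota v) -> v = 0 }.

Record neg_completion (Hm : hilbert R) (jm : (E -> C) -> Hm) : Prop := {
  negc_linear : linear_on (H1S P) jm;
  negc_norm : forall u, H1S P u -> `|jm u| = (negnorm P u)%:C%C;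
  negc_dense : closure (jm @` H1S P) = [set: Hm] }.

Definition is_pairing (H Hm : hilbert R) (iota : H -> E -> C)
    (jm : (E -> C) -> Hm) (pair : H -> Hm -> C) :=
  forall (v : H) (f : Hm) (u : nat -> E -> C),
    (forall k, H1S P (u k)) -> jm (u k) @[k --> \oo] --> f ->
    (L2dot vol D (iota v) (u k) : C^o) @[k --> \oo] --> (pair v f : C^o).

(* iota' : L^2(D) -> Hm is the embedding induced by the pairing. *)
Record dual_embedding (H Hm : hilbert R) (iota : H -> E -> C)
    (pair : H -> Hm -> C) (iota' : (E -> C) -> Hm) : Prop := {
  de_linear : linear_on (L2 vol D) iota';
  de_pair : forall v f, L2 vol D f -> pair v (iota' f) = L2dot vol D (iota v) f;
  de_bounded : exists M : R, forall f, L2 vol D f ->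
    ((complex.Re `|iota' f| ^+ 2)%:E <= M%:E * sqnorm2 vol D f)%E;
  de_injective : forall f, L2 vol D f -> iota' f = 0 -> null_on P f }.

End spaces.

(* Main.v *)
(* On Hm put Q f = iota' (iota (L0inv f)) and K = dL \o L0inv: Q is compact,
   positive, injective, in a Schatten class, K is compact, the domain of T is
   the range of Q and T (Q f) = f + K f.  Hence T - l corresponds to the pencil
   f + K f - l Q f.  Since Q is selfadjoint and positive, this pencil is bounded
   below for large l outside any sector around the positive half-line; this
   localises the eigenvalues and yields a resolvent B = Q G at some -a < 0, whose
   root vectors are those of T.
   Completeness is Keldysh's theorem.  If h is orthogonal to the root vectors of
   B, let V be the adjoint of B preceded by the projection onto the orthogonal
   complement of these root vectors; V has no nonzero eigenvalue.  A power of V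
   is a limit of finite rank operators with uniformly bounded trace norm, so
   f z = (1 - z V)^-1 h grows at most like exp (c |z|^m).  As f is bounded outside
   a narrow sector, it is bounded everywhere by Phragmen-Lindelof, and then
   V (f z) = O(1/|z|) vanishes by the maximum principle, so that h = 0.
   Holomorphy is replaced by iterated difference quotients and the mean value
   inequality over four points, determinants of operators by Schur's inequality
   for matrices.
   Completeness in L^2 follows from the density of the image of iota, by
   projecting in L^2 (Riesz-Fischer) and using that iota' is injective. *)
From HB Require Import structures.
Require Import Defs.
From mathcomp Require Import all_boot all_order all_algebra.
From mathcomp Require Import complex.
From mathcomp Require Import all_classical all_reals all_analysis.
From mathcomp Require Import measurable_realfun ring lra.

Import Order.TTheory GRing.Theory Num.Theory.
Import numFieldNormedType.Exports.

Local Open Scope classical_set_scope.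
Local Open Scope ring_scope.

Set Implicit Arguments.
Unset Strict Implicit.
Unset Printing Implicit Defensive.

(** * Semi-inner products and projections *)

(** The pencil bound says nothing inside a sector around the positive half-line, where infinitely
    many eigenvalues may lie; there growth is the only tool. Passing to the adjoint on the
    complement of the root vectors removes all nonzero eigenvalues, so (1 - z V)^-1 exists for every
    z, and the finite order of Q limits its growth to the order m = 2 ^ q. This order is compatible
    with Phragmen-Lindelof in sectors of slope kappa with 3 (m + 1) kappa <= 1; as the pencil bound
    holds for every kappa > 0, kappa is chosen after m. The exponent is a power of two because 1 - z
    W^2 factors through a square root of z, so that powers of V again have no nonzero eigenvalue.
    The bound outside the sector comes from B = Q G: 1 - z B is the pencil at z - a composed with G,
    and a is so large that the shift by a carries the complement of the sector to where the pencil
    is bounded below. The three completeness statements rest on one fact: only 0 is orthogonal to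
    the root vectors of B. It is carried to H through G and L0, and from there to L^2 by density. *)

Section modulus.
Context {R : realType}.
Implicit Types z w : R[i].

Definition cabs z : R := Normc.normc z.

Lemma cabsE z : `|z| = (cabs z)%:C%C.
Proof. by []. Qed.

Lemma sqr_cabs z : cabs z ^+ 2 = complex.Re z ^+ 2 + complex.Im z ^+ 2.
Proof.
by case: z => a b; rewrite /cabs /= sqr_sqrtr // addr_ge0 ?sqr_ge0.
Qed.

Lemma cabs_ge0 z : 0 <= cabs z.
Proof. by case: z => a b; rewrite /cabs /= sqrtr_ge0. Qed.

Lemma cabs0 : cabs 0 = 0. Proof. exact: Normc.normc0. Qed.
Lemma cabs1 : cabs 1 = 1. Proof. exact: Normc.normc1. Qed.

Lemma cabs_eq0 z : cabs z = 0 -> z = 0. Proof. exact: Normc.eq0_normc. Qed.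

Lemma cabs_gt0 z : z != 0 -> 0 < cabs z.
Proof.
move=> z0; rewrite lt0r cabs_ge0 andbT; apply: contraNneq z0.
by move=> /cabs_eq0 ->.
Qed.

Lemma cabsM z w : cabs (z * w) = cabs z * cabs w.
Proof. exact: Normc.normcM. Qed.

Lemma cabsV z : cabs z^-1 = (cabs z)^-1. Proof. exact: Normc.normcV. Qed.

Lemma cabsX z n : cabs (z ^+ n) = cabs z ^+ n.
Proof. by elim: n => [|n ih]; rewrite ?expr0 ?cabs1 // !exprS cabsM ih. Qed.

Lemma cabsN z : cabs (- z) = cabs z.
Proof. by case: z => a b; rewrite /cabs /= !sqrrN. Qed.

Lemma cabsJ z : cabs z^* = cabs z.
Proof. by case: z => a b; rewrite /cabs /= sqrrN. Qed.

Lemma cabsD z w : cabs (z + w) <= cabs z + cabs w.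
Proof. by have := ler_normD z w; rewrite !cabsE -rmorphD lecR. Qed.

Lemma cabsBC z w : cabs (z - w) = cabs (w - z).
Proof. by rewrite -cabsN opprB. Qed.

Lemma cabs_real (r : R) : cabs r%:C%C = `|r|.
Proof. by rewrite /cabs /= expr0n /= addr0 sqrtr_sqr. Qed.

Lemma cabs_i : cabs 'i%C = 1.
Proof. by rewrite /cabs /= expr0n expr1n /= add0r sqrtr1. Qed.

Lemma cabs_nat n : cabs n%:R = n%:R.
Proof. by rewrite -(rmorph_nat (real_complex R)) cabs_real normr_nat. Qed.

Lemma Re_cabs z : `|complex.Re z| <= cabs z.
Proof. by have := normc_ge_Re z; rewrite cabsE lecR. Qed.

Lemma Im_cabs z : `|complex.Im z| <= cabs z.
Proof.
rewrite -(ler_pXn2r (n := 2)) ?nnegrE ?cabs_ge0 //.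
by rewrite sqr_cabs real_normK ?num_real // lerDr sqr_ge0.
Qed.

Lemma cabs_ReIm z : cabs z <= `|complex.Re z| + `|complex.Im z|.
Proof.
rewrite -(ler_pXn2r (n := 2)) ?nnegrE ?cabs_ge0 ?addr_ge0 //.
rewrite sqr_cabs sqrrD !real_normK ?num_real //.
by rewrite lerD2r lerDl mulrn_wge0 // mulr_ge0.
Qed.

Lemma mulrJ_cabs z : z * z^* = (cabs z ^+ 2)%:C%C.
Proof. by have := sqr_normc z; rewrite cabsE -rmorphXn. Qed.

Lemma cabs_prod I (r : seq I) (P : pred I) (F : I -> R[i]) :
  cabs (\prod_(i <- r | P i) F i) = \prod_(i <- r | P i) cabs (F i).
Proof.
by elim/big_rec2: _ => [|i x y _ ih]; rewrite ?cabs1 // cabsM ih.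
Qed.

Lemma ReD z w : complex.Re (z + w) = complex.Re z + complex.Re w.
Proof. by case: z w => [? ?] [? ?]. Qed.
Lemma ReN z : complex.Re (- z) = - complex.Re z.
Proof. by case: z. Qed.
Lemma ReM z w : complex.Re (z * w) =
  complex.Re z * complex.Re w - complex.Im z * complex.Im w.
Proof. by case: z w => [? ?] [? ?]. Qed.
Lemma ReJ z : complex.Re z^* = complex.Re z. Proof. by case: z. Qed.
Lemma ImD z w : complex.Im (z + w) = complex.Im z + complex.Im w.
Proof. by case: z w => [? ?] [? ?]. Qed.
Lemma ImJ z : complex.Im z^* = - complex.Im z. Proof. by case: z. Qed.
Lemma ImM z w : complex.Im (z * w) =
  complex.Re z * complex.Im w + complex.Im z * complex.Re w.
Proof. by case: z w => [? ?] [? ?]. Qed.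
Lemma conjCr (r : R) : (r%:C%C)^* = r%:C%C.
Proof. exact: conjc_real. Qed.
Lemma ReRM (r : R) z : complex.Re (r%:C%C * z) = r * complex.Re z.
Proof. by rewrite ReM /= mul0r subr0. Qed.

End modulus.

Section null_sequence.
Context {R : realType}.

Lemma inv_natS_lt (e : R) : 0 < e ->
  exists N : nat, forall n, (N <= n)%N -> n.+1%:R^-1 < e.
Proof.
move=> e0; exists (Num.truncn e^-1) => n Nn.
rewrite invf_plt ?posrE ?ltr0n //; apply: lt_le_trans (truncnS_gt _) _.
by rewrite ler_nat ltnS.
Qed.

Lemma le_small (a b : R) : (forall e, 0 < e -> a <= b + e) -> a <= b.
Proof. by move=> h; apply/ler_addgt0Pr. Qed.

End null_sequence.

Section semi_inner_product.
Context {R : realType} (V : lmodType R[i]) (L : set V) (dot : V -> V -> R[i]).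
Hypotheses (L0 : L 0) (LP : forall a x y, L x -> L y -> L (a *: x + y)).
Hypothesis dotP : forall a x y z, L x -> L y -> L z ->
  dot (a *: x + y) z = a * dot x z + dot y z.
Hypothesis dotC : forall x y, L x -> L y -> dot y x = (dot x y)^*.
Hypothesis dot_ge0 : forall x, L x -> 0 <= dot x x.

(** The form may be degenerate and is controlled only on [L], so that the same section serves
    Hilbert spaces ([L] everything) and square integrable functions, where a vanishing seminorm
    means vanishing almost everywhere. *)
Definition seminorm x := Num.sqrt (complex.Re (dot x x)).
Local Notation nr := seminorm.

Lemma L_scale a x : L x -> L (a *: x).
Proof. by move=> Lx; rewrite -[_ *: _]addr0; exact: LP. Qed.
Lemma L_add x y : L x -> L y -> L (x + y).
Proof. by move=> Lx Ly; rewrite -[x]scale1r; exact: LP. Qed.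
Lemma L_sub x y : L x -> L y -> L (x - y).
Proof.
by move=> Lx Ly; rewrite addrC -scaleN1r; exact: LP.
Qed.

Lemma dotl0 z : L z -> dot 0 z = 0.
Proof.
move=> Lz; have := @dotP (-1) 0 0 z L0 L0 Lz.
by rewrite scaler0 addr0 mulN1r addNr.
Qed.

Lemma dotlZ a x z : L x -> L z -> dot (a *: x) z = a * dot x z.
Proof. by move=> Lx Lz; rewrite -[_ *: _]addr0 dotP // dotl0 // addr0. Qed.

Lemma dotlD x y z : L x -> L y -> L z -> dot (x + y) z = dot x z + dot y z.
Proof. by move=> Lx Ly Lz; rewrite -{1}[x]scale1r dotP // mul1r. Qed.

Lemma dotrZ a x z : L x -> L z -> dot z (a *: x) = a^* * dot z x.
Proof.
move=> Lx Lz; rewrite (dotC (L_scale a Lx) Lz) dotlZ // rmorphM /=.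
by rewrite (dotC Lx Lz).
Qed.

Lemma dotrD x y z : L x -> L y -> L z -> dot z (x + y) = dot z x + dot z y.
Proof.
move=> Lx Ly Lz; rewrite (dotC (L_add Lx Ly) Lz) dotlD // rmorphD /=.
by rewrite (dotC Lx Lz) (dotC Ly Lz).
Qed.

Lemma seminorm_ge0 x : 0 <= nr x. Proof. exact: sqrtr_ge0. Qed.

Lemma sqr_seminorm x : L x -> dot x x = (nr x ^+ 2)%:C%C.
Proof.
move=> /dot_ge0; rewrite /seminorm lecE /=; case: (dot x x) => a b /=.
by move=> /andP[/eqP -> a0]; rewrite sqr_sqrtr.
Qed.

Lemma sqr_seminormDZ t x y : L x -> L y ->
  nr (x + t *: y) ^+ 2 =
  nr x ^+ 2 + 2 * complex.Re (t^* * dot x y) + cabs t ^+ 2 * nr y ^+ 2.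
Proof.
move=> Lx Ly; have Lty := L_scale t Ly.
apply: complexI; rewrite -sqr_seminorm; last exact: L_add.
rewrite dotlD ?dotrD //; try exact: L_add.
rewrite (sqr_seminorm Lx) !(dotlZ, dotrZ) // (sqr_seminorm Ly).
rewrite (dotC Lx Ly) [t * (t^* * _)]mulrA mulrJ_cabs -[_ * (nr y ^+ 2)%:C%C]rmorphM.
move: (dot x y) (nr x ^+ 2) (cabs t ^+ 2 * nr y ^+ 2) => c A B /=.
apply/eqP; rewrite eq_complex; apply/andP; split; apply/eqP.
  by rewrite !(ReD, ReM, ReJ, ImJ) /=; ring.
by rewrite !(ImD, ImM, ReJ, ImJ) /=; ring.
Qed.

Lemma sqr_seminormD x y : L x -> L y ->
  nr (x + y) ^+ 2 = nr x ^+ 2 + 2 * complex.Re (dot x y) + nr y ^+ 2.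
Proof.
move=> Lx Ly; have := sqr_seminormDZ 1 Lx Ly.
by rewrite scale1r rmorph1 mul1r cabs1 expr1n mul1r.
Qed.

Lemma seminormZ a x : L x -> nr (a *: x) = cabs a * nr x.
Proof.
move=> Lx; apply/eqP.
rewrite -(eqrXn2 (n := 2)) ?seminorm_ge0 ?mulr_ge0 ?cabs_ge0 ?seminorm_ge0 //.
have := sqr_seminormDZ a L0 Lx; rewrite add0r dotl0 // mulr0 mulr0 addr0.
rewrite /(seminorm 0) dotl0 // sqrtr0 expr0n add0r => ->.
by rewrite exprMn.
Qed.

Lemma seminormN x : L x -> nr (- x) = nr x.
Proof. by move=> Lx; rewrite -scaleN1r seminormZ // cabsN cabs1 mul1r. Qed.

Lemma parallelogram x y : L x -> L y ->
  nr (x + y) ^+ 2 + nr (x - y) ^+ 2 = 2 * nr x ^+ 2 + 2 * nr y ^+ 2.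
Proof.
move=> Lx Ly; have := sqr_seminormDZ (-1) Lx Ly.
rewrite scaleN1r rmorphN1 mulN1r ReN cabsN cabs1 expr1n mul1r => ->.
by rewrite sqr_seminormD //; ring.
Qed.

Lemma cauchy_schwarz x y : L x -> L y -> cabs (dot x y) <= nr x * nr y.
Proof.
move=> Lx Ly; set c := dot x y.
have key (s : R) :
    0 <= nr x ^+ 2 - 2 * s * cabs c ^+ 2 + s ^+ 2 * cabs c ^+ 2 * nr y ^+ 2.
  have := sqr_seminormDZ (- s%:C%C * c) Lx Ly; rewrite -/c.
  rewrite rmorphM rmorphN /= conjCr cabsM cabsN cabs_real -mulrA.
  rewrite [_^* * c]mulrC mulrJ_cabs -rmorphN -rmorphM /=.
  rewrite exprMn real_normK ?num_real // => E.
  have := sqr_ge0 (nr (x + ((- s)%:C%C * c) *: y)); rewrite E.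
  by congr (_ <= _); ring.
rewrite -(ler_pXn2r (n := 2)) ?nnegrE ?cabs_ge0 ?mulr_ge0 ?seminorm_ge0 //.
rewrite exprMn.
have [y0|y0] := eqVneq (nr y) 0.
  have [c0|c0] := eqVneq (cabs c ^+ 2) 0; first by rewrite c0 y0 expr0n mulr0.
  (* With [nr y = 0] the bound [key] is affine in [s] with slope [- 2 * cabs c ^+ 2], and this [s]
     brings it to -1. In the other case below, [s] is the minimiser [(nr y ^+ 2)^-1]. *)
  have := key ((nr x ^+ 2 + 1) / (2 * cabs c ^+ 2)).
  rewrite y0 expr0n mulr0 addr0.
  rewrite (_ : _ - _ = - 1) ?ler0N1 //.
  by field; move: c0; rewrite expf_eq0.
have := key (nr y ^+ 2)^-1.
set C := cabs c ^+ 2; set A := nr x ^+ 2; set B := nr y ^+ 2.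
have B0 : 0 < B by rewrite exprn_gt0 // lt0r y0 seminorm_ge0.
rewrite (_ : _ + _ = A - C / B); first by rewrite subr_ge0 ler_pdivrMr.
by field; rewrite gt_eqF.
Qed.

Lemma seminormD x y : L x -> L y -> nr (x + y) <= nr x + nr y.
Proof.
move=> Lx Ly.
rewrite -(ler_pXn2r (n := 2)) ?nnegrE ?addr_ge0 ?seminorm_ge0 //.
rewrite sqr_seminormD // sqrrD lerD2r lerD2l mulr_natl lerMn2r /=.
apply: le_trans (cauchy_schwarz Lx Ly).
by apply: le_trans (Re_cabs _); exact: ler_norm.
Qed.

Hypothesis complete : forall u : nat -> V, (forall n, L (u n)) ->
  (forall e : R, 0 < e -> exists N, forall m n, (N <= m)%N -> (N <= n)%N ->
     nr (u m - u n) < e) ->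
  exists2 x, L x & forall e : R, 0 < e -> exists N, forall n, (N <= n)%N ->
     nr (u n - x) < e.

(** [Y] is not assumed closed, hence [p] is only a limit of its elements. A minimising sequence is
    Cauchy by the parallelogram law, since midpoints stay in [Y]. *)
Lemma projection (Y : set V) : Y `<=` L -> Y 0 ->
  (forall a x y, Y x -> Y y -> Y (a *: x + y)) ->
  forall x, L x -> exists2 p,
    L p /\ (forall e : R, 0 < e -> exists2 y, Y y & nr (y - p) < e)
  & forall y, Y y -> dot (x - p) y = 0.
Proof.
move=> YL Y0 YP x Lx.
pose E := [set nr (x - y) ^+ 2 | y in Y]; pose d := inf E.
have lbE : has_lbound E by exists 0 => _ [y _ <-]; exact: sqr_ge0.
have hE : has_inf E by split => //; exists (nr (x - 0) ^+ 2), 0.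
have dE y : Y y -> d <= nr (x - y) ^+ 2.
  by move=> Yy; apply: ge_inf => //; exists y.
have /boolp.choice[u uP] : forall n, exists y,
    Y y /\ nr (x - y) ^+ 2 < d + n.+1%:R^-1.
  move=> n; have n0 : (0 : R) < n.+1%:R^-1 by rewrite invr_gt0 ltr0n.
  by have [_ [y Yy <-] lt] := inf_adherent n0 hE; exists y.
have Lu n : L (u n) by apply: YL; case: (uP n).
have Lxu n : L (x - u n) by exact: L_sub.
have lin (a b c f s t d0 : R) : a < d0 + s -> b < d0 + t -> d0 <= c ->
    2 ^+ 2 * c + f = 2 * b + 2 * a -> f <= 2 * s + 2 * t by lra.
have cau m n : nr (u m - u n) ^+ 2 <= 2 * m.+1%:R^-1 + 2 * n.+1%:R^-1.
  have := parallelogram (Lxu n) (Lxu m).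
  have -> : x - u n - (x - u m) = u m - u n.
    by rewrite opprB addrC addrA subrK.
  have -> : x - u n + (x - u m) = 2%:R *: (x - 2^-1 *: (u n + u m)).
    rewrite scalerBr scalerA divff ?pnatr_eq0 // scale1r scaler_nat mulr2n.
    by rewrite opprD addrACA.
  have Lm : Y (2^-1 *: (u n + u m)).
    rewrite scalerDr; apply: (YP); first by case: (uP n).
    by rewrite -[_ *: _]addr0; apply: (YP) => //; case: (uP m).
  rewrite seminormZ; last by apply: L_sub => //; exact: YL.
  rewrite cabs_nat exprMn.
  by apply: lin (dE _ Lm); [have [_] := uP m|have [_] := uP n].
have [|p Lp pP] := complete Lu.
  move=> e e0; have e20 : 0 < e ^+ 2 / 4 by rewrite divr_gt0 ?exprn_gt0 ?ltr0n.
  have [N NP] := inv_natS_lt e20; exists N => m n Nm Nn.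
  rewrite -(ltr_pXn2r (n := 2)) ?nnegrE ?seminorm_ge0 ?ltW //.
  apply: le_lt_trans (cau m n) _.
  by have := NP _ Nm; have := NP _ Nn; move: m.+1%:R^-1 n.+1%:R^-1 => s t; lra.
exists p; first split=> //.
  by move=> e /pP[N /(_ N (leqnn N)) lt]; exists (u N) => //; case: (uP N).
move=> y Yy; apply: cabs_eq0; apply/eqP; rewrite eq_le cabs_ge0 andbT.
have Ly := YL _ Yy; set B := nr y ^+ 2.
have B0 : 0 <= B by exact: sqr_ge0.
have small n : cabs (dot (x - u n) y) ^+ 2 <= (B + 1) / n.+1%:R.
  (* Moving [u n] along [y] cannot bring it closer to [x] than the infimum. The optimal step would
     be [B^-1]; the added 1 covers the case [B = 0]. *)
  set c := dot _ y; pose s := (B + 1)^-1.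
  have s0 : 0 < s by rewrite invr_gt0 ltr_wpDl.
  have := sqr_seminormDZ (- s%:C%C * c) (Lxu n) Ly; rewrite -/c.
  rewrite rmorphM rmorphN /= conjCr cabsM cabsN cabs_real -mulrA.
  rewrite [_^* * c]mulrC mulrJ_cabs -rmorphN -rmorphM /=.
  rewrite exprMn real_normK ?num_real // -/B => eq1.
  have : d <= nr (x - u n + ((- s)%:C%C * c) *: y) ^+ 2.
    rewrite rmorphN mulNr scaleNr -addrA -opprD; apply: dE.
    by rewrite addrC; apply: (YP) => //; case: (uP n).
  rewrite eq1; have [_] := uP n.
  set C := cabs c ^+ 2; set A := nr _ ^+ 2; set r := n.+1%:R^-1 => h1 h2.
  have C0 : 0 <= C by exact: sqr_ge0.
  have h3 : s * C <= r.
    have -> : s * C = 2 * s * C - s ^+ 2 * C * (B + 1).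
      by rewrite /s; field; rewrite gt_eqF // ltr_wpDl.
    suff : s ^+ 2 * C >= 0 by lra.
    by rewrite mulr_ge0 // sqr_ge0.
  have : (B + 1) * (s * C) <= (B + 1) * r by rewrite ler_wpM2l // addr_ge0.
  by rewrite mulrA divff ?mul1r // gt_eqF // ltr_wpDl.
apply: le_small => e e0; rewrite add0r.
have e2 : 0 < (e / 2) ^+ 2 / (B + 1).
  by rewrite divr_gt0 ?exprn_gt0 ?divr_gt0 ?ltr_wpDl.
have [N1 N1P] := inv_natS_lt e2.
have y1 : 0 < nr y + 1 by rewrite ltr_wpDl ?seminorm_ge0.
have e3 : 0 < e / 2 / (nr y + 1) by rewrite !divr_gt0.
have [N2 N2P] := pP _ e3; pose n := maxn N1 N2.
have -> : x - p = (x - u n) + (u n - p) by rewrite addrA subrK.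
rewrite dotlD //; last exact: L_sub.
apply: le_trans (cabsD _ _) _; rewrite [e]splitr lerD //.
  rewrite -(ler_pXn2r (n := 2)) ?nnegrE ?cabs_ge0 ?divr_ge0 ?(ltW e0) //.
  apply: le_trans (small n) _; have := N1P n (leq_maxl _ _).
  by rewrite ltr_pdivlMr ?ltr_wpDl // mulrC => /ltW.
apply: le_trans (cauchy_schwarz _ _) _ => //; first exact: L_sub.
have := N2P n (leq_maxr _ _); rewrite ltr_pdivlMr // => /ltW.
by apply: le_trans; rewrite ler_wpM2l ?seminorm_ge0 // lerDl.
Qed.

End semi_inner_product.

(** * Hilbert spaces and compact operators *)

Local Notation ip := (hdot _) (only parsing).

Section linear_maps.
Context {R : realType}.

Lemma lin0 (U V : lmodType R[i]) (f : U -> V) : linear f -> f 0 = 0.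
Proof. by move=> lf; have := lf (-1) 0 0; rewrite scaler0 addr0 scaleN1r addNr. Qed.
Lemma linZ (U V : lmodType R[i]) (f : U -> V) (lf : linear f) a x :
  f (a *: x) = a *: f x.
Proof. by rewrite -[a *: x]addr0 lf (lin0 lf) addr0. Qed.
Lemma linD (U V : lmodType R[i]) (f : U -> V) (lf : linear f) x y :
  f (x + y) = f x + f y.
Proof. by rewrite -{1}[x]scale1r lf scale1r. Qed.
Lemma linN (U V : lmodType R[i]) (f : U -> V) (lf : linear f) x :
  f (- x) = - f x.
Proof. by rewrite -[in LHS]scaleN1r linZ // scaleN1r. Qed.
Lemma linB (U V : lmodType R[i]) (f : U -> V) (lf : linear f) x y :
  f (x - y) = f x - f y.
Proof. by rewrite linD // linN. Qed.
Lemma lin_sum (U V : lmodType R[i]) (f : U -> V) (lf : linear f)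
  I (r : seq I) (P : pred I) (F : I -> U) :
  f (\sum_(i <- r | P i) F i) = \sum_(i <- r | P i) f (F i).
Proof.
by elim/big_rec2: _ => [|i x y _ ih]; rewrite ?(lin0 lf) // linD // ih.
Qed.

End linear_maps.

Section hilbert_space.
Context {R : realType} {X : hilbert R}.
Implicit Types x y z : X.

Definition nr x : R := seminorm (hdot X) x.

Lemma ipC x y : ip y x = (ip x y)^*.
Proof. by rewrite hermC /= expr0 mul1r. Qed.
Lemma ipDl x y z : ip (x + y) z = ip x z + ip y z.
Proof. by rewrite linearDl. Qed.
Lemma ipDr x y z : ip z (x + y) = ip z x + ip z y.
Proof. by rewrite linearDr. Qed.
Lemma ipZl a x z : ip (a *: x) z = a * ip x z.
Proof. by rewrite linearZl. Qed.
Lemma ipZr a x z : ip z (a *: x) = a^* * ip z x.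
Proof. by rewrite linearZr. Qed.
Lemma ipNl x z : ip (- x) z = - ip x z. Proof. by rewrite linearNl. Qed.
Lemma ipNr x z : ip z (- x) = - ip z x. Proof. by rewrite linearNr. Qed.
Lemma ipBl x y z : ip (x - y) z = ip x z - ip y z.
Proof. by rewrite ipDl ipNl. Qed.
Lemma ipBr x y z : ip z (x - y) = ip z x - ip z y.
Proof. by rewrite ipDr ipNr. Qed.
Lemma ip0l z : ip (0 : X) z = 0. Proof. by rewrite linear0l. Qed.
Lemma ip0r z : ip z (0 : X) = 0. Proof. by rewrite linear0r. Qed.
Lemma ip_suml I (r : seq I) (P : pred I) (F : I -> X) z :
  ip (\sum_(i <- r | P i) F i) z = \sum_(i <- r | P i) ip (F i) z.
Proof. by elim/big_rec2: _ => [|i x y _ <-]; rewrite ?ip0l // ipDl. Qed.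
Lemma ip_sumr I (r : seq I) (P : pred I) (F : I -> X) z :
  ip z (\sum_(i <- r | P i) F i) = \sum_(i <- r | P i) ip z (F i).
Proof. by elim/big_rec2: _ => [|i x y _ <-]; rewrite ?ip0r // ipDr. Qed.

Lemma ip_ge0 x : 0 <= ip x x.
Proof. by rewrite -hdotE exprn_ge0. Qed.

Let P3 a x y z (_ _ _ : True) : ip (a *: x + y) z = a * ip x z + ip y z.
Proof. by rewrite ipDl ipZl. Qed.
Let C3 x y (_ _ : True) : ip y x = (ip x y)^*.
Proof. exact: ipC. Qed.
Let G3 x (_ : True) : 0 <= ip x x.
Proof. exact: ip_ge0. Qed.
Let T3 : [set: X] 0 := I.
Let L3 (a : R[i]) x y (_ _ : True) : [set: X] (a *: x + y) := I.

Lemma ip_sq x : ip x x = (nr x ^+ 2)%:C%C.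
Proof. exact: (sqr_seminorm (L := setT) G3). Qed.
Lemma nr_ge0 x : 0 <= nr x. Proof. exact: seminorm_ge0. Qed.
Lemma nrZ a x : nr (a *: x) = cabs a * nr x.
Proof. exact: (seminormZ T3 L3 P3 C3 G3). Qed.
Lemma nrN x : nr (- x) = nr x.
Proof. exact: (seminormN T3 L3 P3 C3 G3). Qed.
Lemma nrD x y : nr (x + y) <= nr x + nr y.
Proof. exact: (seminormD T3 L3 P3 C3 G3). Qed.
Lemma ip_le x y : cabs (ip x y) <= nr x * nr y.
Proof. exact: (cauchy_schwarz T3 L3 P3 C3 G3). Qed.
Lemma sqr_nrD x y : nr (x + y) ^+ 2 =
  nr x ^+ 2 + 2 * complex.Re (ip x y) + nr y ^+ 2.
Proof. exact: (sqr_seminormD T3 L3 P3 C3 G3). Qed.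

Lemma nr_norm x : `|x| = (nr x)%:C%C.
Proof.
have h : 0 <= `|x| by [].
apply/eqP; rewrite -(eqrXn2 (n := 2)) //; last by rewrite ler0c nr_ge0.
by rewrite hdotE ip_sq rmorphXn.
Qed.

Lemma nr_eq0 x : nr x = 0 -> x = 0.
Proof. by move=> h; apply/eqP; rewrite -normr_eq0 nr_norm h. Qed.
Lemma nr0 : nr (0 : X) = 0.
Proof. by rewrite -[0](scale0r (0 : X)) nrZ cabs0 mul0r. Qed.
Lemma nr_gt0 x : x != 0 -> 0 < nr x.
Proof.
by move=> x0; rewrite lt0r nr_ge0 andbT; apply: contraNneq x0 => /nr_eq0 ->.
Qed.
Lemma nrBC x y : nr (x - y) = nr (y - x).
Proof. by rewrite -nrN opprB. Qed.
Lemma nrB x y : nr (x - y) <= nr x + nr y.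
Proof. by rewrite -(nrN y) nrD. Qed.
Lemma nr_subr x y : nr x <= nr (x - y) + nr y.
Proof. by rewrite -{1}[x](subrK y) nrD. Qed.
Lemma nr_trans y x z : nr (x - z) <= nr (x - y) + nr (y - z).
Proof. by rewrite -{1}[x](subrK y) -addrA nrD. Qed.
Lemma nr_sum I (r : seq I) (P : pred I) (F : I -> X) :
  nr (\sum_(i <- r | P i) F i) <= \sum_(i <- r | P i) nr (F i).
Proof.
elim/big_rec2: _ => [|i x y _ ih]; first by rewrite nr0.
by apply: le_trans (nrD _ _) _; rewrite lerD2l.
Qed.
Lemma nr_sqE x : nr x ^+ 2 = complex.Re (ip x x).
Proof. by rewrite ip_sq. Qed.
Lemma nr_normalize x : x != 0 -> nr ((nr x)^-1%:C%C *: x) = 1.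
Proof.
move=> /nr_gt0 x0; rewrite nrZ cabs_real ger0_norm ?invr_ge0 ?ltW //.
by rewrite mulVf // gt_eqF.
Qed.

Lemma ip_inj x y : (forall z, ip x z = ip y z) -> x = y.
Proof.
move=> h; apply/eqP; rewrite -subr_eq0; apply/eqP/nr_eq0/eqP.
by rewrite -sqrf_eq0 nr_sqE ipBl h subrr.
Qed.

Lemma nr_small x : (forall e : R, 0 < e -> nr x <= e) -> x = 0.
Proof.
move=> h; apply: nr_eq0; apply/eqP; rewrite eq_le nr_ge0 andbT.
by apply: le_small => e /h; rewrite add0r.
Qed.

Lemma hilbert_complete (u : nat -> X) :
  (forall e : R, 0 < e -> exists N, forall m n, (N <= m)%N -> (N <= n)%N ->
     nr (u m - u n) < e) ->
  exists x, forall e : R, 0 < e -> exists N, forall n, (N <= n)%N ->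
     nr (u n - x) < e.
Proof.
move=> cau.
have/cauchy_cvgP uc : cauchy (u @ \oo).
  apply/cauchy_ballP => e e0.
  have /cau[N NP] : 0 < complex.Re e by move: e0; rewrite ltcE => /andP[].
  pose A := [set x | exists2 n, (N <= n)%N & x = u n].
  have FA : (u @ \oo) A by exists N => // n /= Nn; exists n.
  exists (A, A) => // -[x y] [/= [m Nm ->] [n Nn ->]].
  rewrite -ball_normE /= nr_norm ltcE /= NP // andbT.
  by move: e0; rewrite ltcE => /andP[].
exists (lim (u @ \oo)) => e e0.
have e0' : 0 < e%:C%C :> R[i] by rewrite ltcR.
have [N _ NP] := (@cvgrPdist_lt _ _ _ _ _ u (lim (u @ \oo))).1 uc _ e0'.
exists N => n Nn; have := NP n Nn; rewrite /= nr_norm ltcR.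
by rewrite nrBC.
Qed.

Definition subspace (Y : set X) :=
  Y 0 /\ forall a x y, Y x -> Y y -> Y (a *: x + y).

Definition closed_set (Y : set X) :=
  forall x, (forall e : R, 0 < e -> exists2 y, Y y & nr (y - x) < e) -> Y x.

Lemma subspaceZ Y a x : subspace Y -> Y x -> Y (a *: x).
Proof. by move=> [Y0 YP] Yx; rewrite -[_ *: _]addr0; exact: YP. Qed.
Lemma subspaceD Y x y : subspace Y -> Y x -> Y y -> Y (x + y).
Proof. by move=> [Y0 YP] Yx Yy; rewrite -[x]scale1r; exact: YP. Qed.
Lemma subspaceB Y x y : subspace Y -> Y x -> Y y -> Y (x - y).
Proof. by move=> [Y0 YP] Yx Yy; rewrite addrC -scaleN1r; exact: YP. Qed.

Lemma hilbert_projection Y : subspace Y -> forall x, exists2 p,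
  (forall e : R, 0 < e -> exists2 y, Y y & nr (y - p) < e)
  & forall y, Y y -> ip (x - p) y = 0.
Proof.
move=> [Y0 YP] x.
have cpl (u : nat -> X) : (forall n, [set: X] (u n)) ->
  (forall e : R, 0 < e -> exists N, forall m n, (N <= m)%N -> (N <= n)%N ->
     nr (u m - u n) < e) ->
  exists2 x, [set: X] x & forall e : R, 0 < e -> exists N, forall n,
    (N <= n)%N -> nr (u n - x) < e.
  by move=> _ /hilbert_complete[y yP]; exists y.
have [//|p [_ h1] h2] := projection T3 L3 P3 C3 G3 cpl _ Y0 YP (x := x) I.
by exists p.
Qed.

Lemma closed_projection Y : subspace Y -> closed_set Y -> forall x,
  exists2 p, Y p & forall y, Y y -> ip (x - p) y = 0.
Proof. by move=> sY cY x; have [p /cY] := hilbert_projection sY x; exists p. Qed.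

Definition orth (A : set X) : set X := [set y | forall a, A a -> ip y a = 0].

Lemma orth_subspace A : subspace (orth A).
Proof.
split=> [a _|a x y hx hy z Az]; first by rewrite ip0l.
by rewrite ipDl ipZl hx // hy // mulr0 addr0.
Qed.

Lemma orth_closed A : closed_set (orth A).
Proof.
move=> x h a Aa; apply: cabs_eq0; apply/eqP; rewrite eq_le cabs_ge0 andbT.
apply: le_small => e e0; rewrite add0r.
have a1 : 0 < nr a + 1 by rewrite ltr_wpDl ?nr_ge0.
have [|y yA lt] := h (e / (nr a + 1)); first by rewrite divr_gt0.
rewrite -[x](subrK y) ipDl yA // addr0; apply: le_trans (ip_le _ _) _.
rewrite nrBC; move: lt; rewrite ltr_pdivlMr // => /ltW; apply: le_trans.
by rewrite ler_wpM2l ?nr_ge0 // lerDl.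
Qed.

Lemma closed_projector Y : subspace Y -> closed_set Y ->
  exists P : X -> X, [/\ linear P,
    forall x, Y (P x), forall x y, Y y -> ip (x - P x) y = 0,
    forall x, Y x -> P x = x & forall x, nr (P x) <= nr x].
Proof.
move=> sY cY.
have /boolp.choice[P PP] x : exists p,
    Y p /\ forall y, Y y -> ip (x - p) y = 0.
  by have [p ? ?] := closed_projection sY cY x; exists p.
have P1 x : Y (P x) by have [] := PP x.
have P2 x y : Y y -> ip (x - P x) y = 0 by have [_] := PP x; apply.
have uni x y z : Y y -> Y z ->
    (forall w, Y w -> ip (x - y) w = 0) ->
    (forall w, Y w -> ip (x - z) w = 0) -> y = z.
  move=> Ay Az hy hz; apply/eqP; rewrite -subr_eq0; apply/eqP.
  apply: nr_eq0; apply/eqP; rewrite -sqrf_eq0; apply/eqP.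
  have Ayz := subspaceB sY Ay Az; rewrite nr_sqE {1}(_ : y - z = (x - z) - (x - y)).
    by rewrite ipBl hy // hz // subrr.
  by rewrite opprB [RHS]addrC addrA subrK.
exists P; split => //.
- move=> a x y; apply: (uni (a *: x + y)) => //.
  - by case: sY => _; apply.
  - by move=> w Aw; exact: P2.
  move=> w Aw; rewrite (_ : _ - _ = a *: (x - P x) + (y - P y)).
    by rewrite ipDl ipZl !P2 // mulr0 addr0.
  by rewrite scalerBr opprD addrACA.
- move=> x Ax; apply: (uni x) => // w Aw; first exact: P2.
  by rewrite subrr ip0l.
move=> x; rewrite -(ler_pXn2r (n := 2)) ?nnegrE ?nr_ge0 //.
rewrite -{2}[x](subrK (P x)) sqr_nrD P2 //= mulr0 addr0 lerDr sqr_ge0 //.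
Qed.

Lemma dense_of_orth M : subspace M -> (forall h, orth M h -> h = 0) ->
  forall x (e : R), 0 < e -> exists2 y, M y & nr (y - x) < e.
Proof.
move=> sM hM x e e0; have [p pM xp] := hilbert_projection sM x.
have /subr0_eq -> : x - p = 0 by apply: hM.
exact: pM.
Qed.

Lemma riesz (phi : X -> R[i]) (c : R) :
  (forall a x y, phi (a *: x + y) = a * phi x + phi y) ->
  0 <= c -> (forall x, cabs (phi x) <= c * nr x) ->
  exists2 a, (forall x, phi x = ip x a) & nr a <= c.
Proof.
move=> lphi c0 bphi.
have phi0 : phi 0 = 0.
  by have := lphi (-1) 0 0; rewrite scaler0 addr0 mulN1r addNr.
have phiZ a x : phi (a *: x) = a * phi x by rewrite -[_ *: _]addr0 lphi phi0 addr0.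
have phiB x y : phi (x - y) = phi x - phi y.
  by rewrite addrC -scaleN1r lphi mulN1r addrC.
have [all0|] := pselect (forall x, phi x = 0).
  by exists 0 => [x|]; rewrite ?ip0r ?nr0 ?all0.
move=> /existsNP[x0 /eqP x00].
pose Y := [set x | phi x = 0].
have sY : subspace Y.
  by split=> [|a x y]; rewrite /Y /= // lphi => -> ->; rewrite mulr0 addr0.
have cY : closed_set Y.
  move=> x h; apply: cabs_eq0; apply/eqP; rewrite eq_le cabs_ge0 andbT.
  apply: le_small => e e0; rewrite add0r.
  have c1 : 0 < c + 1 by rewrite ltr_wpDl.
  have [|y yY lt] := h (e / (c + 1)); first by rewrite divr_gt0.
  rewrite -[phi x]subr0 -yY -phiB; apply: le_trans (bphi _) _.
  rewrite nrBC; move: lt; rewrite ltr_pdivlMr // => /ltW; apply: le_trans.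
  by rewrite mulrC ler_wpM2l ?nr_ge0 // lerDl.
have [p pY pP] := closed_projection sY cY x0.
pose z := x0 - p.
have phiz : phi z != 0 by rewrite /z phiB pY subr0.
have z0 : z != 0 by apply: contraNneq phiz => ->; rewrite phi0.
have zz0 : ip z z != 0.
  rewrite ip_sq; apply/eqP => /complexI/eqP; rewrite sqrf_eq0.
  by rewrite gt_eqF // nr_gt0.
pose a := (phi z / ip z z)^* *: z.
have phia x : phi x = ip x a.
  have : Y (x - (phi x / phi z) *: z).
    by rewrite /Y /= phiB phiZ divfK // subrr.
  move=> /pP; rewrite -/z => /(congr1 (fun w => w^*)); rewrite -ipC conjC0.
  rewrite ipBl ipZl => /eqP; rewrite subr_eq0 => /eqP E.
  by rewrite /a ipZr conjCK E; field; apply/andP.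
exists a => //; have [a0|a0] := eqVneq a 0; first by rewrite a0 nr0.
rewrite -(ler_pM2r (nr_gt0 a0)); apply: le_trans (bphi a).
by rewrite phia ip_sq cabs_real ger0_norm ?sqr_ge0.
Qed.

End hilbert_space.

(* An identity between vectors is checked by pairing it with a generic vector. *)
Ltac vec := apply: ip_inj => ?;
  rewrite ?(ipDl, ipZl, ipNl, ip0l); first [ring | field].

Section operators.
Context {R : realType}.

Definition blin (X Y : hilbert R) (f : X -> Y) :=
  linear f /\ exists2 c : R, 0 <= c & forall x, nr (f x) <= c * nr x.

Lemma blin_comp (X Y Z : hilbert R) (f : Y -> Z) (g : X -> Y) :
  blin f -> blin g -> blin (f \o g).
Proof.
move=> [lf [c c0 fc]] [lg [d d0 gd]]; split.
  by move=> a x y /=; rewrite lg lf.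
exists (c * d); first exact: mulr_ge0.
by move=> x /=; apply: le_trans (fc _) _; rewrite -mulrA ler_wpM2l.
Qed.

Lemma blin_add (X Y : hilbert R) (f g : X -> Y) :
  blin f -> blin g -> blin (fun x => f x + g x).
Proof.
move=> [lf [c c0 fc]] [lg [d d0 gd]]; split.
  by move=> a x y; rewrite lf lg scalerDr addrACA.
exists (c + d); first exact: addr_ge0.
by move=> x; apply: le_trans (nrD _ _) _; rewrite mulrDl lerD.
Qed.

Lemma blin_scale (X Y : hilbert R) (f : X -> Y) (b : R[i]) :
  blin f -> blin (fun x => b *: f x).
Proof.
move=> [lf [c c0 fc]]; split.
  by move=> a x y; rewrite lf scalerDr !scalerA mulrC.
exists (cabs b * c); first by rewrite mulr_ge0 ?cabs_ge0.
by move=> x; rewrite nrZ -mulrA ler_wpM2l ?cabs_ge0.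
Qed.

Lemma blin_id (X : hilbert R) : blin (fun x : X => x).
Proof. by split=> //; exists 1 => // x; rewrite mul1r. Qed.

Lemma blin_sub (X Y : hilbert R) (f g : X -> Y) :
  blin f -> blin g -> blin (fun x => f x - g x).
Proof.
move=> bf bg; have := blin_add bf (blin_scale (-1) bg).
by under [X in blin X -> _]eq_fun do rewrite scaleN1r.
Qed.

Lemma blin_adjoint (X Y : hilbert R) (f : X -> Y) : blin f ->
  exists2 g : Y -> X, blin g & forall x y, ip (f x) y = ip x (g y).
Proof.
move=> [lf [c c0 fc]].
have /boolp.choice[g gP] y : exists a,
    (forall x, ip (f x) y = ip x a) /\ nr a <= c * nr y.
  have [||x|a aP ac] := @riesz _ X (fun x => ip (f x) y) (c * nr y).
  - by move=> a x z; rewrite lf ipDl ipZl.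
  - by rewrite mulr_ge0 ?nr_ge0.
  - apply: le_trans (ip_le _ _) _; rewrite mulrAC ler_wpM2r ?nr_ge0 //.
  by exists a.
have g1 x y : ip (f x) y = ip x (g y) by have [h _] := gP y; apply: h.
exists g => //; split; last by exists c => // y; have [] := gP y.
move=> a x y; apply/eqP; rewrite -subr_eq0; apply/eqP.
set d := _ - _; have : ip d d = 0.
  rewrite {2}/d ipBr -g1 ipDr ipZr !ipDr !ipZr -!g1 subrr //.
by rewrite ip_sq => /complexI/eqP; rewrite sqrf_eq0 => /eqP/nr_eq0.
Qed.

(* Compactness in the form of a cluster point, which passes through
   compositions without extracting subsequences. *)
Definition cptop (X Y : hilbert R) (K : X -> Y) :=
  linear K /\ forall u : nat -> X, (forall n, nr (u n) <= 1) ->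
    exists y, forall (e : R) N, 0 < e -> exists2 n, (N <= n)%N & nr (K (u n) - y) < e.

Lemma cptop_seq (X Y : hilbert R) (K : X -> Y) (c : R) (u : nat -> X) : cptop K ->
  (forall n, nr (u n) <= c) ->
  exists y, forall (e : R) N, 0 < e -> exists2 n, (N <= n)%N & nr (K (u n) - y) < e.
Proof.
move=> [lK cK] uc; pose d := `|c| + 1.
have d0 : 0 < d by rewrite ltr_wpDl.
have d1 : d%:C%C != 0 :> R[i] by rewrite eq_complex /= gt_eqF.
have [|y yP] := cK (fun n => d^-1%:C%C *: u n).
  move=> n; rewrite nrZ cabs_real ger0_norm ?invr_ge0 ?(ltW d0) //.
  rewrite mulrC ler_pdivrMr // mul1r; apply: le_trans (uc n) _.
  by rewrite (le_trans (ler_norm c)) // lerDl.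
exists (d%:C%C *: y) => e N e0.
have [|n Nn lt] := yP (e / d) N; first by rewrite divr_gt0.
exists n => //; move: lt; rewrite linZ // ltr_pdivlMr // => lt.
rewrite -[K _](scalerKV d1) -scalerBr nrZ cabs_real ger0_norm ?(ltW d0) //.
by rewrite -fmorphV mulrC.
Qed.

Lemma cptop_blin (X Y : hilbert R) (K : X -> Y) : cptop K -> blin K.
Proof.
move=> cK; have [lK _] := cK; split=> //; apply: contrapT => nb.
have /boolp.choice[u uP] (n : nat) : exists x, nr x <= 1 /\ n%:R < nr (K x).
  apply: contrapT => h; apply: nb; exists n%:R => // x.
  have [->|x0] := eqVneq x 0; first by rewrite (lin0 lK) !nr0 mulr0.
  rewrite leNgt; apply/negP => lt; apply: h.
  exists ((nr x)^-1%:C%C *: x); rewrite nr_normalize //; split=> //.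
  rewrite linZ // nrZ cabs_real ger0_norm ?invr_ge0 ?nr_ge0 //.
  by rewrite mulrC ltr_pdivlMr // nr_gt0.
have [|y yP] := cptop_seq (c := 1) (u := u) cK; first by move=> n; case: (uP n).
have [n] := yP 1 (Num.truncn (nr y + 1)).+1 ltr01.
rewrite -(ler_nat R) => /(lt_le_trans (truncnS_gt _)) h lt.
have [_] := uP n; have := nr_subr (K (u n)) y => h1 h2.
by have := lt_trans h h2; move: h1 lt; clear; lra.
Qed.

Lemma cptop_compl (X Y Z : hilbert R) (f : Y -> Z) (K : X -> Y) :
  blin f -> cptop K -> cptop (f \o K).
Proof.
move=> [lf [c c0 fc]] [lK cK]; split; first by move=> a x y /=; rewrite lK lf.
move=> u /cK[y yP]; exists (f y) => e N e0.
have c1 : 0 < c + 1 by rewrite ltr_wpDl.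
have [|n Nn lt] := yP (e / (c + 1)) N; first by rewrite divr_gt0.
exists n => //=; rewrite -linB //; apply: le_lt_trans (fc _) _.
move: lt; rewrite ltr_pdivlMr //; apply: le_lt_trans.
by rewrite mulrC ler_wpM2l ?nr_ge0 // lerDl.
Qed.

Lemma cptop_compr (X Y Z : hilbert R) (K : Y -> Z) (f : X -> Y) :
  cptop K -> blin f -> cptop (K \o f).
Proof.
move=> cK [lf [c c0 fc]]; have [lK _] := cK.
split; first by move=> a x y /=; rewrite lf lK.
move=> u u1; apply: (cptop_seq (u := f \o u) (c := c)) => // n.
by apply: le_trans (fc _) _; rewrite ler_piMr.
Qed.

Lemma cptop_scale (X Y : hilbert R) (K : X -> Y) a :
  cptop K -> cptop (fun x => a *: K x).
Proof. by move=> cK; exact: (cptop_compl (blin_scale a (blin_id Y)) cK). Qed.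

(** The cluster points for [K1] and [K2] need not be approached along the same indices, so here
    indices [s n] are extracted along which [K1] converges, before [K2] is used. *)
Lemma cptop_add (X Y : hilbert R) (K1 K2 : X -> Y) :
  cptop K1 -> cptop K2 -> cptop (fun x => K1 x + K2 x).
Proof.
move=> [l1 c1] [l2 c2]; split.
  by move=> a x y; rewrite l1 l2 scalerDr addrACA.
move=> u u1; have [y yP] := c1 u u1.
have /boolp.choice[s sP] (n : nat) : exists k,
    (n <= k)%N /\ nr (K1 (u k) - y) < n.+1%:R^-1.
  by have [|k ? ?] := yP n.+1%:R^-1 n; [rewrite invr_gt0|exists k].
have [|z zP] := c2 (u \o s); first by move=> n; exact: u1.
exists (y + z) => e N e0; have e2 : 0 < e / 2 by rewrite divr_gt0.
have [M MP] := inv_natS_lt e2.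
have [n Nn lt] := zP (e / 2) (maxn N M) e2.
have [sn lt1] := sP n; exists (s n).
  by apply: leq_trans sn; apply: leq_trans Nn; exact: leq_maxl.
rewrite opprD addrACA; apply: le_lt_trans (nrD _ _) _.
rewrite [e]splitr ltrD //; apply: lt_trans lt1 (MP _ _).
by apply: leq_trans Nn; exact: leq_maxr.
Qed.

Lemma compact_operator_cptop (X Y : hilbert R) (K : X -> Y) :
  compact_operator K -> cptop K.
Proof.
move=> [lK cK]; split=> // u u1.
have [|y [_ yP]] := cK (((K \o u) @ \oo) : set_system Y) _.
  by exists 0%N => // n _ /=; apply: subset_closure; exists (u n) => //=; rewrite nr_norm lecR.
exists y => e N e0.
have e0' : 0 < e%:C%C :> R[i] by rewrite ltcR.
pose A := [set z | exists2 n, (N <= n)%N & z = K (u n)].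
have [||_ [[n Nn ->]]] := yP A (ball y e%:C%C).
- by exists N => // n /= Nn; exists n.
- exact: nbhsx_ballx.
by rewrite -ball_normE /= nr_norm ltcR nrBC => lt; exists n.
Qed.

End operators.

(** * Fredholm theory *)

Section compact_operators.
Context {R : realType} {X : hilbert R}.
Implicit Types (x y z : X) (B K : X -> X).

Lemma unit_orthogonal (Y Z : set X) x : subspace Y -> closed_set Y ->
  subspace Z -> Y `<=` Z -> Z x -> ~ Y x ->
  exists e, [/\ Z e, nr e = 1 & forall y, Y y -> ip e y = 0].
Proof.
move=> sY cY sZ YZ Zx Yx; have [p Yp pP] := closed_projection sY cY x.
have d0 : x - p != 0.
  by rewrite subr_eq0; apply: contra_notN Yx => /eqP ->.
exists ((nr (x - p))^-1%:C%C *: (x - p)); split.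
- by apply: subspaceZ => //; apply: subspaceB => //; exact: YZ.
- exact: nr_normalize.
by move=> y Yy; rewrite ipZl pP // mulr0.
Qed.

Lemma nr_ge_orth (e w : X) (c : R[i]) : nr e = 1 -> ip e w = 0 ->
  cabs c <= nr (c *: e + w).
Proof.
move=> e1 ew; rewrite -(ler_pXn2r (n := 2)) ?nnegrE ?cabs_ge0 ?nr_ge0 //.
rewrite sqr_nrD ipZl ew mulr0 /= mulr0 addr0 nrZ e1 mulr1.
by rewrite lerDl sqr_ge0.
Qed.

Lemma cptop_separated K (u : nat -> X) (d : R) : cptop K -> 0 < d ->
  (forall n, nr (u n) <= 1) ->
  (forall m n, (m < n)%N -> d <= nr (K (u m) - K (u n))) -> False.
Proof.
move=> [_ cK] d0 /cK[y yP] h; have d2 : 0 < d / 2 by rewrite divr_gt0.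
have [m _ hm] := yP _ 0%N d2; have [n mn hn] := yP _ m.+1 d2.
have := h m n mn; apply/negP; rewrite -ltNge.
by apply: le_lt_trans (nr_trans y _ _) _; rewrite [d]splitr ltrD // nrBC.
Qed.

(** Unit vectors with [x - K x] tending to 0 would accumulate, through [K], at a vector fixed by
    [K]; by injectivity it is 0, which is not a limit of unit vectors. *)
Lemma cptop_bounded_below K : cptop K -> (forall x, x = K x -> x = 0) ->
  exists2 c : R, 0 < c & forall x, nr x <= c * nr (x - K x).
Proof.
move=> cK inj; have [lK _] := cK; have [_ [b b0 Kb]] := cptop_blin cK.
apply: contrapT => nb.
have /boolp.choice[u uP] (n : nat) : exists x,
    nr x = 1 /\ nr (x - K x) < n.+1%:R^-1.
  apply: contrapT => h; apply: nb; exists n.+1%:R => [|x]; first by rewrite ltr0n.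
  have [->|x0] := eqVneq x 0; first by rewrite nr0 mulr_ge0 ?nr_ge0.
  rewrite leNgt; apply/negP => lt; apply: h.
  exists ((nr x)^-1%:C%C *: x); rewrite nr_normalize //; split=> //.
  rewrite (linZ lK) -scalerBr nrZ cabs_real ger0_norm ?invr_ge0 ?nr_ge0 //.
  rewrite mulrC ltr_pdivrMr ?nr_gt0 // [_^-1 * _]mulrC ltr_pdivlMr ?ltr0n //.
  by rewrite mulrC.
have [|y yP] := cptop_seq (c := 1) (u := u) cK; first by move=> n; case: (uP n) => ->.
have near (e : R) : 0 < e -> exists n, nr (u n - y) < e /\ nr (u n - K (u n)) < e.
  move=> e0; have e2 : 0 < e / 2 by rewrite divr_gt0.
  have [N NP] := inv_natS_lt e2; have [n Nn lt] := yP _ N e2.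
  have [_ lt2] := uP n; have lt3 := lt_trans lt2 (NP _ Nn); exists n; split.
    by apply: le_lt_trans (nr_trans (K (u n)) _ _) _; rewrite [e]splitr ltrD.
  by apply: lt_le_trans lt3 _; rewrite ler_pdivrMr // ler_peMr ?ler1n // ltW.
have y0 : y = 0.
  apply: inj; apply/eqP; rewrite -subr_eq0; apply/eqP; apply: nr_small => e e0.
  have b2 : 0 < b + 2 by rewrite ltr_wpDl.
  have [|n [h1 h2]] := near (e / (b + 2)); first by rewrite divr_gt0.
  have -> : y - K y = (u n - K (u n)) - ((u n - y) - K (u n - y)).
    by rewrite (linB lK); vec.
  apply: le_trans (nrB _ _) _; apply: le_trans (lerD (ltW h2) (nrB _ _)) _.
  have := Kb (u n - y); have bh : b * nr (u n - y) <= b * (e / (b + 2)).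
    by rewrite ler_wpM2l // ltW.
  move=> h3; have {h3 bh} h3 := le_trans h3 bh.
  apply: le_trans (lerD (lexx _) (lerD (ltW h1) h3)) _.
  rewrite (_ : e / _ + _ = e) //; field; exact: lt0r_neq0.
have [n [lt _]] := near 1 ltr01; move: lt; rewrite y0 subr0.
by have [-> _] := uP n; rewrite ltxx.
Qed.

Lemma iter_linear (f : X -> X) n : linear f -> linear (iter n f).
Proof. by move=> lf; elim: n => [//|n ih] a x y /=; rewrite ih lf. Qed.

Lemma range_closed (f : X -> X) (c : R) : blin f -> 0 < c ->
  (forall x, nr x <= c * nr (f x)) -> closed_set (range f).
Proof.
move=> [lf [b b0 fb]] c0 fc y h.
have /boolp.choice[u uP] (n : nat) : exists x, nr (f x - y) < n.+1%:R^-1.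
  by have [|_ [x _ <-] lt] := h n.+1%:R^-1; [rewrite invr_gt0|exists x].
have [|x xP] := @hilbert_complete _ _ u.
  move=> e e0; have ec : 0 < e / c / 2 by rewrite !divr_gt0.
  have [N NP] := inv_natS_lt ec; exists N => m n Nm Nn.
  apply: le_lt_trans (fc _) _; rewrite -ltr_pdivlMl // mulrC [e / c]splitr.
  rewrite linB //; apply: le_lt_trans (nr_trans y _ _) _.
  by rewrite ltrD // ?[nr (y - _)]nrBC; apply: lt_trans (uP _) (NP _ _).
exists x => //; apply/eqP; rewrite -subr_eq0; apply/eqP; apply: nr_small => e e0.
have b1 : 0 < b + 1 by rewrite ltr_wpDl.
have e1 : 0 < e / (b + 1) by rewrite divr_gt0.
have [N NP] := xP _ e1; have [M MP] := inv_natS_lt e1.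
pose n := maxn N M; apply: le_trans (nr_trans (f (u n)) _ _) _.
have h1 := NP n (leq_maxl _ _).
have h2 := lt_trans (uP n) (MP n (leq_maxr _ _)).
have h3 : nr (f x - f (u n)) <= b * (e / (b + 1)).
  by rewrite -linB //; apply: le_trans (fb _) _; rewrite ler_wpM2l // nrBC ltW.
apply: le_trans (lerD h3 (ltW h2)) _.
by rewrite -{2}[e / _]mul1r -mulrDl mulrCA divff ?mulr1 // gt_eqF.
Qed.

Lemma iter_blin (f : X -> X) n : blin f -> blin (iter n f).
Proof.
by move=> bf; elim: n => [|n ih]; [exact: blin_id|exact: (blin_comp bf ih)].
Qed.

(** Riesz's argument: if [y] were missed by [F], injectivity would make the ranges of the iterates
    of [F] strictly decreasing. Unit vectors [e n] of the [n]-th range orthogonal to the next one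
    would then have images under [K] at mutual distance at least 1, because [K (e m)] is [e m] up to
    the range [m.+1]. *)
Theorem fredholm K : cptop K -> (forall x, x = K x -> x = 0) ->
  exists2 G : X -> X, blin G &
    (forall x, G (x - K x) = x) /\ (forall y, G y - K (G y) = y).
Proof.
move=> cK inj; have [c c0 cP] := cptop_bounded_below cK inj.
have [lK _] := cK; pose F x := x - K x.
have bF : blin F by apply: blin_sub; [exact: blin_id|exact: cptop_blin].
have lF : linear F by case: bF.
have F0 x : F x = 0 -> x = 0 by move=> /subr0_eq; exact: inj.
have Fi n x : iter n F x = 0 -> x = 0.
  by elim: n => [//|n ih] /= /F0.
pose rng n := range (iter n F).
have srng n : subspace (rng n).
  split; first by exists 0 => //; rewrite (lin0 (iter_linear n lF)).
  move=> a x y [x' _ <-] [y' _ <-]; exists (a *: x' + y') => //.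
  exact: iter_linear.
have crng n : closed_set (rng n).
  apply: (@range_closed _ (c ^+ n)); [exact: iter_blin|exact: exprn_gt0|].
  move=> x; elim: n => [|n ih] /=; first by rewrite mul1r.
  apply: le_trans ih _; rewrite exprSr -mulrA ler_wpM2l ?exprn_ge0 ?(ltW c0) //.
have rngD m n : (m <= n)%N -> rng n `<=` rng m.
  move=> /subnKC <- _ [x _ <-]; exists (iter (n - m) F x) => //.
  by rewrite iterD.
have surj y : exists x, F x = y.
  apply: contrapT => ny.
  have /boolp.choice[e eP] n : exists e, [/\ rng n e, nr e = 1 &
      forall y, rng n.+1 y -> ip e y = 0].
    apply: (@unit_orthogonal _ _ (iter n F y)) => //; [exact: rngD|by exists y|].
    move=> [x _]; rewrite iterSr => /eqP.
    rewrite -subr_eq0 -(linB (iter_linear n lF)) => /eqP/Fi/subr0_eq Fx.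
    by apply: ny; exists x.
  apply: (@cptop_separated K e 1) => // [n|m n mn]; first by case: (eP n) => _ ->.
  have [rm em hm] := eP m; have [rn en _] := eP n.
  rewrite (_ : K (e m) - K (e n) = 1 *: e m + - (F (e m) + (e n - F (e n)))).
    rewrite -cabs1; apply: nr_ge_orth => //; rewrite ipNr hm ?oppr0 //.
    apply: subspaceD => //; last apply: subspaceB => //.
    - by case: rm => x _ <-; exists x.
    - exact: (rngD m.+1 n).
    apply: (rngD m.+1 n.+1); first exact: ltnW.
    by case: rn => x _ <-; exists x.
  by rewrite /F; vec.
have /boolp.choice[G GP] := surj.
have GF x : G (F x) = x.
  by apply/eqP; rewrite -subr_eq0; apply/eqP/F0; rewrite linB // GP subrr.
exists G; last by [].
split.
  move=> a x y; apply/eqP; rewrite -subr_eq0; apply/eqP/F0.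
  by rewrite linB // GP lF !GP subrr.
by exists c => [|y]; [exact: ltW|rewrite -{2}[y]GP cP].
Qed.

(** The product of the first [n] shifts, the last one acting first: the shift by [mu n] then sends
    the kernel for [n.+1] into the kernel for [n] by definition. *)
Fixpoint chain B (mu : nat -> R[i]) n x :=
  if n is n'.+1 then chain B mu n' (B x - mu n' *: x) else x.

Lemma blin_shift B (mu : R[i]) : blin B -> blin (fun x => B x - mu *: x).
Proof.
by move=> bB; apply: blin_sub => //; exact: (blin_scale _ (blin_id X)).
Qed.

Lemma blin_chain B mu n : blin B -> blin (chain B mu n).
Proof.
move=> bB; elim: n => [|n ih]; first exact: blin_id.
exact: (blin_comp ih (blin_shift _ bB)).
Qed.

Lemma chain_comm B mu n x : blin B -> chain B mu n (B x) = B (chain B mu n x).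
Proof.
move=> bB; have [lB _] := bB; elim: n x => [//|n ih] x /=.
by rewrite -ih (linB lB) (linZ lB).
Qed.

(* Covers at once the ascent of [B - mu] (constant [mu]) and the discreteness
   of the nonzero eigenvalues (pairwise distinct [mu n]). *)
Lemma chain_stationary B mu (d : R) : cptop B -> 0 < d ->
  (forall n, d <= cabs (mu n)) ->
  exists n, forall x, chain B mu n.+1 x = 0 -> chain B mu n x = 0.
Proof.
move=> cB d0 dmu; apply: contrapT => h.
have bB := cptop_blin cB; have [lB _] := bB.
have bC n := blin_chain mu n bB; have lC n : linear (chain B mu n) by case: (bC n).
pose ker n := [set x | chain B mu n x = 0].
have sker n : subspace (ker n).
  split=> [|a x y]; rewrite /ker /=; first exact: lin0.
  by rewrite lC => -> ->; rewrite scaler0 addr0.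
have cker n : closed_set (ker n).
  move=> x hx; apply: nr_small => e e0; have [_ [c c0 cP]] := bC n.
  have c1 : 0 < c + 1 by rewrite ltr_wpDl.
  have [|y yk lt] := hx (e / (c + 1)); first by rewrite divr_gt0.
  rewrite -[chain _ _ _ _]subr0 -yk -(linB (lC n)); apply: le_trans (cP _) _.
  rewrite nrBC; move: lt; rewrite ltr_pdivlMr // => /ltW; apply: le_trans.
  by rewrite mulrC ler_wpM2l ?nr_ge0 // lerDl.
have kerB n x : ker n x -> ker n (B x).
  by rewrite /ker /= chain_comm // => ->; rewrite (lin0 lB).
have kerS n : ker n `<=` ker n.+1.
  move=> x kx; rewrite /ker /= (linB (lC n)) (linZ (lC n)) (kerB _ _ kx) kx.
  by rewrite scaler0 subrr.
have ker_le m n : (m <= n)%N -> ker m `<=` ker n.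
  move=> /subnK <-; elim: (n - m)%N => [//|k ih] x /ih.
  by rewrite addSn; exact: kerS.
have /boolp.choice[e eP] n : exists e, [/\ ker n.+1 e, nr e = 1 &
    forall y, ker n y -> ip e y = 0].
  have [x [x1 x2]] : exists x, ker n.+1 x /\ ~ ker n x.
    apply: contrapT => h'; apply: h; exists n => x hx.
    by apply: contrapT => h2; apply: h'; exists x.
  exact: (@unit_orthogonal _ _ x).
apply: (@cptop_separated B e d) => // [n|m n mn]; first by case: (eP n) => _ ->.
have [km em _] := eP m; have [kn en hn] := eP n.
rewrite nrBC (_ : _ - _ = mu n *: e n + ((B (e n) - mu n *: e n) - B (e m))).
  apply: le_trans (dmu n) _; apply: nr_ge_orth => //; apply: hn.
  by apply: subspaceB => //; apply: kerB; exact: (ker_le m.+1).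
by vec.
Qed.

Lemma chain_eigen B mu n (l : R[i]) x : linear B -> B x = l *: x ->
  chain B mu n x = (\prod_(i < n) (l - mu i)) *: x.
Proof.
move=> lB Bx; elim: n => [|n ih] /=; first by rewrite big_ord0 scale1r.
have lC k : linear (chain B mu k).
  elim: k => [//|k ihk] a y z /=; rewrite -ihk; congr chain.
  by rewrite lB; vec.
rewrite Bx -scalerBl (linZ (lC n)) ih scalerA big_ord_recr /=; congr (_ *: _).
exact: mulrC.
Qed.

(** An injective sequence of such eigenvalues would contradict [chain_stationary]: an eigenvector
    for its [n]-th term is killed by the first [n.+1] factors but not by the first [n]. *)
Theorem cptop_eigenvalues_finite B (d : R) : cptop B -> 0 < d ->
  finite_set [set mu : R[i] | d <= cabs mu /\ exists2 x, x != 0 & B x = mu *: x].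
Proof.
move=> cB d0; set S := [set mu | _]; apply: contrapT => inf.
have /infiniteP/card_leP[g] : infinite_set S by [].
pose f (n : nat) : R[i] := set_val (g (to_setT n)).
have fS n : S (f n) by exact: set_mem (valP _).
have finj m n : f m = f n -> m = n.
  by move=> /val_inj/inj => /(_ (mem_setT _) (mem_setT _)) [].
have [n nP] := @chain_stationary B f d cB d0 (fun n => (fS n).1).
have [_ [x x0 Bx]] := fS n; have [lB _] := cB.
have := nP x; rewrite !(@chain_eigen _ _ _ (f n)) // big_ord_recr /= subrr mulr0 scale0r.
move=> /(_ erefl)/eqP; rewrite scaler_eq0 (negbTE x0) orbF.
move=> /prodf_eq0[i _]; rewrite subr_eq0 => /eqP/finj E.
by have := ltn_ord i; rewrite -E ltnn.
Qed.

Lemma chain_const B mu n x :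
  chain B (fun=> mu) n x = iter n (fun y => B y - mu *: y) x.
Proof. by elim: n x => [//|n ih] x; rewrite iterSr /= ih. Qed.

(** Expanding the power leaves a nonzero scalar plus terms containing [B]; this brings powers of
    [B - mu] within reach of [fredholm]. *)
Lemma iter_shift_compact B (mu : R[i]) n : cptop B -> mu != 0 ->
  exists (c : R[i]) K, [/\ c != 0, cptop K &
    forall x, iter n (fun y => B y - mu *: y) x = c *: (x - K x)].
Proof.
move=> cB mu0; have [lB _] := cB.
elim: n => [|n [c [K [c0 cK E]]]].
  exists 1, (fun x => 0 *: B x); split=> //; first exact: cptop_scale.
  by move=> x; rewrite scale0r subr0 scale1r.
exists (- mu * c), (fun x => K x + mu^-1 *: (B x + -1 *: B (K x))); split.
- by rewrite mulf_neq0 // oppr_eq0.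
- apply: cptop_add => //; apply: cptop_scale; apply: cptop_add => //.
  by apply: cptop_scale; apply: (cptop_compl _ cK); exact: cptop_blin.
by move=> x; rewrite iterS E (linZ lB) (linB lB); vec.
Qed.

(** For [k] beyond the point where the kernels stabilise, the [k]-th power of [B - mu] is a multiple
    of some [1 - K]. Adding the projection [P] onto its kernel gives an onto map, so [x] is the sum
    of a vector in the range of [B - mu] and a root vector. Being an eigenvector of [Bs] for [mu^*],
    [x] is orthogonal to the first; by hypothesis it is orthogonal to the second. *)
Theorem root_vectors_orthogonal B Bs (mu : R[i]) x : cptop B ->
  (forall y z, ip (B y) z = ip y (Bs z)) -> mu != 0 -> Bs x = mu^* *: x ->
  (forall n y, iter n (fun y => B y - mu *: y) y = 0 -> ip x y = 0) -> x = 0.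
Proof.
move=> cB adj mu0 Bsx xroot; have bB := cptop_blin cB; have [lB _] := bB.
pose C y := B y - mu *: y.
have lC : linear C by case: (blin_shift mu bB).
have [||k0 kP0] := @chain_stationary B (fun=> mu) (cabs mu) cB.
- exact: cabs_gt0.
- by [].
pose k := k0.+1.
have kP y : iter k.+1 C y = 0 -> iter k C y = 0.
  rewrite /k !iterSr => h; have := kP0 (C y); rewrite !chain_const.
  by rewrite iterSr; apply.
have kP2 j y : iter (j + k) C y = 0 -> iter k C y = 0.
  elim: j y => [//|j ih] y; rewrite addSn iterSr => /ih.
  by rewrite -iterSr; exact: kP.
have [c [K [c0 cK EK]]] := iter_shift_compact k cB mu0; have [lK _] := cK.
have lCk : linear (iter k C) by exact: iter_linear.
pose Y := [set y | y = K y].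
have YE y : Y y <-> iter k C y = 0.
  rewrite EK; split=> [yE|/eqP]; first by rewrite -yE subrr scaler0.
  by rewrite scaler_eq0 (negbTE c0) subr_eq0 => /eqP.
have sY : subspace Y.
  split=> [|a y z]; rewrite /Y /=; first by rewrite (lin0 lK).
  by move=> yE zE; rewrite lK -yE -zE.
have cY : closed_set Y.
  move=> y hy; apply/eqP; rewrite -subr_eq0; apply/eqP; apply: nr_small => e e0.
  have [_ [b b0 bP]] : blin (fun z => z - K z).
    by apply: blin_sub; [exact: blin_id|exact: cptop_blin].
  have b1 : 0 < b + 1 by rewrite ltr_wpDl.
  have [|z zY lt] := hy (e / (b + 1)); first by rewrite divr_gt0.
  rewrite (_ : y - K y = (y - z) - K (y - z)); last first.
    by rewrite (linB lK) -[K z]zY; vec.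
  apply: le_trans (bP _) _; rewrite nrBC.
  move: lt; rewrite ltr_pdivlMr // => /ltW; apply: le_trans.
  by rewrite mulrC ler_wpM2l ?nr_ge0 // lerDl.
have [P [lP PY Porth Pid Ple]] := closed_projector sY cY.
have bP : blin P by split=> //; exists 1 => // y; rewrite mul1r.
pose K1 y := K (y - P y).
have K1E y : y - K1 y = (y - K y) + P y.
  by rewrite /K1 (linB lK) -[K (P y)](PY y); vec.
have cK1 : cptop K1.
  by apply: (cptop_compr cK); apply: blin_sub => //; exact: blin_id.
have [|G _ [_ GK]] := fredholm cK1.
  move=> y yE; have E : y - K y = - P y.
    by apply/eqP; rewrite -addr_eq0 -K1E -yE subrr.
  (* Since [y - K y = - P y] lies in the kernel of the [k]-th power, [y] is killed by the power
     [k + k], and stabilisation puts [y] itself in that kernel, where [P] is the identity. *)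
  have : iter (k + k) C y = 0.
    rewrite iterD [X in iter k C X]EK (linZ lCk) E (linN lCk) (YE _).1 //.
    by rewrite oppr0 scaler0.
  move=> /kP2 /YE Yy; rewrite -[y]Pid //; apply/eqP.
  by rewrite -oppr_eq0 -E subr_eq0; apply/eqP.
have orthC z : ip x (C z) = 0.
  rewrite /C ipBr ipZr (ipC (B z)) adj -ipC Bsx ipZl subrr //.
have := GK x; rewrite K1E => Ex.
apply: nr_eq0; apply/eqP; rewrite -sqrf_eq0 nr_sqE -{2}Ex ipDr.
rewrite (xroot k (P (G x))) ?addr0; last by apply/YE.
have -> : G x - K (G x) = c^-1 *: iter k C (G x) by rewrite EK scalerA mulVf // scale1r.
by rewrite ipZr /k iterS orthC mulr0.
Qed.

End compact_operators.

(** * Resolvents of finite rank operators *)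

Section schur_weyl.
Context {R : realType} {X : hilbert R}.
Local Open Scope sesquilinear_scope.

(** In the coordinates [ip x (a k)], the operator [x |-> \sum_i ip x (a i) *: b i] acts by this
    matrix, which therefore carries its nonzero eigenvalues. *)
Definition cross_gram n (a b : 'I_n -> X) : 'M[R[i]]_n :=
  \matrix_(k, l) ip (b l) (a k).

Lemma unitary_family n (P : 'M[R[i]]_n) (b : 'I_n -> X) : P \is unitarymx ->
  \sum_i nr (\sum_l (P i l)^* *: b l) ^+ 2 = \sum_l nr (b l) ^+ 2.
Proof.
move=> uP; have PP := mulmx1C (unitarymxP uP).
apply: complexI; rewrite !rmorph_sum /=.
under eq_bigr do rewrite -ip_sq; under [RHS]eq_bigr do rewrite -ip_sq.
have E i : ip (\sum_l (P i l)^* *: b l) (\sum_l (P i l)^* *: b l) =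
    \sum_l \sum_m ((P i l)^* * P i m) * ip (b l) (b m).
  rewrite ip_suml; apply: eq_bigr => l _; rewrite ip_sumr; apply: eq_bigr => m _.
  by rewrite ipZl ipZr conjCK mulrA.
under eq_bigr do rewrite E; rewrite exchange_big /=; apply: eq_bigr => l _.
rewrite exchange_big /= (bigD1 l) //= [X in _ + X]big1 ?addr0 => [|m ml].
  rewrite -mulr_suml [X in X * _](_ : _ = 1) ?mul1r //.
  have := congr1 (fun M : 'M[R[i]]_n => M l l) (PP); rewrite !mxE eqxx mulr1n => <-.
  by apply: eq_bigr => i _; rewrite !mxE.
rewrite -mulr_suml [X in X * _](_ : _ = 0) ?mul0r //.
have := congr1 (fun M : 'M[R[i]]_n => M l m) (PP); rewrite !mxE eq_sym (negbTE ml) mulr0n => h; rewrite -[RHS]h.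
by apply: eq_bigr => i _; rewrite !mxE.
Qed.

(** After unitary triangularisation the diagonal entries are inner products of the two families
    rotated by [P]. Rotation preserves the sums of squares, and [|<b, a>| <= (|a|^2 + |b|^2) / 2]
    gives the bound: a substitute for Weyl's inequality between eigenvalues and singular values. *)
Lemma cross_gram_schur n (a b : 'I_n -> X) (nu : R) :
  \sum_i nr (a i) ^+ 2 <= nu -> \sum_i nr (b i) ^+ 2 <= nu ->
  exists t : 'I_n -> R[i], [/\ \det (1%:M - cross_gram a b) = \prod_i (1 - t i),
    \sum_i cabs (t i) <= nu
  & forall i, exists2 c : 'cV[R[i]]_n, c != 0 & cross_gram a b *m c = t i *: c].
Proof.
move=> ha hb; have [n0|n_gt0] := posnP n.
  subst n; exists (fun=> 0); split=> [| |[]//]; first by rewrite det_mx00 big_ord0.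
  by rewrite big_ord0 in ha; rewrite big_ord0.
set A := cross_gram a b; have [P uP tP] := Schur A n_gt0.
pose T := conjmx P A.
have TE : T = P *m A *m P^t* by rewrite /T conjymx.
have shift z : \det (z%:M - A) = \prod_i (z - T i i).
  have -> : \det (z%:M - A) = \det (z%:M - T).
    rewrite TE; have PP : P *m P^t* = 1%:M by exact/unitarymxP.
    have -> : z%:M - P *m A *m P^t* = P *m (z%:M - A) *m P^t*.
      by rewrite mulmxBr mulmxBl mul_mx_scalar -scalemxAl PP scalemx1.
    by rewrite !det_mulmx mulrAC -det_mulmx PP det1 mul1r.
  rewrite det_trig; last first.
    have /is_trig_mxP tr : is_trig_mx T by [].
    apply/is_trig_mxP => i j ij; rewrite mxE [X in X + _]mxE [X in _ + X]mxE tr //.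
    by rewrite (_ : i == j = false) ?subrr // -val_eqE ltn_eqF.
  by apply: eq_bigr => i _; rewrite mxE [X in X + _]mxE [X in _ + X]mxE eqxx.
exists (fun i => T i i); split; first exact: shift.
- have bound i : cabs (T i i) <=
      2^-1 * nr (\sum_l (P i l)^* *: b l) ^+ 2 + 2^-1 * nr (\sum_l (P i l)^* *: a l) ^+ 2.
    have -> : T i i = ip (\sum_l (P i l)^* *: b l) (\sum_l (P i l)^* *: a l).
      rewrite TE !mxE ip_suml; apply: eq_bigr => l _; rewrite !mxE ip_sumr mulr_suml.
      by apply: eq_bigr => k _; rewrite ipZl ipZr conjCK !mxE; ring.
    apply: le_trans (ip_le _ _) _; set x := nr _; set y := nr _.
    rewrite -subr_ge0 (_ : _ - _ = 2^-1 * (x - y) ^+ 2); last by field.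
    by rewrite mulr_ge0 // sqr_ge0.
  apply: le_trans (ler_sum _ (fun i _ => bound i)) _.
  rewrite big_split /= -!mulr_sumr !unitary_family //.
  by rewrite [nu]splitr ![nu / 2]mulrC lerD // ler_pM2l.
move=> i; have /eqP : \det ((T i i)%:M - A) = 0.
  by rewrite shift (bigD1 i) //= subrr mul0r.
rewrite -det_tr => /det0P[v v0 vA]; exists v^T.
  by apply: contraNneq v0 => h; rewrite -[v]trmxK h trmx0.
apply/eqP; rewrite -subr_eq0 -mul_scalar_mx -mulmxBl -oppr_eq0 -mulNmx opprB.
by rewrite -trmx_eq0 trmx_mul trmxK vA.
Qed.

Lemma det_cross_gram_le n (a b : 'I_n -> X) (nu : R) :
  \sum_i nr (a i) ^+ 2 <= nu -> \sum_i nr (b i) ^+ 2 <= nu ->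
  cabs (\det (1%:M - cross_gram a b)) <= expR nu.
Proof.
move=> ha hb; have [t [-> tn _]] := cross_gram_schur ha hb.
rewrite cabs_prod; apply: le_trans (_ : \prod_i expR (cabs (t i)) <= _).
  apply: ler_prod => i _; rewrite cabs_ge0 /=; apply: le_trans (expR_ge1Dx _).
  by apply: le_trans (cabsD _ _) _; rewrite cabs1 cabsN.
by rewrite -expR_sum ler_expR.
Qed.

(** A nonzero eigenvalue of the matrix, with coordinates [c], is one of the operator, with
    eigenvector [\sum_l c l 0 *: b l]. So all have modulus at most 1/2, and there
    [1 - s >= expR (- (2 * s))]. *)
Lemma det_cross_gram_ge n (a b : 'I_n -> X) (nu : R) :
  \sum_i nr (a i) ^+ 2 <= nu -> \sum_i nr (b i) ^+ 2 <= nu ->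
  (forall (mu : R[i]) x, x != 0 ->
     \sum_i ip x (a i) *: b i = mu *: x -> cabs mu <= 2^-1) ->
  expR (- (2 * nu)) <= cabs (\det (1%:M - cross_gram a b)).
Proof.
move=> ha hb small; have [t [-> tn te]] := cross_gram_schur ha hb.
have t2 i : cabs (t i) <= 2^-1.
  have [->|ti0] := eqVneq (t i) 0; first by rewrite cabs0.
  have [c c0 cE] := te i.
  have cEk k : \sum_l c l 0 * ip (b l) (a k) = t i * c k 0.
    have := congr1 (fun M : 'cV_n => M k 0) cE; rewrite !mxE => <-.
    by apply: eq_bigr => l _; rewrite !mxE mulrC.
  pose x := \sum_l c l 0 *: b l.
  have xa k : ip x (a k) = t i * c k 0.
    by rewrite -cEk /x ip_suml; apply: eq_bigr => l _; rewrite ipZl.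
  apply: (small _ x).
    apply: contraNneq c0 => x0; apply/eqP/colP => k; rewrite mxE.
    have := xa k; rewrite x0 ip0l => /esym/eqP; rewrite mulf_eq0 (negbTE ti0).
    by move=> /eqP.
  rewrite /x scaler_sumr; apply: eq_bigr => k _.
  by rewrite xa scalerA.
rewrite cabs_prod; apply: le_trans (_ : \prod_i expR (- (2 * cabs (t i))) <= _).
  rewrite -expR_sum ler_expR sumrN lerN2 -mulr_sumr ler_pM2l //.
apply: ler_prod => i _; rewrite expR_ge0 /=.
have h1 : 1 - cabs (t i) <= cabs (1 - t i).
  by have := cabsD (1 - t i) (t i); rewrite subrK cabs1; lra.
apply: le_trans h1; have h2 := cabs_ge0 (t i); have h3 := t2 i.
set s := cabs (t i) in h2 h3 *.
rewrite expRN -[leRHS]invrK lef_pV2 ?posrE ?expR_gt0 ?invr_gt0 //; last by lra.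
have h4 : (1 - s)^-1 <= 1 + 2 * s.
  by rewrite invf_ple ?posrE; [rewrite -[leLHS]mul1r ler_pdivrMr; nra|lra|lra].
exact: le_trans h4 (expR_ge1Dx _).
Qed.

(* The matrix of the family extended by [b = y] and [a = z] has determinant
   [det (1 - G) * (1 - <x, z>)] when [x - F x = y], so that the resolvent is
   a quotient of two determinants of the same kind. *)
Lemma finite_rank_resolvent n (a b : 'I_n -> X) (nu : R) :
  \sum_i nr (a i) ^+ 2 <= nu -> \sum_i nr (b i) ^+ 2 <= nu ->
  (forall (mu : R[i]) x, x != 0 ->
     \sum_i ip x (a i) *: b i = mu *: x -> cabs mu <= 2^-1) ->
  forall x, nr x <= (1 + expR (3 * nu + 1)) * nr (x - \sum_i ip x (a i) *: b i).
Proof.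
move=> ha hb small x; pose F x := \sum_i ip x (a i) *: b i.
rewrite -/(F x); set G := 1%:M - cross_gram a b.
have [x0|x0] := eqVneq x 0.
  by rewrite x0 nr0 mulr_ge0 ?nr_ge0 // addr_ge0 ?expR_ge0.
have lF (s : R[i]) u : F (s *: u) = s *: F u.
  by rewrite /F scaler_sumr; apply: eq_bigr => i _; rewrite ipZl scalerA.
have y0 : x - F x != 0.
  rewrite subr_eq0; apply/eqP => E; have := small 1 x x0; rewrite scale1r -/(F x) -E.
  by move=> /(_ erefl); rewrite cabs1; lra.
(* Scaling makes the added vectors [y] and [z] unit vectors, at the cost of 1 in the bound [nu], and
   turns [ip u z] into the very ratio that is to be estimated. *)
pose s : R[i] := (nr (x - F x))^-1%:C%C.
pose u := s *: x; pose y := u - F u; pose z := (nr x)^-1%:C%C *: x.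
have yE : y = s *: (x - F x) by rewrite /y /u lF scalerBr.
have ny : nr y = 1 by rewrite yE nr_normalize.
have nz : nr z = 1 by rewrite nr_normalize.
have uz : ip u z = (nr x / nr (x - F x))%:C%C.
  rewrite /u /z ipZl ipZr conjCr ip_sq /s -!rmorphM /=; congr (_%:C%C).
  by field; rewrite !gt_eqF ?nr_gt0.
pose ext (f : 'I_n -> X) w (i : 'I_(n + 1)) :=
  if fintype.split i is inl k then f k else w.
have extl f w i : ext f w (lshift 1 i) = f i.
  by rewrite /ext (unsplitK (inl i)).
have extr f w i : ext f w (rshift n i) = w.
  by rewrite /ext (unsplitK (inr i)).
pose a1 := ext a z; pose b1 := ext b y.
have ext_sum f w : nr w = 1 -> \sum_i nr (f i) ^+ 2 <= nu ->
    \sum_i nr (ext f w i) ^+ 2 <= nu + 1.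
  move=> w1 hf; rewrite big_split_ord /= big_ord1 extr w1 expr1n lerD2r.
  by under eq_bigr do rewrite extl.
have ha1 := ext_sum _ _ nz ha; have hb1 := ext_sum _ _ ny hb.
rewrite -/a1 in ha1; rewrite -/b1 in hb1.
pose c : 'cV[R[i]]_n := \col_k ip u (a k).
pose g : 'cV[R[i]]_n := \col_k ip y (a k).
pose h : 'rV[R[i]]_n := \row_l ip (b l) z.
have Gc : G *m c = g.
  apply/colP => k; rewrite mulmxBl mul1mx !mxE /y ipBl ip_suml; congr (_ - _).
  by apply: eq_bigr => l _; rewrite !mxE [RHS]ipZl mulrC.
have hc : h *m c = (ip u z - ip y z)%:M.
  apply/matrixP => i k; rewrite !ord1 !mxE eqxx mulr1n /y ipBl subKr ip_suml.
  by apply: eq_bigr => l _; rewrite !mxE [RHS]ipZl mulrC.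
have blk0 : cross_gram a1 b1 = block_mx (cross_gram a b) g h (ip y z)%:M.
  apply/matrixP => i k; case: (split_ordP i) => i' ->; case: (split_ordP k) => k' ->.
  - by rewrite block_mxEul !mxE /a1 /b1 !extl.
  - by rewrite block_mxEur !mxE /a1 /b1 extl extr.
  - by rewrite block_mxEdl !mxE /a1 /b1 extl extr.
  by rewrite block_mxEdr !mxE /a1 /b1 !extr !ord1 eqxx mulr1n.
have blk : 1%:M - cross_gram a1 b1 = block_mx G (- g) (- h) (1 - ip y z)%:M.
  by rewrite blk0 scalar_mx_block opp_block_mx add_block_mx !add0r raddfB.
have D : \det (1%:M - cross_gram a1 b1) = \det G * (1 - ip u z).
  have : (1%:M - cross_gram a1 b1) *m block_mx 1%:M c 0 1%:M =
      block_mx G 0 (- h) (1 - ip u z)%:M.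
    rewrite blk mulmx_block !mulmx0 !mulmx1 !addr0 Gc subrr mulNmx hc.
    by congr block_mx; rewrite -raddfN -raddfD /=; congr (_%:M); ring.
  move=> /(congr1 (@determinant _ _)); rewrite det_mulmx det_ublock det_lblock !det1.
  by rewrite !mulr1 det_scalar1.
have nu0 : 0 <= nu by apply: le_trans ha; apply: sumr_ge0 => i _; exact: sqr_ge0.
have Dle := det_cross_gram_le ha1 hb1; have Gge := det_cross_gram_ge ha hb small.
rewrite D cabsM in Dle; set r := nr x / nr (x - F x).
have r0 : 0 <= r by rewrite divr_ge0 ?nr_ge0.
(* The quotient of [expR (nu + 1)], the upper bound for the extended families, by
   [expR (- (2 * nu))], the lower bound for the original ones. *)
have le1 : cabs (1 - ip u z) <= expR (3 * nu + 1).
  rewrite -(ler_pM2l (expR_gt0 (- (2 * nu)))) -expRD.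
  rewrite (_ : - (2 * nu) + (3 * nu + 1) = nu + 1); last by ring.
  by apply: le_trans Dle; rewrite ler_wpM2r ?cabs_ge0.
rewrite -ler_pdivrMr ?nr_gt0 // -/r.
have : r <= 1 + cabs (1 - ip u z).
  have := cabsD 1 (- (1 - ip u z)); rewrite opprB addrCA subrr addr0 uz cabs_real cabs1.
  by rewrite ger0_norm // -/r cabsBC.
by move=> /le_trans; apply; rewrite lerD2l.
Qed.

End schur_weyl.

(** * Growth of resolvents of Volterra operators *)

Section nuclear.
Context {R : realType} {X : hilbert R}.
Implicit Types (F D E W : X -> X) (x y : X).

(** A trace norm bound restricted to finite rank, where an explicit representation witnesses it;
    limits in operator norm are taken separately in [nuclear_limit]. *)
Definition nuclear_le (c : R) F := exists n (a b : 'I_n -> X),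
  (forall x, F x = \sum_i ip x (a i) *: b i) /\ \sum_i nr (a i) * nr (b i) <= c.

Lemma nuclear_zero : nuclear_le 0 (fun=> 0).
Proof.
by exists 0%N, (fun=> 0), (fun=> 0); split=> [x|]; rewrite big_ord0.
Qed.

Lemma nuclear_rank1 a b : nuclear_le (nr a * nr b) (fun x => ip x a *: b).
Proof.
by exists 1%N, (fun=> a), (fun=> b); split=> [x|]; rewrite big_ord1.
Qed.

Lemma nuclear_add c1 c2 F1 F2 : nuclear_le c1 F1 -> nuclear_le c2 F2 ->
  nuclear_le (c1 + c2) (fun x => F1 x + F2 x).
Proof.
move=> [n1 [a1 [b1 [E1 h1]]]] [n2 [a2 [b2 [E2 h2]]]].
pose glue (f : 'I_n1 -> X) (g : 'I_n2 -> X) i :=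
  match fintype.split i with inl k => f k | inr k => g k end.
have gl f g i : glue f g (lshift n2 i) = f i by rewrite /glue (unsplitK (inl i)).
have gr f g i : glue f g (rshift n1 i) = g i by rewrite /glue (unsplitK (inr i)).
exists (n1 + n2)%N, (glue a1 a2), (glue b1 b2); split=> [x|].
  rewrite big_split_ord E1 E2 /=; congr (_ + _); apply: eq_bigr => i _.
    by rewrite !gl.
  by rewrite !gr.
rewrite big_split_ord /=; apply: lerD.
  by under eq_bigr do rewrite !gl.
by under eq_bigr do rewrite !gr.
Qed.

Lemma nuclear_compl c e F E : linear E -> 0 <= e ->
  (forall x, nr (E x) <= e * nr x) -> nuclear_le c F ->
  nuclear_le (e * c) (fun x => E (F x)).
Proof.
move=> lE e0 Ee [n [a [b [EF h]]]]; exists n, a, (fun i => E (b i)); split=> [x|].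
  by rewrite EF (lin_sum lE); apply: eq_bigr => i _; rewrite (linZ lE).
apply: le_trans (ler_wpM2l e0 h); rewrite mulr_sumr; apply: ler_sum => i _.
by rewrite mulrCA ler_wpM2l ?nr_ge0.
Qed.

Lemma nuclear_compr c d F D : linear D -> 0 <= d ->
  (forall x, nr (D x) <= d * nr x) -> nuclear_le c F ->
  nuclear_le (d * c) (fun x => F (D x)).
Proof.
move=> lD d0 Dd [n [a [b [EF h]]]].
have [|Ds _ adj] := @blin_adjoint _ _ _ D; first by split=> //; exists d.
have Ds_le y : nr (Ds y) <= d * nr y.
  have [->|y0] := eqVneq (Ds y) 0; first by rewrite nr0 mulr_ge0 ?nr_ge0.
  rewrite -(ler_pM2l (nr_gt0 y0)) -expr2 nr_sqE -adj.
  apply: le_trans (le_trans (ler_norm _) (Re_cabs _)) _.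
  apply: le_trans (ip_le _ _) _; rewrite mulrA [_ * d]mulrC.
  by rewrite ler_wpM2r ?nr_ge0.
exists n, (fun i => Ds (a i)), b; split=> [x|].
  by rewrite EF; apply: eq_bigr => i _; rewrite adj.
apply: le_trans (ler_wpM2l d0 h); rewrite mulr_sumr; apply: ler_sum => i _.
by rewrite mulrA ler_wpM2r ?nr_ge0.
Qed.

Lemma nuclear_le_trans c d F : c <= d -> nuclear_le c F -> nuclear_le d F.
Proof. by move=> cd [n [a [b [E h]]]]; exists n, a, b; split=> //; exact: le_trans cd. Qed.

(** The determinant estimates need the sums of squares of both families, whereas the trace norm
    controls products; rescaling by [t] and its inverse makes both squares equal to the product. *)
Lemma rank1_balance a b : exists a' b' : X,
  [/\ forall x, ip x a *: b = ip x a' *: b', nr a' ^+ 2 <= nr a * nr b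
    & nr b' ^+ 2 <= nr a * nr b].
Proof.
have [->|a0] := eqVneq a 0.
  by exists 0, 0; split=> [x||]; rewrite ?ip0r ?scale0r ?scaler0 ?nr0 ?expr0n ?mul0r.
have [->|b0] := eqVneq b 0.
  by exists 0, 0; split=> [x||]; rewrite ?ip0r ?scale0r ?scaler0 ?nr0 ?expr0n ?mulr0.
have pa := nr_gt0 a0; have pb := nr_gt0 b0.
pose t : R := Num.sqrt (nr b / nr a).
have t0 : 0 < t by rewrite sqrtr_gt0 divr_gt0.
have t2 : t ^+ 2 = nr b / nr a by rewrite sqr_sqrtr ?divr_ge0 ?ltW.
exists (t%:C%C *: a), (t^-1%:C%C *: b); split=> [x||].
- rewrite ipZr conjCr scalerA [_ * ip x a]mulrC -mulrA -rmorphM /= divff ?gt_eqF //.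
  by rewrite mulr1.
- rewrite nrZ cabs_real gtr0_norm // exprMn t2.
  by rewrite (_ : _ / _ * _ = nr a * nr b) //; field; rewrite gt_eqF.
rewrite nrZ cabs_real gtr0_norm ?invr_gt0 // exprMn exprVn t2.
by rewrite (_ : _^-1 * _ = nr a * nr b) //; field; rewrite !gt_eqF.
Qed.

Lemma nuclear_resolvent nu F : nuclear_le nu F ->
  (forall (mu : R[i]) x, x != 0 -> F x = mu *: x -> cabs mu <= 2^-1) ->
  forall x, nr x <= (1 + expR (3 * nu + 1)) * nr (x - F x).
Proof.
move=> [n [a [b [EF h]]]] small x.
have /boolp.choice[p pP] i : exists p : X * X,
    [/\ forall x, ip x (a i) *: b i = ip x p.1 *: p.2,
        nr p.1 ^+ 2 <= nr (a i) * nr (b i) & nr p.2 ^+ 2 <= nr (a i) * nr (b i)].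
  by have [a' [b' ?]] := rank1_balance (a i) (b i); exists (a', b').
have EF' y : F y = \sum_i ip y (p i).1 *: (p i).2.
  by rewrite EF; apply: eq_bigr => i _; case: (pP i).
rewrite EF'; apply: finite_rank_resolvent.
- by apply: le_trans h; apply: ler_sum => i _; case: (pP i).
- by apply: le_trans h; apply: ler_sum => i _; case: (pP i).
by move=> mu y y0; rewrite -EF'; exact: small.
Qed.

(** Needed because the eigenvectors of a finite rank approximation of [W] are only approximate
    eigenvectors of [W]. By compactness, approximate eigenvalues above [eta] would produce a genuine
    nonzero eigenvalue. *)
Lemma approximate_eigenvalue_small W (eta : R) : cptop W -> 0 < eta ->
  (forall (z : R[i]) x, x = z *: W x -> x = 0) ->
  exists2 e : R, 0 < e & forall (mu : R[i]) x, nr x = 1 ->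
    nr (W x - mu *: x) <= e -> cabs mu <= eta.
Proof.
move=> cW eta0 inj; have [lW [b b0 Wb]] := cptop_blin cW.
apply: contrapT => h.
have /boolp.choice[p pP] (n : nat) : exists p : R[i] * X, [/\ nr p.2 = 1,
    nr (W p.2 - p.1 *: p.2) <= n.+1%:R^-1 & eta < cabs p.1].
  apply: contrapT => h'; apply: h; exists n.+1%:R^-1; first by rewrite invr_gt0.
  move=> mu x x1 hx; rewrite leNgt; apply/negP => lt; apply: h'.
  by exists (mu, x).
have [|y yP] := cptop_seq (c := 1) (u := fun n => (p n).2) cW.
  by move=> n; case: (pP n) => ->.
have near (e : R) : 0 < e -> exists (mu : R[i]) x, [/\ nr x = 1,
    nr (W x - mu *: x) <= e, nr (W x - y) <= e & eta < cabs mu].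
  move=> e0; have [N NP] := inv_natS_lt e0; have [n Nn lt] := yP e N e0.
  exists (p n).1, (p n).2; have [h1 h2 h3] := pP n; split=> //; last exact: ltW.
  by apply: le_trans h2 _; apply: ltW; exact: NP.
have mule mu x (e : R) : nr x = 1 -> nr (W x - mu *: x) <= e ->
    cabs mu <= nr (W x) + e.
  move=> x1 hx; have := nr_subr (mu *: x) (W x); rewrite nrZ x1 mulr1 nrBC.
  by move=> h1; apply: le_trans h1 _; rewrite addrC lerD2l.
have ny : eta <= nr y.
  apply: le_small => e e0; have e2 : 0 < e / 2 by rewrite divr_gt0.
  have [mu [x [x1 h1 h2 h3]]] := near _ e2.
  apply: le_trans (ltW h3) _; apply: le_trans (mule _ _ _ x1 h1) _.
  by have := nr_subr (W x) y; lra.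
have y0 : y != 0 by apply/eqP => yy; rewrite yy nr0 in ny; lra.
have close (e : R) : 0 < e -> exists2 mu : R[i], nr (W y - mu *: y) <= e & eta < cabs mu.
  move=> e0; pose d : R := Num.min 1 (e / (3 * b + 1)).
  have b3 : 0 < 3 * b + 1 by lra.
  have d0 : 0 < d by rewrite lt_min ltr01 divr_gt0.
  have d1 : d <= 1 by rewrite ge_min lexx.
  have [mu [x [x1 h1 h2 h3]]] := near _ d0; exists mu => //.
  rewrite (_ : W y - mu *: y =
      W (y - W x) + (W (W x - mu *: x) + mu *: (W x - y))); last first.
    by rewrite !(linB lW) (linZ lW); vec.
  apply: le_trans (nrD _ _) _; apply: le_trans (lerD (lexx _) (nrD _ _)) _.
  have k1 : nr (W (y - W x)) <= b * d.
    by apply: le_trans (Wb _) _; rewrite ler_wpM2l // nrBC.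
  have k2 : nr (W (W x - mu *: x)) <= b * d.
    by apply: le_trans (Wb _) _; rewrite ler_wpM2l.
  have mu_le : cabs mu <= b + 1.
    have := mule _ _ _ x1 h1; have := Wb x; rewrite x1 mulr1; lra.
  have k3 : nr (mu *: (W x - y)) <= (b + 1) * d.
    by rewrite nrZ ler_pM ?cabs_ge0 ?nr_ge0.
  apply: le_trans (lerD k1 (lerD k2 k3)) _.
  have : d <= e / (3 * b + 1) by rewrite ge_min lexx orbT.
  by rewrite ler_pdivlMr //; lra.
(* The scalars given by [close] need not converge. The Rayleigh quotient approximates at least as
   well as each of them, hence [W y = mu *: y] exactly. *)
pose mu := ip (W y) y / ip y y.
have yy0 : ip y y != 0.
  rewrite ip_sq; apply/eqP => /complexI/eqP; rewrite sqrf_eq0.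
  by rewrite gt_eqF // nr_gt0.
have ortho : ip (W y - mu *: y) y = 0 by rewrite ipBl ipZl divfK // subrr.
have best (l : R[i]) : nr (W y - mu *: y) <= nr (W y - l *: y).
  rewrite -(ler_pXn2r (n := 2)) ?nnegrE ?nr_ge0 //.
  rewrite (_ : W y - l *: y = (W y - mu *: y) + (mu - l) *: y); last by vec.
  rewrite [leRHS]sqr_nrD ipZr ortho mulr0 /= mulr0 addr0.
  by rewrite lerDl sqr_ge0.
have Wy : W y = mu *: y.
  apply/eqP; rewrite -subr_eq0; apply/eqP; apply: nr_small => e e0.
  by have [l hl _] := close e e0; apply: le_trans (best l) hl.
have [mu0|mu0] := eqVneq mu 0.
  have [|l hl le] := close (eta * eta / 2); first by rewrite divr_gt0 ?mulr_gt0.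
  move: hl; rewrite Wy mu0 scale0r sub0r nrN nrZ.
  have : eta * eta <= cabs l * nr y by rewrite ler_pM // ltW.
  by have := mulr_gt0 eta0 eta0; lra.
by move: y0; rewrite (inj mu^-1 y) ?eqxx // Wy scalerA mulVf // scale1r.
Qed.

Definition nuclear_limit (nu : R) W := forall e : R, 0 < e ->
  exists2 F, nuclear_le nu F & forall x, nr (W x - F x) <= e * nr x.

(** At fixed [z], a finite rank [F] close enough to [W] has only eigenvalues of modulus at most
    [(2 * cabs z)^-1]. The finite rank estimate for [z *: F] then depends on [cabs z * nu] alone and
    survives the limit. *)
Theorem quasinilpotent_resolvent W nu : cptop W ->
  (forall (z : R[i]) x, x = z *: W x -> x = 0) -> nuclear_limit nu W ->
  forall (z : R[i]) x,
    nr x <= (1 + expR (3 * (cabs z * nu) + 1)) * nr (x - z *: W x).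
Proof.
move=> cW inj lim z x; set C := _ + _.
have C1 : 1 <= C by rewrite lerDl expR_ge0.
have C0 : 0 < C by lra.
have [z0|z0] := eqVneq z 0.
  by rewrite z0 scale0r subr0 ler_peMl ?nr_ge0.
have pz := cabs_gt0 z0.
have eta0 : 0 < (2 * cabs z)^-1 by rewrite invr_gt0 mulr_gt0.
have [e1 e10 e1P] := approximate_eigenvalue_small cW eta0 inj.
apply: le_small => e e0.
pose k := C * cabs z * nr x + 1.
have k0 : 0 < k by rewrite ltr_wpDl ?mulr_ge0 ?nr_ge0 // ltW.
pose d := Num.min e1 (e / k).
have d0 : 0 < d by rewrite lt_min e10 divr_gt0.
have [F nF WF] := lim d d0.
have nzF : nuclear_le (cabs z * nu) (fun y => z *: F y).
  apply: nuclear_compl => //; [exact: (blin_scale z (blin_id X)).1|exact: cabs_ge0|].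
  by move=> y; rewrite nrZ.
have [n [a [b [EF _]]]] := nF.
have lF : linear F.
  move=> s u v; rewrite !EF scaler_sumr -big_split; apply: eq_bigr => i _ /=.
  by rewrite ipDl ipZl scalerDl scalerA.
have := nuclear_resolvent nzF _ x; rewrite -/C => /(_ _)/le_trans; apply.
  move=> mu y y0 Fy; have ny := nr_normalize y0.
  have := e1P (mu / z) _ ny; rewrite cabsM cabsV ler_pdivrMr // invfM mulfVK ?gt_eqF //.
  apply; set u := _ *: y.
  have Fu : F u = (mu / z) *: u.
    rewrite /u (linZ lF) -[F y](scalerK z0) Fy !scalerA; congr (_ *: _); ring.
  rewrite -Fu; apply: le_trans (WF _) _.
  by rewrite ny mulr1 ge_min lexx.
have -> : x - z *: F x = (x - z *: W x) + z *: (W x - F x) by vec.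
apply: le_trans (ler_wpM2l (ltW C0) (nrD _ _)) _; rewrite mulrDr lerD2l nrZ.
apply: le_trans (_ : C * (cabs z * (d * nr x)) <= _).
  by rewrite !ler_wpM2l ?cabs_ge0 // ltW.
have : d <= e / k by rewrite ge_min lexx orbT.
rewrite ler_pdivlMr // /k mulrDr mulr1; have := ltW d0; set q := C * _ * _.
rewrite (_ : C * (cabs z * (d * nr x)) = d * q); last by rewrite /q; ring.
lra.
Qed.

Lemma iter_bound D (d : R) m : 0 <= d -> (forall x, nr (D x) <= d * nr x) ->
  forall x, nr (iter m D x) <= d ^+ m * nr x.
Proof.
move=> d0 Dd x; elim: m => [|m ih] /=; first by rewrite mul1r.
by apply: le_trans (Dd _) _; rewrite exprS -mulrA ler_wpM2l.
Qed.

(** Telescoping gives [m] products, each containing the rank one factor [D - E] once and [m - 1]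
    further factors of norm at most [d]. *)
Lemma nuclear_iter_diff D E (d : R) a b m : linear D -> linear E -> 0 <= d ->
  (forall x, nr (D x) <= d * nr x) -> (forall x, nr (E x) <= d * nr x) ->
  (forall x, D x - E x = ip x a *: b) -> nr a * nr b <= d ->
  nuclear_le (m%:R * d ^+ m) (fun x => iter m D x - iter m E x).
Proof.
move=> lD lE d0 Dd Ed DE ab; elim: m => [|m ih].
  rewrite mul0r (_ : (fun _ => _) = fun=> 0); first exact: nuclear_zero.
  by apply/funext => x /=; rewrite subrr.
have -> : (fun x => iter m.+1 D x - iter m.+1 E x) = (fun x =>
    (ip (iter m D x) a *: b) + E (iter m D x - iter m E x)).
  apply/funext => x /=; rewrite -DE (linB lE); vec.
have -> : m.+1%:R * d ^+ m.+1 = d ^+ m * d + d * (m%:R * d ^+ m).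
  by rewrite exprS -natr1; ring.
apply: nuclear_add; last exact: nuclear_compl.
apply: (@nuclear_compr d (d ^+ m) (fun x => ip x a *: b)) => //.
- exact: iter_linear.
- exact: exprn_ge0.
- exact: iter_bound.
exact: nuclear_le_trans ab (nuclear_rank1 a b).
Qed.

(** Doubling the exponent: [1 - z W^2] is the product of [1 - s W] and [1 + s W] with [s] a square
    root of [z], and both factors are injective by induction. *)
Lemma iter2_injective V q : linear V ->
  (forall (z : R[i]) x, x = z *: V x -> x = 0) ->
  forall (z : R[i]) x, x = z *: iter (2 ^ q) V x -> x = 0.
Proof.
move=> lV inj; elim: q => [|q ih] z x; first by rewrite expn0 => /inj.
rewrite expnS mul2n -addnn iterD; set W := iter _ V => xE.
have lW : linear W by exact: iter_linear.
pose s := sqrtc z; have sz : s * s = z by rewrite -expr2 sqr_sqrtc.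
have : x + s *: W x = 0.
  apply: (ih s); rewrite -/W (linD lW) (linZ lW) scalerDr scalerA sz -xE addrC //.
by move=> /eqP; rewrite addr_eq0 -scaleNr => /eqP/ih.
Qed.

Lemma sum_iter V (l : R[i]) m x : linear V ->
  x - l ^+ m *: iter m V x = \sum_(j < m) l ^+ j *: iter j V (x - l *: V x).
Proof.
move=> lV; elim: m => [|m ih]; first by rewrite big_ord0 expr0 scale1r subrr.
rewrite big_ord_recr -ih /= (linB (iter_linear _ lV)) (linZ (iter_linear _ lV)).
by rewrite -iterSr exprSr /=; vec.
Qed.

(* With [m = 2 ^ q], the power [V^m] is the limit of the finite rank operators
   [V^m - (D n)^m], whose trace norms are at most [m g^m \sum_k s k ^+ m], and
   [1 - z^m V^m] is a multiple of [1 - z V]. *)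
Theorem volterra_growth V (D : nat -> X -> X) (a b : nat -> X) (s : nat -> R)
    (g S : R) (q : nat) :
  cptop V -> (forall (z : R[i]) x, x = z *: V x -> x = 0) ->
  (forall x, D 0%N x = V x) -> (forall n, linear (D n)) -> 0 <= g ->
  (forall n, 0 <= s n.+1 <= s n) ->
  (forall e : R, 0 < e -> exists n, s n < e) ->
  (forall n x, nr (D n x) <= g * s n * nr x) ->
  (forall n x, D n x - D n.+1 x = ip x (a n) *: b n) ->
  (forall n, nr (a n) * nr (b n) <= g * s n) ->
  (forall n, \sum_(k < n) s k ^+ (2 ^ q) <= S) ->
  exists2 c : R, 0 <= c & forall (z : R[i]) x,
    nr x <= expR (c * (1 + cabs z) ^+ (2 ^ q)) * nr (x - z *: V x).
Proof.
move=> cV inj D0 lD g0 sP s0 DP Dab ab sS; set m := (2 ^ q)%N.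
have m0 : (0 < m)%N by rewrite expn_gt0.
have [lV [v v0 Vv]] := cptop_blin cV.
have sge0 n : 0 <= s n by have /andP[h1 h2] := sP n; exact: le_trans h2.
have S0 : 0 <= S by have := sS 0%N; rewrite big_ord0.
have gs0 n : 0 <= g * s n by rewrite mulr_ge0.
have ED : D 0%N = V by apply/funext.
pose nu := m%:R * g ^+ m * S.
have nu0 : 0 <= nu by rewrite !mulr_ge0 ?exprn_ge0.
have nucN n : nuclear_le (m%:R * g ^+ m * \sum_(k < n) s k ^+ m)
    (fun x => iter m V x - iter m (D n) x).
  elim: n => [|n ih].
    rewrite big_ord0 mulr0 (_ : (fun _ => _) = fun=> 0); first exact: nuclear_zero.
    by apply/funext => x; rewrite ED subrr.
  rewrite big_ord_recr mulrDr (_ : (fun _ => _) = (fun x =>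
    (iter m V x - iter m (D n) x) + (iter m (D n) x - iter m (D n.+1) x))).
    apply: nuclear_add => //=; rewrite -mulrA -exprMn.
    apply: (@nuclear_iter_diff _ _ _ (a n) (b n)) => //.
    move=> x; apply: le_trans (DP _ _) _; rewrite ler_wpM2r ?nr_ge0 //.
    by rewrite ler_wpM2l //; have /andP[] := sP n.
  by apply/funext => x; vec.
have lim : nuclear_limit nu (iter m V).
  move=> e e0; have g1 : 0 < g + 1 by lra.
  pose d := Num.min 1 e; have d0 : 0 < d by rewrite lt_min ltr01 e0.
  have [|n sn] := s0 (d / (g + 1)); first by rewrite divr_gt0.
  exists (fun x => iter m V x - iter m (D n) x).
    by apply: nuclear_le_trans (nucN n); rewrite ler_wpM2l // mulr_ge0 ?exprn_ge0.
  move=> x; rewrite subKr; apply: le_trans (iter_bound m (gs0 n) (DP n) x) _.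
  rewrite ler_wpM2r ?nr_ge0 //.
  have gsd : g * s n <= d.
    move: sn; rewrite ltr_pdivlMr // => sn.
    by have := sge0 n; nra.
  have d1 : d <= 1 by rewrite ge_min lexx.
  have de : d <= e by rewrite ge_min lexx orbT.
  apply: le_trans (_ : g * s n <= _); last exact: le_trans gsd de.
  by rewrite -{2}[g * s n]expr1 ler_wiXn2l // (le_trans gsd).
have cW : cptop (iter m V).
  rewrite -(prednK m0); apply: (cptop_compr (K := V) (f := iter m.-1 V)) => //.
  by apply: iter_blin; split=> //; exists v.
have injW : forall (z : R[i]) x, x = z *: iter m V x -> x = 0.
  exact: iter2_injective.
(* The first summand absorbs the geometric sum of the [z ^+ j *: iter j V], the second the resolvent
   bound for [iter m V] at [z ^+ m]. *)
exists (m%:R * (1 + v) ^+ m + (3 * nu + 2)).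
  by rewrite !addr_ge0 ?mulr_ge0 ?exprn_ge0 ?addr_ge0.
move=> z x; apply: le_trans (quasinilpotent_resolvent cW injW lim (z ^+ m) x) _.
rewrite sum_iter // cabsX; set r := cabs z; set y := x - z *: V x.
have r0 : 0 <= r by exact: cabs_ge0.
have t1 : 1 <= (1 + r) ^+ m by rewrite exprn_ege1 // lerDl.
set t := (1 + r) ^+ m in t1 *.
have rt : r ^+ m <= t by rewrite /t lerXn2r ?nnegrE ?addr_ge0 // lerDr.
rewrite [(_ + (3 * nu + 2)) * t]mulrDl.
have k1 : 1 + expR (3 * (r ^+ m * nu) + 1) <= expR ((3 * nu + 2) * t).
  apply: le_trans (_ : expR (3 * (r ^+ m * nu) + 2) <= _); last first.
    rewrite ler_expR [leRHS]mulrDl lerD //; last by rewrite ler_peMr.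
    by rewrite -mulrA ler_pM2l // mulrC ler_wpM2l.
  rewrite (_ : _ + 2 = 1 + (3 * (r ^+ m * nu) + 1)); last by ring.
  rewrite [leRHS]expRD; have := expR_ge1Dx (1 : R).
  have : 1 <= expR (3 * (r ^+ m * nu) + 1).
    apply: le_trans (expR_ge1Dx _); rewrite lerDl addr_ge0 //.
    by rewrite !mulr_ge0 // exprn_ge0.
  by set A := expR 1; set B := expR (3 * _ + 1); nra.
have k2 : nr (\sum_(j < m) z ^+ j *: iter j V y) <=
    expR (m%:R * (1 + v) ^+ m * t) * nr y.
  apply: le_trans (nr_sum _ _ _) _.
  apply: le_trans (_ : \sum_(j < m) ((1 + v) ^+ m * t) * nr y <= _).
    apply: ler_sum => j _; rewrite nrZ cabsX -/r.
    apply: le_trans (ler_wpM2l (exprn_ge0 _ r0) (iter_bound j v0 Vv y)) _.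
    rewrite mulrA ler_wpM2r ?nr_ge0 // mulrC ler_pM ?exprn_ge0 //.
      apply: le_trans (_ : (1 + v) ^+ j <= _).
        by rewrite lerXn2r ?nnegrE ?addr_ge0 // lerDr.
      by rewrite ler_weXn2l ?lerDl // ltnW.
    apply: le_trans (_ : (1 + r) ^+ j <= _).
      by rewrite lerXn2r ?nnegrE ?addr_ge0 // lerDr.
    by rewrite /t ler_weXn2l ?lerDl // ltnW.
  rewrite -mulr_suml ler_wpM2r ?nr_ge0 // sumr_const card_ord -[leLHS]mulr_natl.
  by rewrite mulrA; apply: le_trans (expR_ge1Dx _); rewrite lerDr.
rewrite [_ * t + _]addrC [X in _ <= X * _]expRD -[leRHS]mulrA.
by apply: ler_pM k1 k2; rewrite ?nr_ge0 ?addr_ge0 ?expR_ge0.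
Qed.

End nuclear.

(** * Difference quotients and the maximum principle *)

Section difference_quotients.
Context {R : realType}.
Implicit Types (z w : R[i]).

Section vector_valued.
Context {V : lmodType R[i]} (N : V -> R).
Hypotheses (N_ge0 : forall x, 0 <= N x) (ND : forall x y, N (x + y) <= N x + N y)
  (NZ : forall (a : R[i]) x, N (a *: x) <= cabs a * N x).

(* [f] has [k] successive difference quotients at [z0], the last one being
   locally bounded; for [k = 3] this is a Taylor expansion of order 2 with a
   cubic remainder. *)
Fixpoint dquot (k : nat) (f : R[i] -> V) z0 : Prop :=
  if k is k'.+1 then
    exists2 g, dquot k' g z0 & exists2 r : R, 0 < r &
      forall w, cabs (w - z0) < r -> f w = f z0 + (w - z0) *: g w
  else exists M r : R, [/\ 0 <= M, 0 < r & forall w, cabs (w - z0) < r -> N (f w) <= M].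

Lemma dquotW k f z0 : dquot k.+1 f z0 -> dquot k f z0.
Proof.
elim: k f => [|k ih] f [g hg [r r0 h]]; last by exists g; [exact: ih|exists r].
have [M [s [M0 s0 gM]]] := hg.
exists (N (f z0) + Num.min r s * M), (Num.min r s); split.
- by rewrite addr_ge0 // mulr_ge0 // ltW // lt_min r0.
- by rewrite lt_min r0.
move=> w lt; move: (lt); rewrite lt_min => /andP[/h -> /gM gw].
apply: le_trans (ND _ _) _; rewrite lerD2l; apply: le_trans (NZ _ _) _.
by apply: ler_pM => //; [exact: cabs_ge0|exact: ltW].
Qed.

Lemma dquot_le k l f z0 : (l <= k)%N -> dquot k f z0 -> dquot l f z0.
Proof.
move=> /subnK <-; elim: (k - l)%N => [//|j ih] h.
by apply: ih; apply: dquotW; rewrite addSn in h.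
Qed.

Lemma dquotD k f g z0 : dquot k f z0 -> dquot k g z0 ->
  dquot k (fun w => f w + g w) z0.
Proof.
elim: k f g => [|k ih] f g.
  move=> [M1 [r1 [M10 r10 h1]]] [M2 [r2 [M20 r20 h2]]].
  exists (M1 + M2), (Num.min r1 r2); rewrite addr_ge0 // lt_min r10 r20; split=> // w.
  by rewrite lt_min => /andP[/h1 k1 /h2 k2]; apply: le_trans (ND _ _) (lerD k1 k2).
move=> [f1 hf1 [r1 r10 h1]] [g1 hg1 [r2 r20 h2]].
exists (fun w => f1 w + g1 w); first exact: ih.
exists (Num.min r1 r2) => [|w]; first by rewrite lt_min r10.
by rewrite lt_min => /andP[/h1 -> /h2 ->]; rewrite scalerDr addrACA.
Qed.

Lemma dquot_continuous f z0 (e : R) : dquot 1 f z0 -> 0 < e ->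
  exists2 d : R, 0 < d & forall w, cabs (w - z0) < d -> N (f w - f z0) < e.
Proof.
move=> [g [M [s [M0 s0 gM]]] [r r0 h]] e0.
have M1 : 0 < M + 1 by lra.
exists (Num.min (Num.min r s) (e / (M + 1))).
  by rewrite !lt_min r0 s0 divr_gt0.
move=> w; rewrite !lt_min => /andP[/andP[/h E /gM gw] lt].
rewrite E addrC addKr; apply: le_lt_trans (NZ _ _) _.
move: lt; rewrite ltr_pdivlMr //; apply: le_lt_trans.
by rewrite ler_wpM2l ?cabs_ge0 // (le_trans gw) // lerDl.
Qed.

End vector_valued.

Local Notation sdquot := (@dquot R[i]^o cabs).

Lemma cabsZ (a : R[i]) (x : R[i]^o) : cabs (a *: x) <= cabs a * cabs x.
Proof. by rewrite cabsM. Qed.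

Lemma sdquot_cst k (c : R[i]) z0 : sdquot k (fun=> c) z0.
Proof.
elim: k c => [|k ih] c.
  by exists (cabs c), 1; split=> //; exact: cabs_ge0.
exists (fun=> 0); first exact: ih.
by exists 1 => // w _; rewrite scaler0 addr0.
Qed.

Lemma sdquot_id k z0 : sdquot k id z0.
Proof.
case: k => [|k].
  exists (cabs z0 + 1), 1; split=> //; first by rewrite addr_ge0 ?cabs_ge0.
  move=> w lt; rewrite -[w](subrK z0) addrC; apply: le_trans (cabsD _ _) _.
  by rewrite lerD2l ltW.
exists (fun=> 1); first exact: sdquot_cst.
by exists 1 => // w _; rewrite addrC [_ *: _]mulr1 subrK.
Qed.

Lemma dquotM (V : lmodType R[i]) (N : V -> R) (N_ge0 : forall x, 0 <= N x)
    (ND : forall x y, N (x + y) <= N x + N y)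
    (NZ : forall (a : R[i]) x, N (a *: x) <= cabs a * N x) k q f z0 :
  sdquot k q z0 -> dquot N k f z0 -> dquot N k (fun w => q w *: f w) z0.
Proof.
elim: k q f => [|k ih] q f.
  move=> [M1 [r1 [M10 r10 h1]]] [M2 [r2 [M20 r20 h2]]].
  exists (M1 * M2), (Num.min r1 r2); rewrite mulr_ge0 // lt_min r10 r20; split=> // w.
  rewrite lt_min => /andP[/h1 k1 /h2 k2]; apply: le_trans (NZ _ _) _.
  by apply: ler_pM; rewrite ?cabs_ge0.
move=> hq hf; have [q1 hq1 [r1 r10 h1]] := hq; have [f1 hf1 [r2 r20 h2]] := hf.
exists (fun w => q z0 *: f1 w + q1 w *: f w).
  apply: dquotD => //; apply: ih => //; first exact: sdquot_cst.
  exact: dquotW hf.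
exists (Num.min r1 r2) => [|w]; first by rewrite lt_min r10.
rewrite lt_min => /andP[k1 /h2 k2]; rewrite {1}h1 // scalerDl {1}k2.
by rewrite !scalerDr !scalerA [q z0 * _]mulrC -addrA.
Qed.

Lemma sdquotM k (p q : R[i] -> R[i]) z0 : sdquot k p z0 -> sdquot k q z0 ->
  sdquot k (fun w => p w * q w) z0.
Proof. exact: (dquotM (@cabs_ge0 R) (@cabsD R) cabsZ). Qed.

Lemma sdquotX k (p : R[i] -> R[i]) n z0 : sdquot k p z0 ->
  sdquot k (fun w => p w ^+ n) z0.
Proof.
move=> hp; elim: n => [|n ih]; first exact: sdquot_cst.
rewrite (_ : (fun _ => _) = fun w => p w * p w ^+ n); first exact: sdquotM.
by apply/funext => w; rewrite exprS.
Qed.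

(** The extra order supplies continuity of [q], which keeps it away from 0 near [z0]. The difference
    quotient of the inverse is [- q1 / (q z0 * q)], so the induction reuses the claim itself. *)
Lemma sdquotV k (q : R[i] -> R[i]) z0 : q z0 != 0 -> sdquot k.+1 q z0 ->
  sdquot k (fun w => (q w)^-1) z0.
Proof.
move=> q0 h.
have pq := cabs_gt0 q0; have pq2 : 0 < cabs (q z0) / 2 by rewrite divr_gt0.
have [d d0 dP] : exists2 d : R, 0 < d & forall w, cabs (w - z0) < d ->
    cabs (q z0) / 2 <= cabs (q w).
  have h1 := dquot_le (@cabs_ge0 R) (@cabsD R) cabsZ (ltn0Sn k) h.
  have [d d0 dP] := dquot_continuous cabsZ h1 pq2.
  exists d => // w /dP; rewrite cabsBC => lt.
  by have := cabsD (q z0 - q w) (q w); rewrite subrK; lra.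
have qw w : cabs (w - z0) < d -> q w != 0.
  by move=> /dP h1; apply: contraTneq h1 => ->; rewrite cabs0; lra.
elim: k h => [|k ih] h.
  exists ((cabs (q z0) / 2)^-1), d; split=> //; first by rewrite invr_ge0 ltW.
  by move=> w /dP h1; rewrite cabsV lef_pV2 ?posrE // (lt_le_trans pq2).
have [q1 hq1 [r r0 hr]] := h.
exists (fun w => (- (q z0)^-1 * q1 w) * (q w)^-1).
  apply: sdquotM; last by apply: ih; exact: (dquotW (@cabs_ge0 R) (@cabsD R) cabsZ).
  apply: sdquotM; first exact: sdquot_cst.
  exact: (dquotW (@cabs_ge0 R) (@cabsD R) cabsZ).
exists (Num.min r d) => [|w]; first by rewrite lt_min r0.
rewrite lt_min => /andP[/hr E /qw w0]; rewrite -[_ *: _]/(_ * _).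
have : (w - z0) * q1 w = q w - q z0 by rewrite E [_ + _ *: _]addrC addrK.
move=> E2; rewrite mulrA [(w - z0) * _]mulrCA E2; field.
by apply/andP.
Qed.

End difference_quotients.

Local Notation hdquot := (dquot nr).

Section maximum_principle.
Context {R : realType} {X : hilbert R}.
Implicit Types (f : R[i] -> X) (z w : R[i]).

Lemma nrZ_le (a : R[i]) (x : X) : nr (a *: x) <= cabs a * nr x.
Proof. by rewrite nrZ. Qed.

(** These are the values at [z0 + r], [z0 + i r], [z0 - r], [z0 - i r] of a quadratic polynomial,
    whose second order term changes sign at the imaginary increments. Parallelogram laws for
    opposite points, and a third one for [x] and [z], cancel all cross terms. *)
Lemma four_points (x y z : X) :
  nr (x + y + z) ^+ 2 + nr (x + 'i%C *: y - z) ^+ 2 +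
  nr (x - y + z) ^+ 2 + nr (x - 'i%C *: y - z) ^+ 2 =
  4 * (nr x ^+ 2 + nr y ^+ 2 + nr z ^+ 2).
Proof.
have e1 : nr ('i%C *: y) = nr y by rewrite nrZ cabs_i mul1r.
have pl (u v : X) : nr (u + v) ^+ 2 + nr (u - v) ^+ 2 = 2 * nr u ^+ 2 + 2 * nr v ^+ 2.
  by rewrite !sqr_nrD ipNr ReN nrN; ring.
have h1 := pl (x + z) y; have h2 := pl (x - z) ('i%C *: y); have h3 := pl x z.
have -> : x + y + z = x + z + y by rewrite addrAC.
have -> : x + 'i%C *: y - z = x - z + 'i%C *: y by rewrite addrAC.
have -> : x - y + z = x + z - y by rewrite addrAC.
have -> : x - 'i%C *: y - z = x - z - 'i%C *: y by rewrite addrAC.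
by rewrite e1 in h2; lra.
Qed.

(** By [four_points] the first and second order terms can only raise the mean, so the deficit is
    cubic. It must be negligible against [r ^+ 2] in the maximum principle, hence three difference
    quotients. *)
Lemma mean_value f z0 : hdquot 3 f z0 -> exists C r0 : R, [/\ 0 <= C, 0 < r0 &
  forall r : R, 0 < r -> r < r0 -> 4 * nr (f z0) ^+ 2 - C * r ^+ 3 <=
    nr (f (z0 + r%:C%C)) ^+ 2 + nr (f (z0 + r%:C%C * 'i%C)) ^+ 2 +
    nr (f (z0 - r%:C%C)) ^+ 2 + nr (f (z0 - r%:C%C * 'i%C)) ^+ 2].
Proof.
move=> [f1 [f2 [f3 [M [s3 [M0 s30 h3]]] [s2 s20 h2]] [s1 s10 h1]] [s s0 h]].
pose a0 := f z0; pose a1 := f1 z0; pose a2 := f2 z0.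
pose A := nr a0 + nr a1 + nr a2.
have A0 : 0 <= A by rewrite !addr_ge0 ?nr_ge0.
(* [A] bounds the Taylor polynomial for [r <= 1], so dropping the remainder costs at most
   [2 * A * M * r ^+ 3] in the square at each of the four points. *)
exists (8 * A * M), (Num.min 1 (Num.min s (Num.min s1 (Num.min s2 s3)))).
split; [by rewrite !mulr_ge0|by rewrite !lt_min ltr01 s0 s10 s20 s30|].
move=> r r0; rewrite !lt_min => /and5P[r1 rs rs1 rs2 rs3].
have pt k : cabs k = r ->
    nr (a0 + k *: a1 + k ^+ 2 *: a2) ^+ 2 - 2 * A * M * r ^+ 3 <=
    nr (f (z0 + k)) ^+ 2.
  move=> kr; have dw : z0 + k - z0 = k by rewrite addrC addKr.
  have E : f (z0 + k) = (a0 + k *: a1 + k ^+ 2 *: a2) + k ^+ 3 *: f3 (z0 + k).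
    rewrite h ?dw ?kr // h1 ?dw ?kr // h2 ?dw ?kr //.
    by rewrite /a0 /a1 /a2; move: (f3 _) (f z0) (f1 z0) (f2 z0) => ? ? ? ?; vec.
  have [p pE] : exists p, p = a0 + k *: a1 + k ^+ 2 *: a2 by eexists.
  rewrite -pE in E *.
  have pA : nr p <= A.
    rewrite pE; apply: le_trans (nrD _ _) _; apply: lerD.
      apply: le_trans (nrD _ _) _; apply: lerD => //.
      by rewrite nrZ kr ler_piMl ?nr_ge0 // ltW.
    by rewrite nrZ cabsX kr ler_piMl ?nr_ge0 // exprn_ile1 // ltW.
  have d3 : nr (k ^+ 3 *: f3 (z0 + k)) <= M * r ^+ 3.
    by rewrite nrZ cabsX kr mulrC ler_wpM2r ?exprn_ge0 ?(ltW r0) // h3 // dw kr.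
  have low : nr p - M * r ^+ 3 <= nr (f (z0 + k)).
    have := nr_subr p (f (z0 + k)); rewrite {1}E opprD addrA subrr sub0r nrN; lra.
  have := nr_ge0 p; have := nr_ge0 (f (z0 + k)).
  have : 0 <= M * r ^+ 3 by rewrite mulr_ge0 // exprn_ge0 // ltW.
  rewrite -[2 * A * M * _]mulrA.
  move: (M * r ^+ 3) (nr p) (nr (f _)) pA low => T a b aA low T0 b0 a0'.
  have [le|lt] := leP T a; nra.
have rr : cabs (r%:C%C : R[i]) = r by rewrite cabs_real gtr0_norm.
have ri : cabs (r%:C%C * 'i%C) = r by rewrite cabsM cabs_i mulr1.
have sqi : (r%:C%C * 'i%C) ^+ 2 = - r%:C%C ^+ 2 :> R[i].
  by rewrite exprMn sqr_i mulrN1.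
have q1 := pt _ rr; have q2 := pt _ ri.
have q3 := pt (- r%:C%C); rewrite cabsN sqrrN in q3; have {}q3 := q3 rr.
have q4 := pt (- (r%:C%C * 'i%C)); rewrite cabsN sqrrN in q4; have {}q4 := q4 ri.
have := four_points a0 (r%:C%C *: a1) (r%:C%C ^+ 2 *: a2).
rewrite -/a0; set z2 := _ ^+ 2 *: a2 in q1 q3 *.
have -> : a0 + 'i%C *: (r%:C%C *: a1) - z2 =
    a0 + (r%:C%C * 'i%C) *: a1 + (r%:C%C * 'i%C) ^+ 2 *: a2.
  by rewrite sqi /z2; vec.
have -> : a0 - 'i%C *: (r%:C%C *: a1) - z2 =
    a0 + (- (r%:C%C * 'i%C)) *: a1 + (r%:C%C * 'i%C) ^+ 2 *: a2.
  by rewrite sqi /z2; vec.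
rewrite scaleNr in q3.
have lin (T p1 p2 p3 p4 s1' s2' s3' s4' u v w : R) : p1 - T <= s1' -> p2 - T <= s2' ->
    p3 - T <= s3' -> p4 - T <= s4' -> 0 <= v -> 0 <= w ->
    p1 + p2 + p3 + p4 = 4 * (u + v + w) -> 4 * u - 4 * T <= s1' + s2' + s3' + s4'.
  lra.
rewrite (_ : 8 * A * M * r ^+ 3 = 4 * (2 * A * M * r ^+ 3)); last by ring.
by apply: lin; [exact: q1|exact: q2|exact: q3|exact: q4|exact: sqr_ge0|exact: sqr_ge0].
Qed.

(** The only consequence of compactness that is used, in a form which [rectangle_attains_max] can
    transport from a real rectangle. *)
Definition attains_max (Om : set R[i]) := forall u : R[i] -> R,
  (forall z (e : R), Om z -> 0 < e -> exists2 d : R, 0 < d &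
     forall w, cabs (w - z) < d -> `|u w - u z| < e) ->
  exists2 z0, Om z0 & forall z, Om z -> u z <= u z0.

Lemma sqr_cabs_shift z (r : R) :
  cabs (z + r%:C%C) ^+ 2 + cabs (z + r%:C%C * 'i%C) ^+ 2 +
  cabs (z - r%:C%C) ^+ 2 + cabs (z - r%:C%C * 'i%C) ^+ 2 =
  4 * cabs z ^+ 2 + 4 * r ^+ 2.
Proof.
case: z => x y; rewrite !sqr_cabs; simpc => /=; ring.
Qed.

(* A strictly subharmonic perturbation [nr f ^+ 2 + eta |z|^2] cannot have an
   interior maximum, by the mean value inequality over four points. *)
Theorem maximum_principle (Om : set R[i]) f (M rho : R) : attains_max Om ->
  (forall z, Om z -> hdquot 3 f z) -> 0 <= M -> (forall z, Om z -> cabs z <= rho) ->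
  (forall z, Om z -> nr (f z) <= M \/
     exists2 r : R, 0 < r & forall w, cabs (w - z) < r -> Om w) ->
  forall z, Om z -> nr (f z) <= M.
Proof.
move=> att hf M0 bnd int z1 Oz1; rewrite leNgt; apply/negP => lt.
have lt2 : M ^+ 2 < nr (f z1) ^+ 2 by rewrite ltr_pXn2r // nnegrE nr_ge0.
(* So small that on [cabs z <= rho] the perturbation cannot lift points with [nr (f z) <= M] to the
   level of [z1]; the perturbed maximum is thus attained where the norm exceeds [M], hence at an
   interior point. *)
pose eta := (nr (f z1) ^+ 2 - M ^+ 2) / (2 * (rho ^+ 2 + 1)).
have rho1 : 0 < rho ^+ 2 + 1 by rewrite ltr_wpDl ?sqr_ge0.
have eta0 : 0 < eta by rewrite divr_gt0 ?subr_gt0 // mulr_gt0.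
have etaM : M ^+ 2 + eta * rho ^+ 2 < nr (f z1) ^+ 2.
  have : eta * (2 * (rho ^+ 2 + 1)) = nr (f z1) ^+ 2 - M ^+ 2.
    by rewrite /eta divfK // gt_eqF // mulr_gt0.
  have := sqr_ge0 rho; nra.
have [|z0 Oz0 zmax] := att (fun z => nr (f z) ^+ 2 + eta * cabs z ^+ 2).
  move=> z e Oz e0.
  pose A := 2 * nr (f z) + 1 + eta * (2 * cabs z + 1).
  have A0 : 0 < A.
    have h1 := nr_ge0 (f z); have h2 : 0 <= eta * (2 * cabs z + 1).
      by rewrite mulr_ge0 ?(ltW eta0) // addr_ge0 // mulr_ge0 ?cabs_ge0.
    by rewrite /A; lra.
  pose e1 := Num.min 1 (e / (2 * A)).
  have e10 : 0 < e1 by rewrite lt_min ltr01 divr_gt0 // mulr_gt0.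
  have e11 : e1 <= 1 by rewrite ge_min lexx.
  have e1A : e1 * A < e.
    have : e1 <= e / (2 * A) by rewrite ge_min lexx orbT.
    by rewrite ler_pdivlMr ?mulr_gt0 //; lra.
  have hf1 : hdquot 1 f z := dquot_le nr_ge0 nrD nrZ_le (isT : (1 <= 3)%N) (hf z Oz).
  have [d d0 dP] := dquot_continuous nrZ_le hf1 e10.
  exists (Num.min d e1) => [|w]; first by rewrite lt_min d0.
  rewrite lt_min => /andP[/dP fw zw].
  have sq (a b : R) : 0 <= a -> 0 <= b -> `|a - b| < e1 ->
      `|a ^+ 2 - b ^+ 2| <= e1 * (2 * b + 1).
    move=> a0 b0 ab; rewrite subr_sqr normrM ler_pM ?(ltW ab) //.
    rewrite ger0_norm ?addr_ge0 //; move: ab; rewrite ltr_norml => /andP[_]; lra.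
  have ab1 : `|nr (f w) - nr (f z)| < e1.
    apply: le_lt_trans fw; rewrite ler_norml lerBlDr -lerBlDr.
    have := nr_subr (f w) (f z); have := nr_subr (f z) (f w); rewrite nrBC; lra.
  have ab2 : `|cabs w - cabs z| < e1.
    apply: le_lt_trans zw; rewrite ler_norml.
    have := cabsD (w - z) z; have := cabsD (z - w) w; rewrite !subrK cabsBC; lra.
  have k1 := sq _ _ (nr_ge0 _) (nr_ge0 _) ab1.
  have k2 := sq _ _ (cabs_ge0 _) (cabs_ge0 _) ab2.
  rewrite opprD addrACA -mulrBr; apply: le_lt_trans (ler_normD _ _) _.
  rewrite normrM (gtr0_norm eta0); apply: le_lt_trans e1A.
  rewrite /A mulrDr lerD // mulrCA ler_pM2l //.
have fz0 : M < nr (f z0).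
  rewrite -(ltr_pXn2r (n := 2)) ?nnegrE ?nr_ge0 //.
  have h1 := zmax _ Oz1; have h2 : eta * cabs z0 ^+ 2 <= eta * rho ^+ 2.
    rewrite ler_pM2l // lerXn2r ?nnegrE ?cabs_ge0 //; last exact: bnd.
    exact: le_trans (cabs_ge0 _) (bnd _ Oz0).
  have : 0 <= eta * cabs z1 ^+ 2 by rewrite mulr_ge0 ?sqr_ge0 // ltW.
  lra.
have [|[s s0 sO]] := int _ Oz0; first by rewrite leNgt fz0.
have [C [r0 [C0 r00 mv]]] := mean_value (hf _ Oz0).
(* The last bound makes the gain [4 * eta * r ^+ 2] of the perturbation exceed the cubic loss
   [C * r ^+ 3]. *)
pose r := Num.min (Num.min (s / 2) (r0 / 2)) (2 * eta / (C + 1)).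
have C1 : 0 < C + 1 by lra.
have r_gt0 : 0 < r.
  have h1 : 0 < s / 2 by lra.
  have h2 : 0 < r0 / 2 by lra.
  have h3 : 0 < 2 * eta / (C + 1) by rewrite divr_gt0 // mulr_gt0.
  by rewrite !lt_min h1 h2 h3.
have rs : r < s.
  by apply: le_lt_trans (_ : r <= s / 2) _; [rewrite !ge_min lexx|lra].
have rr0 : r < r0.
  by apply: le_lt_trans (_ : r <= r0 / 2) _; [rewrite !ge_min lexx orbT|lra].
have rC : r * C < 4 * eta.
  have : r <= 2 * eta / (C + 1) by rewrite ge_min lexx orbT.
  by rewrite ler_pdivlMr //; lra.
have rc : cabs (r%:C%C : R[i]) < s by rewrite cabs_real gtr0_norm.
have ric : cabs (r%:C%C * 'i%C : R[i]) < s by rewrite cabsM cabs_i mulr1.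
have O1 : Om (z0 + r%:C%C) by apply: sO; rewrite addrC addKr.
have O2 : Om (z0 + r%:C%C * 'i%C) by apply: sO; rewrite addrC addKr.
have O3 : Om (z0 - r%:C%C) by apply: sO; rewrite addrC addKr cabsN.
have O4 : Om (z0 - r%:C%C * 'i%C) by apply: sO; rewrite addrC addKr cabsN.
have := mv r r_gt0 rr0; have := sqr_cabs_shift z0 r.
move: (zmax _ O1) (zmax _ O2) (zmax _ O3) (zmax _ O4).
have : C * r ^+ 3 < 4 * eta * r ^+ 2.
  by rewrite exprS mulrA [C * r]mulrC ltr_pM2r // exprn_gt0.
move: (nr _ ^+ 2) (nr _ ^+ 2) (nr _ ^+ 2) (nr _ ^+ 2) (nr _ ^+ 2) => a b c d g.
move: (cabs _ ^+ 2) (cabs _ ^+ 2) (cabs _ ^+ 2) (cabs _ ^+ 2) (cabs _ ^+ 2) => a' b' c' d' g'.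
nra.
Qed.

(** The point [q] may leave the rectangle, and the bilinear parametrisation of [triangle] is
    Lipschitz only while [q.2] stays bounded; hence the restriction on [q.2 - p.2]. *)
Lemma rectangle_attains_max (a b c d : R) (phi : R * R -> R[i]) (L : R) :
  a <= b -> c <= d -> 0 <= L ->
  (forall p q, a <= p.1 <= b -> c <= p.2 <= d -> `|q.2 - p.2| <= 1 ->
     cabs (phi q - phi p) <= L * (`|q.1 - p.1| + `|q.2 - p.2|)) ->
  attains_max [set phi p | p in [set p | a <= p.1 <= b /\ c <= p.2 <= d]].
Proof.
move=> ab cd L0 lip u cu.
set A := [set p | _].
have A0 : A !=set0 by exists (a, c); rewrite /A /= !lexx ab cd.
have cA : compact A.
  have -> : A = `[a, b]%classic `*` `[c, d]%classic.
    by apply/seteqP; split=> p /=; rewrite !in_itv.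
  by apply: compact_setX; exact: segment_compact.
have [|p Ap pmax] := @compact_EVT_max _ R (u \o phi) _ A0 cA.
  apply: continuous_in_subspaceT => p /set_mem Ap.
  apply/cvgrPdist_lt => e e0.
  have [|dl dl0 dP] := cu (phi p) e _ e0; first by exists p.
  have L1 : 0 < 2 * L + 1 by lra.
  pose r := Num.min 1 (dl / (2 * L + 1)).
  have r0 : 0 < r by rewrite lt_min ltr01 divr_gt0.
  exists (ball p.1 r, ball p.2 r) => /=; first by split; exact: nbhsx_ballx.
  move=> [q1 q2] [/= b1 b2]; rewrite -ball_normE /= in b1 b2.
  rewrite distrC; apply: dP; case: Ap => Ap1 Ap2.
  have r1 : r <= 1 by rewrite ge_min lexx.
  have rd : r * (2 * L + 1) <= dl by rewrite -ler_pdivlMr // ge_min lexx orbT.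
  rewrite distrC in b1; rewrite distrC in b2.
  apply: le_lt_trans (lip p (q1, q2) Ap1 Ap2 _) _ => /=.
    by rewrite (le_trans _ r1) // ltW.
  apply: le_lt_trans (_ : _ <= L * (r + r)) _; first by rewrite ler_wpM2l // lerD // ltW.
  lra.
exists (phi p); first by exists p => //; exact: set_mem.
by move=> _ [q Aq <-]; exact: pmax (mem_set Aq).
Qed.

End maximum_principle.

(** * The Phragmen-Lindelof principle *)

Arguments cabs : simpl never.

Section phragmen_lindelof.
Context {R : realType} {X : hilbert R}.
Implicit Types (z w : R[i]) (f : R[i] -> X).

Definition sector (kappa : R) : set R[i] :=
  [set z | 0 < complex.Re z /\ `|complex.Im z| < kappa * complex.Re z].

Lemma cabs_pow_sub1 (v : R[i]) n :
  cabs ((1 + v) ^+ n - 1) <= (1 + cabs v) ^+ n - 1.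
Proof.
elim: n => [|n ih]; first by rewrite !expr0 !subrr cabs0.
have -> : (1 + v) ^+ n.+1 - 1 = ((1 + v) ^+ n - 1) * (1 + v) + v.
  by rewrite exprS; ring.
have -> : (1 + cabs v) ^+ n.+1 - 1 = ((1 + cabs v) ^+ n - 1) * (1 + cabs v) + cabs v.
  by rewrite exprS; ring.
apply: le_trans (cabsD _ _) _; rewrite lerD2r cabsM.
apply: ler_pM => //; try exact: cabs_ge0.
by apply: le_trans (cabsD _ _) _; rewrite cabs1.
Qed.

Lemma pow_le_affine (kappa : R) n : 0 <= kappa -> 3 * n%:R * kappa <= 1 ->
  (1 + kappa) ^+ n <= 1 + 3 / 2 * n%:R * kappa.
Proof.
move=> k0; elim: n => [|n ih] h; first by rewrite expr0 mulr0 mul0r addr0.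
have h' : 3 * n%:R * kappa <= 1.
  by apply: le_trans h; rewrite ler_wpM2r // ler_wpM2l // ler_nat.
have {}ih := ih h'; rewrite exprS -[n.+1%:R]natr1.
have n0 : (0 : R) <= n%:R by [].
apply: le_trans (ler_wpM2l _ ih) _; first by rewrite addr_ge0.
move: n0 h'; move: (n%:R : R) => t t0 h'.
have : kappa * (3 * t * kappa) <= kappa * 1 by rewrite ler_wpM2l.
lra.
Qed.

(** Arguments of complex numbers are avoided: [z] is its real part times [1 + v] with
    [cabs v <= kappa], and for [3 * n%:R * kappa <= 1] the power [(1 + v) ^+ n] stays within 1/2 of
    1. *)
Lemma Re_pow_sector (kappa : R) n z : 0 <= kappa -> 3 * n%:R * kappa <= 1 ->
  0 <= complex.Re z -> `|complex.Im z| <= kappa * complex.Re z ->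
  complex.Re z ^+ n <= 2 * complex.Re (z ^+ n).
Proof.
move=> k0 kn; case: z => x y /= x0 yx.
have [x00|xn0] := eqVneq x 0.
  have y0 : y = 0 by move: yx; rewrite x00 mulr0 normr_le0 => /eqP.
  rewrite x00 y0 (_ : Complex 0 0 = 0%:C%C) // -rmorphXn /=.
  by rewrite ler_peMl ?ler1n // exprn_ge0.
have xp : 0 < x by rewrite lt0r xn0.
pose v : R[i] := Complex 0 (y / x).
have -> : Complex x y = x%:C%C * (1 + v).
  by rewrite /v; simpc; congr Complex; field.
rewrite exprMn -rmorphXn /= ReRM mulrCA ler_peMr ?exprn_ge0 //.
have vk : cabs v <= kappa.
  apply: le_trans (cabs_ReIm _) _; rewrite /v /= normr0 add0r normrM normfV.
  by rewrite (gtr0_norm xp) ler_pdivrMr.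
have h1 : (1 + cabs v) ^+ n - 1 <= 2^-1.
  apply: le_trans (_ : (1 + kappa) ^+ n - 1 <= _).
    by rewrite lerD2r lerXn2r ?nnegrE ?addr_ge0 ?cabs_ge0 // lerD2l.
  by have := pow_le_affine k0 kn; lra.
have h2 := le_trans (cabs_pow_sub1 v n) h1.
have := le_trans (Re_cabs _) h2; rewrite ler_norml ReD ReN /= => /andP[h3 _].
lra.
Qed.

(** The closed sector cut off at real part [rho], given as the image of a rectangle so as to inherit
    [attains_max]; a whole edge is sent to the vertex. *)
Definition triangle (kappa rho : R) : set R[i] :=
  [set Complex p.1 (kappa * p.1 * p.2) | p in
    [set p : R * R | 0 <= p.1 <= rho /\ -1 <= p.2 <= 1]].

Lemma triangleP (kappa rho : R) z : 0 < kappa -> triangle kappa rho z <->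
  [/\ 0 <= complex.Re z, complex.Re z <= rho &
      `|complex.Im z| <= kappa * complex.Re z].
Proof.
move=> k0; split=> [[[x t] /= [/andP[x0 xr] t1] <-]|] /=.
  split=> //; rewrite normrM ger0_norm ?mulr_ge0 ?(ltW k0) //.
  by rewrite ler_piMr ?mulr_ge0 ?(ltW k0) // ler_norml.
case: z => x y /= [x0 xr yx]; have [xx|xn0] := eqVneq x 0.
  exists (0, 0); first by rewrite /= lexx (le_trans x0 xr) lerN10 ler01.
  by move: yx; rewrite xx mulr0 normr_le0 => /eqP ->; rewrite /= !mulr0.
have xp : 0 < x by rewrite lt0r xn0.
have kx : 0 < kappa * x by rewrite mulr_gt0.
exists (x, y / (kappa * x)); last by rewrite /= mulrC divfK // gt_eqF.
rewrite /= x0 xr; split=> //; rewrite -ler_norml normrM normfV (gtr0_norm kx).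
by rewrite ler_pdivrMr // mul1r.
Qed.

Lemma triangle_attains_max (kappa rho : R) : 0 < kappa -> 0 <= rho ->
  attains_max (triangle kappa rho).
Proof.
move=> k0 r0; apply: (@rectangle_attains_max _ 0 rho (-1) 1 _
  (1 + 2 * kappa + kappa * rho)) => //.
- by rewrite !addr_ge0 ?mulr_ge0 ?(ltW k0).
move=> [x t] [x' t'] /= /andP[x0 xr] /andP[t1 t2] tt.
apply: le_trans (cabs_ReIm _) _ => /=.
have -> : kappa * x' * t' - kappa * x * t =
    kappa * t' * (x' - x) + kappa * x * (t' - t) by ring.
apply: le_trans (lerD (lexx _) (ler_normD _ _)) _; rewrite !normrM.
rewrite (gtr0_norm k0) (ger0_norm x0).
have t'2 : `|t'| <= 2.
  rewrite -[t'](subrK t); apply: le_trans (ler_normD _ _) _.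
  have : `|t| <= 1 by rewrite ler_norml t1. lra.
have a0 : 0 <= `|x' - x| by []; have b0 : 0 <= `|t' - t| by [].
have h1 : kappa * `|t'| * `|x' - x| <= kappa * 2 * `|x' - x|.
  by rewrite ler_wpM2r // ler_pM2l.
have h2 : kappa * x * `|t' - t| <= kappa * rho * `|t' - t|.
  by rewrite ler_wpM2r // ler_pM2l.
have h3 : 0 <= kappa * rho * `|x' - x| by rewrite !mulr_ge0 // ltW.
have h4 : 0 <= kappa * `|t' - t| by rewrite !mulr_ge0 // ltW.
lra.
Qed.

(** From [1 + t >= expR (t / 2)] on [0, 1], whence the condition [y <= k%:R]. With [damping_small]
    it shows that a power, whose difference quotients are elementary, can replace the
    exponential. *)
Lemma damping_large (y : R) (k : nat) : 0 <= y -> y <= k%:R ->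
  expR (y / 2) <= (1 + y / k%:R) ^+ k.
Proof.
move=> y0 yk; have [k0|kn0] := eqVneq k 0%N.
  have -> : y = 0 by apply/eqP; rewrite eq_le y0 andbT; move: yk; rewrite k0.
  by rewrite mul0r expR0 k0 expr0.
have kp : (0 : R) < k%:R by rewrite ltr0n lt0n.
have -> : expR (y / 2) = expR (y / k%:R / 2) ^+ k.
  by rewrite -expRM_natl -mulr_natl; congr expR; field; rewrite gt_eqF.
rewrite lerXn2r ?nnegrE ?expR_ge0 ?addr_ge0 ?divr_ge0 //.
set t := y / k%:R; have t0 : 0 <= t by rewrite divr_ge0.
have t1 : t <= 1 by rewrite ler_pdivrMr // mul1r.
have h := expR_ge1Dx (- (t / 2)); rewrite expRN in h.
have e0 := expR_gt0 (t / 2).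
have h2 : expR (t / 2) * (1 - t / 2) <= 1.
  by rewrite -[leRHS](divff (lt0r_neq0 e0)) ler_pM2l.
by nra.
Qed.

Lemma damping_small (y : R) (k : nat) : 0 <= y -> (1 + y / k%:R) ^+ k <= expR y.
Proof.
move=> y0; have [k0|kn0] := eqVneq k 0%N.
  by rewrite k0 expr0; apply: le_trans (expR_ge1Dx _); rewrite lerDl.
have kp : (0 : R) < k%:R by rewrite ltr0n lt0n.
have {2}-> : y = k%:R * (y / k%:R) by rewrite mulrC divfK // gt_eqF.
rewrite expRM_natl.
by rewrite lerXn2r ?nnegrE ?expR_ge0 ?addr_ge0 ?divr_ge0 // expR_ge1Dx.
Qed.

(* The damping factor [(1 + (delta / k) z^(m+1))^-k] plays the role of
   [exp (- delta z^(m+1))]. *)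
Theorem phragmen_lindelof f (M c kappa : R) m : 0 < kappa ->
  3 * m.+1%:R * kappa <= 1 -> 0 <= M -> 0 <= c ->
  (forall z, hdquot 3 f z) -> (forall z, ~ sector kappa z -> nr (f z) <= M) ->
  (forall z, nr (f z) <= M * expR (c * (1 + cabs z) ^+ m)) ->
  forall z, nr (f z) <= M.
Proof.
move=> k0 km M0 c0 hf fout fgrow z1.
have [zs|zs] := pselect (sector kappa z1); last exact: fout.
have kle1 : kappa <= 1.
  have : 1 <= (m.+1%:R : R) by rewrite ler1n.
  move: (m.+1%:R : R) km => t km t1; nra.
have damp (delta : R) : 0 < delta -> nr (f z1) <= M * expR (delta * cabs z1 ^+ m.+1).
  move=> d0.
  (* On the far edge [1 + cabs z <= 3 * rho]; the last bound on [rho] makes the growth exponent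
     [c * (3 * rho) ^+ m] at most [delta * rho ^+ m.+1 / 4], which is [y / 2] below. *)
  pose rho := Num.max (Num.max 1 (complex.Re z1)) (4 * (c * 3 ^+ m) / delta).
  have rho1 : 1 <= rho by rewrite !le_max lexx.
  have rho0 : 0 < rho by lra.
  have rhoz : complex.Re z1 <= rho by rewrite !le_max lexx orbT.
  have rhoc : c * 3 ^+ m <= delta * rho / 4.
    have : 4 * (c * 3 ^+ m) / delta <= rho by rewrite !le_max lexx orbT.
    by rewrite ler_pdivrMr //; lra.
  pose y := delta * rho ^+ m.+1 / 2.
  have y0 : 0 <= y by rewrite divr_ge0 ?mulr_ge0 ?exprn_ge0 // ltW.
  pose k := (Num.truncn y).+1.
  have yk : y <= k%:R by exact/ltW/truncnS_gt.
  have kp : (0 : R) < k%:R by rewrite ltr0n.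
  pose e : R := delta / k%:R; have e0 : 0 < e by rewrite divr_gt0.
  pose g z : R[i] := 1 + e%:C%C * z ^+ m.+1.
  have Reg z : triangle kappa rho z ->
      1 + e * (complex.Re z ^+ m.+1 / 2) <= cabs (g z).
    move=> /(triangleP rho z k0)[x0 _ yx].
    have h := Re_pow_sector (ltW k0) km x0 yx.
    apply: le_trans (le_trans (ler_norm _) (Re_cabs _)).
    rewrite /g ReD ReRM /= lerD2l ler_pM2l //; lra.
  have g1 z : triangle kappa rho z -> 1 <= cabs (g z).
    move=> Tz; apply: le_trans (Reg z Tz); move: Tz => /(triangleP rho z k0)[x0 _ _].
    by rewrite lerDl mulr_ge0 ?(ltW e0) // divr_ge0 // exprn_ge0.
  have gk0 z : triangle kappa rho z -> g z ^+ k != 0.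
    move=> /g1 h; rewrite expf_neq0 //; apply: contraTneq h => ->.
    by rewrite cabs0; lra.
  pose F z := (g z ^+ k)^-1 *: f z.
  have nF z : nr (F z) = nr (f z) / cabs (g z) ^+ k.
    by rewrite /F nrZ cabsV cabsX mulrC.
  have Tz1 : triangle kappa rho z1.
    by apply/triangleP => //; case: zs => h1 h2; split=> //; exact: ltW.
  have Fle : forall z, triangle kappa rho z -> nr (F z) <= M.
    apply: (@maximum_principle _ _ _ _ _ (2 * rho)) => //.
    - by apply: triangle_attains_max => //; exact: ltW.
    - move=> z Tz; apply: (dquotM nr_ge0 nrD nrZ_le) => //.
      apply: sdquotV; first exact: gk0.
      apply: sdquotX; apply: (dquotD (@cabsD R)); first exact: sdquot_cst.
      by apply: sdquotM; [exact: sdquot_cst|apply: sdquotX; exact: sdquot_id].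
    - move=> z /(triangleP rho z k0)[x0 xr yx]; apply: le_trans (cabs_ReIm _) _.
      rewrite (ger0_norm x0).
      have : kappa * complex.Re z <= 1 * rho by rewrite ler_pM // ltW.
      lra.
    move=> z Tz; have gz1 := g1 z Tz.
    have gk1 : 1 <= cabs (g z) ^+ k by rewrite exprn_ege1.
    have gkp : 0 < cabs (g z) ^+ k by lra.
    have [zs'|zs'] := pselect (sector kappa z); last first.
      left; rewrite nF ler_pdivrMr //; apply: le_trans (fout z zs') _.
      by rewrite ler_peMr.
    have /(triangleP rho z k0)[x0 xr yx] := Tz.
    have [xrE|xrN] := eqVneq (complex.Re z) rho.
      left; rewrite nF ler_pdivrMr //; apply: le_trans (fgrow z) _.
      rewrite ler_wpM2l //.
      have h1 : expR (y / 2) <= cabs (g z) ^+ k.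
        apply: le_trans (damping_large y0 yk) _.
        have yk0 : 0 <= 1 + y / k%:R by apply: addr_ge0 => //; exact: divr_ge0.
        rewrite lerXn2r ?nnegrE ?cabs_ge0 //.
        apply: le_trans (Reg z Tz); rewrite xrE lerD2l /e /y.
        have E (a b d l : R) : a * b / d / l = a / l * (b / d) by ring.
        by rewrite E.
      apply: le_trans h1; rewrite ler_expR.
      have cz : cabs z <= 2 * rho.
        apply: le_trans (cabs_ReIm _) _; rewrite (ger0_norm x0) xrE.
        by move: yx; rewrite xrE; nra.
      apply: le_trans (_ : c * (3 * rho) ^+ m <= _).
        rewrite ler_wpM2l // lerXn2r ?nnegrE ?addr_ge0 ?mulr_ge0 ?cabs_ge0 ?(ltW rho0) //.
        lra.
      rewrite exprMn mulrA; apply: le_trans (_ : delta * rho / 4 * rho ^+ m <= _).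
        by rewrite ler_wpM2r // exprn_ge0 // ltW.
      by rewrite /y exprS; lra.
    right; have {}xr : complex.Re z < rho by rewrite lt_neqAle xrN.
    case: zs' => xp ylt.
    pose r := Num.min (Num.min (complex.Re z) (rho - complex.Re z))
      ((kappa * complex.Re z - `|complex.Im z|) / (1 + kappa)).
    have k1 : 0 < 1 + kappa by lra.
    exists r.
      by rewrite !lt_min xp !subr_gt0 xr /= divr_gt0 // subr_gt0.
    move=> w wz; have h1 := le_lt_trans (Re_cabs _) wz; have h2 := le_lt_trans (Im_cabs _) wz.
    have r1 : r <= complex.Re z by rewrite !ge_min lexx.
    have r2 : r <= rho - complex.Re z by rewrite !ge_min lexx orbT.
    have r3 : r * (1 + kappa) <= kappa * complex.Re z - `|complex.Im z|.
      by rewrite -ler_pdivlMr // !ge_min lexx !orbT.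
    rewrite ReD ReN ltr_norml in h1; case/andP: h1 => h1 h1'.
    have imN : complex.Im (w - z) = complex.Im w - complex.Im z by case: (w) (z) => [? ?] [? ?].
    rewrite imN in h2.
    have h3 := ler_normD (complex.Im w - complex.Im z) (complex.Im z); rewrite subrK in h3.
    apply/triangleP => //; split; [lra|lra|].
    have : kappa * (complex.Re z - r) <= kappa * complex.Re w by rewrite ler_pM2l //; lra.
    lra.
  have := Fle _ Tz1; rewrite nF ler_pdivrMr; last first.
    by rewrite exprn_gt0 // (lt_le_trans ltr01) // g1.
  move=> /le_trans; apply; rewrite ler_wpM2l //.
  apply: le_trans (damping_small k _); last first.
    by rewrite mulr_ge0 ?(ltW d0) // exprn_ge0 // cabs_ge0.
  rewrite lerXn2r ?nnegrE ?cabs_ge0 ?addr_ge0 ?divr_ge0 ?mulr_ge0 ?exprn_ge0 ?cabs_ge0 ?(ltW d0) //.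
  apply: le_trans (cabsD _ _) _; rewrite cabs1 lerD2l cabsM cabs_real gtr0_norm //.
  by rewrite cabsX /e mulrAC.
apply: le_small => e e0; set A := cabs z1 ^+ m.+1 in damp.
have A0 : 0 <= A by rewrite exprn_ge0 // cabs_ge0.
(* The damping is now removed: the first bound gives [s <= 1 / 2], where [expR s <= 1 + 2 * s], and
   the second gives [2 * M * s <= e]. *)
pose delta := Num.min (1 / (2 * (A + 1))) (e / (2 * (M + 1) * (A + 1))).
have A1 : 0 < A + 1 by lra.
have M1 : 0 < M + 1 by lra.
have d0 : 0 < delta.
  have h1 : 0 < 1 / (2 * (A + 1)) by rewrite divr_gt0 // mulr_gt0.
  have h2 : 0 < e / (2 * (M + 1) * (A + 1)) by rewrite divr_gt0 // !mulr_gt0.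
  by rewrite lt_min h1 h2.
apply: le_trans (damp _ d0) _; set s := delta * A.
have s0 : 0 <= s by rewrite mulr_ge0 // ltW.
have s1 : s <= 1 / 2.
  have : delta <= 1 / (2 * (A + 1)) by rewrite ge_min lexx.
  rewrite ler_pdivlMr ?mulr_gt0 // /s; lra.
have s2 : 2 * M * s <= e.
  have : delta <= e / (2 * (M + 1) * (A + 1)) by rewrite ge_min lexx orbT.
  rewrite ler_pdivlMr ?mulr_gt0 // /s => h.
  apply: le_trans h.
  have : 0 <= delta * (M + A + 1) by rewrite mulr_ge0 ?addr_ge0 // ltW.
  by move: (delta) => dl; lra.
have : expR s <= 1 + 2 * s.
  have h := expR_ge1Dx (- s); rewrite expRN in h.
  have e1 := expR_gt0 s.
  have h2 : expR s * (1 - s) <= 1.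
    by rewrite -[leRHS](divff (lt0r_neq0 e1)) ler_pM2l.
  nra.
move=> h; apply: le_trans (ler_wpM2l M0 h) _; lra.
Qed.

Lemma square_attains_max (rho : R) : 0 <= rho ->
  attains_max [set Complex p.1 p.2 | p in
    [set p : R * R | - rho <= p.1 <= rho /\ - rho <= p.2 <= rho]].
Proof.
move=> r0; apply: (@rectangle_attains_max _ _ _ _ _ _ 1) => //.
- by rewrite (le_trans _ r0) // oppr_le0.
- by rewrite (le_trans _ r0) // oppr_le0.
by move=> p q _ _ _; rewrite mul1r; exact: cabs_ReIm.
Qed.

(** On the square of half-side [rho], points of modulus at least [rho] satisfy
    [nr (f z) <= M / rho <= e], and all others are interior, so the maximum principle bounds [f 0]
    by [e]. *)
Theorem vanishing_at_infinity f (M : R) : 0 <= M -> (forall z, hdquot 3 f z) ->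
  (forall z, cabs z * nr (f z) <= M) -> f 0 = 0.
Proof.
move=> M0 hf fM; apply: nr_small => e e0.
pose rho := M / e + 1; have rho0 : 0 < rho by rewrite ltr_wpDl // divr_ge0 // ltW.
have rhoe : M <= e * rho.
  by rewrite /rho mulrDr mulrC divfK ?gt_eqF // lerDl mulr1 ltW.
apply: (@maximum_principle _ _ _ f e (2 * rho) (square_attains_max (ltW rho0))) => //.
- exact: ltW.
- move=> _ [[x y] /= [xr yr] <-]; apply: le_trans (cabs_ReIm _) _ => /=.
  have : `|x| <= rho by rewrite ler_norml.
  have : `|y| <= rho by rewrite ler_norml.
  lra.
- move=> _ [[x y] /= [xr yr] <-]; set z := Complex x y.
  have [big|small] := leP rho (cabs z).
    left; have zp : 0 < cabs z by lra.
    rewrite -(ler_pM2l zp); apply: le_trans (fM z) _; apply: le_trans rhoe _.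
    by rewrite mulrC ler_pM2r.
  right; exists (rho - cabs z) => [|w wz]; first by rewrite subr_gt0.
  have wr : cabs w <= rho.
    by have := cabsD (w - z) z; rewrite subrK; lra.
  exists (complex.Re w, complex.Im w); last by case: (w).
  by rewrite /= -!ler_norml (le_trans (Re_cabs _) wr) (le_trans (Im_cabs _) wr).
exists (0, 0) => //=; rewrite oppr_le0 ltW //.
Qed.

(** By the resolvent identity the difference quotient of [f] is [G (V (f w))], again a bounded
    operator applied to [f]. Carrying an arbitrary [A] makes the induction close on itself. *)
Lemma resolvent_dquot (V : X -> X) f (h : X) : blin V ->
  (forall z, exists2 G : X -> X, blin G & forall x, G (x - z *: V x) = x) ->
  (forall z, f z - z *: V (f z) = h) ->
  forall k (A : X -> X) z0, blin A -> hdquot k (fun z => A (f z)) z0.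
Proof.
move=> bV inv fE k A z0 bA; have [G bG GK] := inv z0.
have [lV _] := bV; have [lG _] := bG.
have step w : f w = f z0 + (w - z0) *: G (V (f w)).
  rewrite -[f w in LHS]GK -[f z0]GK fE -(linZ lG) -(linD lG); congr (G _).
  by rewrite -{1}(fE w); vec.
elim: k A bA => [|k ih] A bA.
  have [lA [a a0 Aa]] := bA.
  have [_ [c cc0 Gc]] := blin_comp bG bV.
  have c1 : 0 < 2 * (c + 1) by lra.
  exists (a * (2 * nr (f z0))), (2 * (c + 1))^-1; split.
  - by rewrite !mulr_ge0 ?nr_ge0.
  - by rewrite invr_gt0.
  move=> w lt; apply: le_trans (Aa _) _; rewrite ler_wpM2l //.
  have h1 : nr (f w) <= nr (f z0) + cabs (w - z0) * (c * nr (f w)).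
    rewrite {1}step; apply: le_trans (nrD _ _) _; rewrite lerD2l nrZ.
    by rewrite ler_wpM2l ?cabs_ge0 //; exact: Gc.
  have h2 : cabs (w - z0) * (2 * (c + 1)) <= 1.
    by rewrite -ler_pdivlMr // mul1r ltW.
  have := nr_ge0 (f w); have := cabs_ge0 (w - z0).
  move: (cabs _) (nr (f w)) (nr (f z0)) h1 h2 => t p q h1 h2 t0 p0.
  have : t * c <= 1 / 2 by lra.
  move=> h3; have : t * c * p <= 1 / 2 * p by rewrite ler_wpM2r.
  lra.
exists (fun w => A (G (V (f w)))).
  by apply: (ih (A \o (G \o V))); apply: blin_comp => //; exact: blin_comp.
exists 1 => // w _; have [lA _] := bA.
by rewrite {1}step (linD lA) (linZ lA).
Qed.

End phragmen_lindelof.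

(** * Schmidt expansions *)

Section schmidt.
Context {R : realType} {X : hilbert R}.
Implicit Types (x y z : X).

(** The inverse of 0 being 0, the zero vector stays 0, and the Gram-Schmidt process below needs no
    linear independence. *)
Definition unitize x : X := (nr x)^-1%:C%C *: x.

Fixpoint gs_proj (u : nat -> X) n : X -> X :=
  if n is n'.+1 then
    let e := unitize (u n' - gs_proj u n' (u n')) in
    fun x => gs_proj u n' x + ip x e *: e
  else fun=> 0.

Definition gs_vec u n := unitize (u n - gs_proj u n (u n)).

Lemma gs_projE u n x : gs_proj u n x = \sum_(i < n) ip x (gs_vec u i) *: gs_vec u i.
Proof.
by elim: n => [|n ih] /=; rewrite ?big_ord0 // big_ord_recr /= -ih.
Qed.

Lemma unitize_nr x : unitize x = 0 \/ nr (unitize x) = 1.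
Proof.
have [->|x0] := eqVneq x 0; first by left; rewrite /unitize scaler0.
by right; exact: nr_normalize.
Qed.

Lemma unitizeK x : x = (nr x)%:C%C *: unitize x.
Proof.
have [->|x0] := eqVneq x 0; first by rewrite /unitize !scaler0.
by rewrite /unitize scalerA -rmorphM /= divff ?scale1r // gt_eqF // nr_gt0.
Qed.

Lemma gs_vec_unit u n : gs_vec u n = 0 \/ nr (gs_vec u n) = 1.
Proof. exact: unitize_nr. Qed.

Lemma gs_vec_le u n : nr (gs_vec u n) <= 1.
Proof. by have [->|->] := gs_vec_unit u n; rewrite ?nr0. Qed.

Lemma gs_orthogonal u n i : (i < n)%N -> ip (gs_vec u n) (gs_vec u i) = 0.
Proof.
elim/ltn_ind: n i => n ih i lt.
suff h x : ip (x - gs_proj u n x) (gs_vec u i) = 0.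
  by rewrite /gs_vec /unitize ipZl -/(gs_vec u i) h mulr0.
rewrite ipBl gs_projE ip_suml (bigD1 (Ordinal lt)) //= big1 ?addr0 => [|j ji].
  rewrite ipZl ip_sq; have [->|->] := gs_vec_unit u i.
    by rewrite ip0r mul0r subrr.
  by rewrite expr1n mulr1 subrr.
rewrite ipZl; have [lt2|lt2|E] := ltngtP i j.
- by rewrite (ih j) ?mulr0.
- by rewrite (ipC (gs_vec u i)) (ih i) // conjC0 mulr0.
by case/eqP: ji; apply: val_inj.
Qed.

Lemma gs_residual_orth u n x i : (i < n)%N ->
  ip (x - gs_proj u n x) (gs_vec u i) = 0.
Proof.
move=> lt; rewrite ipBl gs_projE ip_suml (bigD1 (Ordinal lt)) //= big1 ?addr0.
  rewrite ipZl ip_sq; have [->|->] := gs_vec_unit u i.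
    by rewrite ip0r mul0r subrr.
  by rewrite expr1n mulr1 subrr.
move=> j ji; rewrite ipZl; have [lt2|lt2|E] := ltngtP i j.
- by rewrite gs_orthogonal ?mulr0.
- by rewrite (ipC (gs_vec u i)) gs_orthogonal // conjC0 mulr0.
by case/eqP: ji; apply: val_inj.
Qed.

Lemma orth_gs u n x : (forall i, (i < n)%N -> ip x (gs_vec u i) = 0) ->
  forall i, (i < n)%N -> ip x (u i) = 0.
Proof.
move=> h i lt; have := unitizeK (u i - gs_proj u i (u i)).
rewrite -/(gs_vec u i) => /eqP; rewrite subr_eq => /eqP ->.
rewrite ipDr ipZr h // mulr0 add0r gs_projE ip_sumr big1 // => j _.
by rewrite ipZr h ?mulr0 // (ltn_trans (ltn_ord j)).
Qed.

Lemma gs_orth u n i : (i < n)%N -> ip (gs_vec u n) (u i) = 0.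
Proof. by move=> lt; apply: (orth_gs _ lt) => j jn; exact: gs_orthogonal. Qed.

Lemma gs_residual_le u n x : nr (x - gs_proj u n x) <= nr x.
Proof.
rewrite -(ler_pXn2r (n := 2)) ?nnegrE ?nr_ge0 //.
rewrite -[X in _ <= nr X ^+ 2](subrK (gs_proj u n x)) [leRHS]sqr_nrD.
have -> : ip (x - gs_proj u n x) (gs_proj u n x) = 0.
  rewrite {2}gs_projE ip_sumr big1 // => i _.
  by rewrite ipZr gs_residual_orth ?mulr0.
by rewrite /= mulr0 addr0 lerDl sqr_ge0.
Qed.

(** Equal norms make a sequence Cauchy under [A] as soon as it is Cauchy under [Q]. *)
Lemma sqrt_cptop (Q A : X -> X) : cptop Q -> linear A ->
  (forall x, nr (A x) = nr (Q x)) -> cptop A.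
Proof.
move=> cQ lA AQ; have [lQ _] := cQ; split=> // u u1.
have [y yP] := cptop_seq cQ u1.
have /boolp.choice[s sP] (n : nat) : exists k,
    (n <= k)%N /\ nr (Q (u k) - y) < n.+1%:R^-1.
  by have [|k ? ?] := yP n.+1%:R^-1 n; [rewrite invr_gt0|exists k].
have [|z zP] := hilbert_complete (u := fun n => A (u (s n))).
  move=> e e0; have e2 : 0 < e / 2 by rewrite divr_gt0.
  have [N NP] := inv_natS_lt e2; exists N => m n Nm Nn.
  rewrite -(linB lA) AQ (linB lQ); apply: le_lt_trans (nr_trans y _ _) _.
  rewrite [e]splitr [nr (y - _)]nrBC ltrD //.
    by apply: lt_trans (sP m).2 (NP _ Nm).
  by apply: lt_trans (sP n).2 (NP _ Nn).
exists z => e N /zP[M MP]; exists (s (maxn N M)).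
  by apply: leq_trans (sP _).1; exact: leq_maxl.
by apply: MP; exact: leq_maxr.
Qed.

(** The indices with [s k = lam] are as many as the dimension of the eigenspace, so a basis can be
    distributed over them. That it spans is recorded by orthogonality, the only form used later. *)
Lemma eigen_enumeration (A : X -> X) (s : nat -> R) :
  (forall lam : R, 0 < lam -> exists2 m : nat,
     has_dim [set x | A x = lam%:C%C *: x] m & ([set k | s k = lam] #= `I_m)%card) ->
  exists u : nat -> X,
    (forall k, 0 < s k -> A (u k) = (s k)%:C%C *: u k) /\
    (forall lam x z, 0 < lam -> A x = lam%:C%C *: x ->
       (forall k, s k = lam -> ip z (u k) = 0) -> ip z x = 0).
Proof.
move=> dim.
have /boolp.choice[w wP] (lam : R) : exists w : nat -> X, 0 < lam ->
    (forall k, s k = lam -> A (w k) = lam%:C%C *: w k) /\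
    (forall x z, A x = lam%:C%C *: x ->
       (forall k, s k = lam -> ip z (w k) = 0) -> ip z x = 0).
  have [l0|l0] := ltP 0 lam; last by exists (fun=> 0).
  have [m [v [_ vE]] /card_set_bijP[f [fS _ fsurj]]] := dim lam l0.
  pose w k := if insub (f k) is Some i then v i else 0.
  have wk k : s k = lam -> exists i : 'I_m, w k = v i.
    move=> sk; have lt : (f k < m)%N by exact: fS.
    by exists (Ordinal lt); rewrite /w insubT.
  have wv i : exists2 k, s k = lam & w k = v i.
    have [k sk fk] := fsurj (val i) (ltn_ord i).
    by exists k => //; rewrite /w fk valK.
  exists w => _; split=> [k /wk[i ->]|x z Ax h].
    have : [set x | A x = lam%:C%C *: x] (v i); last by [].
    rewrite vE; exists (fun j => (j == i)%:R).
    by rewrite (bigD1 i) //= eqxx scale1r big1 ?addr0 // => j /negbTE ->; rewrite scale0r.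
  have : [set x | A x = lam%:C%C *: x] x by [].
  rewrite vE => -[c ->]; rewrite ip_sumr big1 // => i _; rewrite ipZr.
  by have [k sk <-] := wv i; rewrite h // mulr0.
exists (fun k => w (s k) k); split=> [k sk|lam x z l0 Ax h].
  by have [h _] := wP _ sk; exact: h.
by have [_ h2] := wP _ l0; apply: (h2 x) => // k sk; rewrite -sk; exact: h.
Qed.

(** The upper half of the min-max principle. If the norm [l] of [A] on the orthogonal complement of
    the first [N] vectors exceeded [s N], compactness would yield an eigenvector for [l] there; but
    all eigenvectors for values above [s N] are spanned by those [N] vectors. *)
Lemma sqrt_le_on_orth (A : X -> X) (s : nat -> R) (u : nat -> X) : cptop A ->
  (forall x y, ip (A x) y = ip x (A y)) -> (forall x, 0 <= ip (A x) x) ->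
  (forall k, 0 <= s k.+1 <= s k) ->
  (forall k, A (u k) = (s k)%:C%C *: u k) ->
  (forall lam x z, 0 < lam -> A x = lam%:C%C *: x ->
     (forall k, s k = lam -> ip z (u k) = 0) -> ip z x = 0) ->
  forall N x, (forall k, (k < N)%N -> ip x (u k) = 0) -> nr (A x) <= s N * nr x.
Proof.
move=> cA sA pA sP uA eig N.
have sge0 k : 0 <= s k by have /andP[h1 h2] := sP k; exact: le_trans h2.
have smono k : (N <= k)%N -> s k <= s N.
  move=> /subnK <-; elim: (k - N)%N => [//|j ih]; rewrite addSn.
  by apply: le_trans ih; have /andP[] := sP (j + N)%N.
have [lA [c c0 Ac]] := cptop_blin cA.
pose Z := [set x | forall k, (k < N)%N -> ip x (u k) = 0].
have ZE : Z = orth [set u k | k in `I_N].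
  apply/seteqP; split=> [x h _ [k kN <-]|x h k kN]; first exact: h.
  by apply: h; exists k.
have sZ : subspace Z by rewrite ZE; exact: orth_subspace.
have cZ : closed_set Z by rewrite ZE; exact: orth_closed.
have AZ x : Z x -> Z (A x).
  by move=> Zx k kN; rewrite sA uA ipZr Zx // mulr0.
pose E := [set nr (A x) | x in [set x | Z x /\ nr x <= 1]].
have hE : has_sup E.
  split; first by exists (nr (A 0)), 0 => //; split; [case: sZ|rewrite nr0].
  exists c => _ [x [_ x1] <-]; apply: le_trans (Ac x) _.
  by rewrite ler_piMr.
pose l := sup E.
have lub x : Z x -> nr (A x) <= l * nr x.
  move=> Zx; have [->|x0] := eqVneq x 0; first by rewrite (lin0 lA) nr0 mulr0.
  have px := nr_gt0 x0; rewrite -ler_pdivrMr //.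
  have : nr (A ((nr x)^-1%:C%C *: x)) <= l.
    apply: ub_le_sup; first by case: hE.
    exists ((nr x)^-1%:C%C *: x) => //; split; first exact: (subspaceZ _ sZ Zx).
    by rewrite nr_normalize.
  by rewrite (linZ lA) nrZ cabs_real ger0_norm ?invr_ge0 ?nr_ge0 // mulrC.
suff ls : l <= s N.
  by move=> x Zx; apply: le_trans (lub x Zx) _; rewrite ler_wpM2r ?nr_ge0.
rewrite leNgt; apply/negP => ls; have l0 : 0 < l by exact: le_lt_trans (sge0 N) ls.
have /boolp.choice[v vP] (n : nat) : exists x, [/\ Z x, nr x <= 1 & l - n.+1%:R^-1 < nr (A x)].
  have n0 : (0 : R) < n.+1%:R^-1 by rewrite invr_gt0.
  by have [_ [x [Zx x1] <-] lt] := sup_adherent n0 hE; exists x.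
have cAA : cptop (A \o A) by apply: cptop_compl => //; exact: cptop_blin.
have [|y yP] := cptop_seq (c := 1) (u := v) cAA; first by move=> n; case: (vP n).
have l2 : (l ^+ 2)%:C%C != 0 :> R[i] by rewrite eq_complex /= negb_and expf_neq0 // gt_eqF.
pose x := (l ^+ 2)%:C%C^-1 *: y.
(* Expanding the square and using the maximality of [l] leaves
   [l ^+ 2 * (l ^+ 2 - nr (A (v n)) ^+ 2)], which is small because [v n] is nearly maximising. *)
have gap n : nr (A (A (v n)) - (l ^+ 2)%:C%C *: v n) ^+ 2 <= 2 * l ^+ 3 * n.+1%:R^-1.
  have [Zv v1 vl] := vP n.
  have h1 : nr (A (A (v n))) <= l * nr (A (v n)) by apply: lub; exact: AZ.
  have h2 : nr (A (v n)) <= l.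
    by apply: le_trans (lub _ Zv) _; rewrite ler_piMr // ltW.
  rewrite -scaleNr sqr_nrD nrZ ipZr rmorphN /= conjCr sA ip_sq cabsN cabs_real.
  rewrite mulNr ReN ReRM /= (ger0_norm (sqr_ge0 l)) exprMn.
  have a0 := nr_ge0 (A (v n)); have b0 := nr_ge0 (v n); have d0 := nr_ge0 (A (A (v n))).
  have h3 : nr (A (A (v n))) ^+ 2 <= l ^+ 2 * nr (A (v n)) ^+ 2.
    by rewrite -exprMn lerXn2r ?nnegrE // mulr_ge0 // ltW.
  have h4 : (l ^+ 2) ^+ 2 * nr (v n) ^+ 2 <= (l ^+ 2) ^+ 2.
    by rewrite ler_piMr ?sqr_ge0 // expr_le1.
  apply: le_trans (_ : l ^+ 2 * (l ^+ 2 - nr (A (v n)) ^+ 2) <= _).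
    by rewrite mulrBr -expr2; lra.
  rewrite [2 * _ * _](_ : _ = l ^+ 2 * (2 * l * n.+1%:R^-1)); last by rewrite !exprS; ring.
  rewrite ler_pM2l ?exprn_gt0 //; move: vl a0 h2; move: (n.+1%:R^-1) (nr (A (v n))) => t a.
  move=> vl a0 h2; rewrite subr_sqr.
  have h5 : (l - a) * (l + a) <= t * (l + a) by rewrite ler_wpM2r //; lra.
  have h6 : 0 <= t by lra.
  have h7 : t * (l + a) <= t * (2 * l) by rewrite ler_wpM2l //; lra.
  lra.
have near (e : R) : 0 < e -> exists n, [/\ nr (v n - x) <= e, l - e <= nr (A (v n))
    & nr (A (A (v n)) - (l ^+ 2)%:C%C *: v n) <= e].
  move=> e0; pose d := Num.min e (e * l ^+ 2 / 2).
  have l20 : 0 < l ^+ 2 by rewrite exprn_gt0.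
  have d0 : 0 < d by rewrite lt_min e0 divr_gt0 // mulr_gt0.
  have d1 : d <= e by rewrite ge_min lexx.
  have d2 : d <= e * l ^+ 2 / 2 by rewrite ge_min lexx orbT.
  have l30 : 0 < 2 * l ^+ 3 by rewrite mulr_gt0 // exprn_gt0.
  have m0 : 0 < Num.min e (d ^+ 2 / (2 * l ^+ 3)).
    by rewrite lt_min e0 divr_gt0 // exprn_gt0.
  have [N1 N1P] := inv_natS_lt m0.
  have [n Nn lt] := yP d N1 d0; exists n.
  have gd : nr (A (A (v n)) - (l ^+ 2)%:C%C *: v n) <= d.
    rewrite -(ler_pXn2r (n := 2)) ?nnegrE ?nr_ge0 ?(ltW d0) //.
    apply: le_trans (gap n) _; have := N1P n Nn; rewrite lt_min => /andP[_].
    by rewrite ltr_pdivlMr // mulrC => /ltW.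
  split; last exact: le_trans gd d1.
    have -> : v n - x = (l ^+ 2)%:C%C^-1 *:
        ((A (A (v n)) - y) - (A (A (v n)) - (l ^+ 2)%:C%C *: v n)).
      by rewrite /x; move: ((l ^+ 2)%:C%C) l2 => L L0; vec.
    rewrite nrZ cabsV cabs_real ger0_norm ?sqr_ge0 // mulrC ler_pdivrMr //.
    apply: le_trans (nrB _ _) _; apply: le_trans (lerD (ltW lt) gd) _; lra.
  have := N1P n Nn; rewrite lt_min => /andP[h1 _]; have [_ _ h2] := vP n.
  by move: h1 h2; move: (n.+1%:R^-1) => t; lra.
have Zx : Z x.
  apply: cZ => e e0; have e2 : 0 < e / 2 by rewrite divr_gt0.
  have [n [h _ _]] := near _ e2; exists (v n); first by case: (vP n).
  by apply: le_lt_trans h _; lra.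
have l20 : 0 < l ^+ 2 by rewrite exprn_gt0.
have Ax : A (A x) = (l ^+ 2)%:C%C *: x.
  apply/eqP; rewrite -subr_eq0; apply/eqP; apply: nr_small => e e0.
  have k0 : 0 < c * c + 1 + l ^+ 2 by have := mulr_ge0 c0 c0; lra.
  have e2 : 0 < e / (c * c + 1 + l ^+ 2) by rewrite divr_gt0.
  have [n [h1 _ h3]] := near _ e2.
  have -> : A (A x) - (l ^+ 2)%:C%C *: x = A (A (x - v n)) +
      ((A (A (v n)) - (l ^+ 2)%:C%C *: v n) + (l ^+ 2)%:C%C *: (v n - x)).
    by rewrite !(linB lA); vec.
  apply: le_trans (nrD _ _) _; apply: le_trans (lerD (lexx _) (nrD _ _)) _.
  rewrite nrZ cabs_real gtr0_norm //; set d := e / _ in h1 h3.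
  have q1 : nr (A (A (x - v n))) <= c * (c * d).
    apply: le_trans (Ac _) _; rewrite ler_wpM2l //; apply: le_trans (Ac _) _.
    by rewrite ler_wpM2l // nrBC.
  have q2 : l ^+ 2 * nr (v n - x) <= l ^+ 2 * d by rewrite ler_wpM2l // ltW.
  apply: le_trans (lerD q1 (lerD h3 q2)) _.
  rewrite (_ : c * (c * d) + _ = d * (c * c + 1 + l ^+ 2)); last by ring.
  by rewrite /d divfK // gt_eqF.
have x0 : x != 0.
  apply/eqP => x00; have c1 : 0 < 2 * (c + 1) by lra.
  have e2 : 0 < l / (2 * (c + 1)) by rewrite divr_gt0.
  have [n [h1 h2 _]] := near _ e2; rewrite x00 subr0 in h1.
  have h3 : nr (A (v n)) <= c * (l / (2 * (c + 1))).
    by apply: le_trans (Ac _) _; rewrite ler_wpM2l.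
  have : (c + 1) * (l / (2 * (c + 1))) = l / 2 by field; rewrite gt_eqF //; lra.
  by move: (l / (2 * (c + 1))) h2 h3 => t; lra.
(* As [A^2 - l^2] is [(A - l) (A + l)], this [z] is an eigenvector for [l] or 0; positivity of [A]
   excludes 0 through the inner product with [x]. *)
clearbody x; pose z := A x + l%:C%C *: x.
have Az : A z = l%:C%C *: z.
  by rewrite /z (linD lA) (linZ lA) Ax rmorphXn /=; vec.
have Zz : Z z.
  by apply: (subspaceD sZ); [exact: AZ|exact: (subspaceZ _ sZ Zx)].
have z0 : ip z z = 0.
  apply: (eig l) => // k sk; apply: Zz; rewrite ltnNge; apply/negP => /smono.
  by rewrite sk leNgt ls.
have zz : z = 0.
  by apply: nr_eq0; apply/eqP; rewrite -sqrf_eq0 nr_sqE z0.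
have : complex.Re (ip z x) = 0 by rewrite zz ip0l.
rewrite /z ipDl ipZl ip_sq ReD -rmorphM /=.
have : 0 <= complex.Re (ip (A x) x) by have := pA x; rewrite lecE => /andP[].
have : 0 < l * nr x ^+ 2 by rewrite mulr_gt0 // exprn_gt0 // nr_gt0.
lra.
Qed.

(** [Q] enters only through its norms, which are those of the operator [A] behind its s-numbers. The
    eigenvectors of [A] are orthonormalised, since within one eigenspace they are merely
    independent. *)
Theorem schmidt_expansion (Q : X -> X) (s : nat -> R) : cptop Q -> s_numbers Q s ->
  exists e : nat -> X, [/\ forall n, nr (e n) <= 1,
    forall N x, nr (Q (x - \sum_(i < N) ip x (e i) *: e i)) <= s N * nr x &
    forall N, nr (Q (e N)) <= s N].
Proof.
move=> cQ [Ka [A [adj [_ sA pA AA] sP dim]]].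
have lA : linear A by move=> a x y; rewrite linearP.
have AQ x : nr (A x) = nr (Q x).
  apply/eqP; rewrite -(eqrXn2 (n := 2)) ?nr_ge0 // !nr_sqE.
  by rewrite sA AA -adj.
have [u [uA eig]] := eigen_enumeration dim.
have sge0 k : 0 <= s k by have /andP[h1 h2] := sP k; exact: le_trans h2.
(* Where [s k = 0] the enumeration says nothing about [u k]; the value 0 makes the eigenvector
   equation hold at every index. *)
pose u' k := if 0 < s k then u k else 0.
have u'A k : A (u' k) = (s k)%:C%C *: u' k.
  by rewrite /u'; case: ifP => [/uA|_] //; rewrite (lin0 lA) scaler0.
have main := @sqrt_le_on_orth A s u' (sqrt_cptop cQ lA AQ) sA _ sP u'A.
have {}main N x : (forall k, (k < N)%N -> ip x (u' k) = 0) -> nr (Q x) <= s N * nr x.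
  rewrite -AQ; apply: main => [y|lam y z l0 Ay h]; first exact: pA.
  apply: (eig lam) => // k sk; have := h k sk; rewrite /u' sk l0 //.
exists (gs_vec u'); split=> [n|N x|N].
- exact: gs_vec_le.
- rewrite -gs_projE; apply: le_trans (main N _ _) _.
    by apply: orth_gs => i; exact: gs_residual_orth.
  by rewrite ler_wpM2l // gs_residual_le.
apply: le_trans (main N _ _) _; first by move=> k kN; exact: gs_orth.
by rewrite ler_piMr // gs_vec_le.
Qed.

End schmidt.

(** * Keldysh's theorem *)

Section keldysh.
Context {R : realType} {X : hilbert R}.
Variables Q K : X -> X.
Hypotheses (cQ : cptop Q) (sQ : forall x y, ip (Q x) y = ip x (Q y))
  (pQ : forall x, 0 <= ip (Q x) x) (iQ : forall x, Q x = 0 -> x = 0)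
  (cK : cptop K).
Implicit Types (x y z : X) (l : R[i]).

(** If [Re l * t <= 1 / 2], the real part is at least 1/2; otherwise the imaginary part has modulus
    at least [kappa * Re l * t > kappa / 2]. *)
Lemma sector_dist (kappa : R) l (t : R) : 0 < kappa -> ~ sector kappa l -> 0 <= t ->
  Num.min 1 kappa / 2 <= cabs (1 - l * t%:C%C).
Proof.
case: l => x y k0 ns t0; set c := _ / 2.
have c1 : c <= 1 / 2 by rewrite ler_pM2r // ge_min lexx.
have c2 : c <= kappa / 2 by rewrite ler_pM2r // ge_min lexx orbT.
have hre : 1 - x * t <= cabs (1 - Complex x y * t%:C%C).
  have := Re_cabs (1 - Complex x y * t%:C%C); apply: le_trans.
  apply: le_trans (ler_norm _).
  suff -> : complex.Re (1 - Complex x y * t%:C%C) = 1 - x * t by [].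
  by rewrite /= mulr0 subr0.
have him : `|y| * t <= cabs (1 - Complex x y * t%:C%C).
  have := Im_cabs (1 - Complex x y * t%:C%C); apply: le_trans.
  suff -> : complex.Im (1 - Complex x y * t%:C%C) = - (y * t).
    by rewrite normrN normrM (ger0_norm t0).
  by rewrite /= mulr0 !add0r.
have [xt|xt] := leP (x * t) (1 / 2); first lra.
have xp : 0 < x by rewrite ltNge; apply/negP => x0; nra.
have yx : kappa * x <= `|y|.
  by rewrite leNgt; apply/negP => h; apply: ns.
apply: le_trans him; have : kappa * x * t <= `|y| * t by rewrite ler_wpM2r.
have : kappa * (1 / 2) <= kappa * (x * t) by rewrite ler_pM2l // ltW.
lra.
Qed.

(** By positivity [ip (Q x) x] is [t * nr x ^+ 2] with [t >= 0], so pairing with [x] reduces the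
    claim to [sector_dist]. *)
Lemma free_lower_bound (kappa : R) l x : 0 < kappa -> ~ sector kappa l ->
  Num.min 1 kappa / 2 * nr x <= nr (x - l *: Q x).
Proof.
move=> k0 ns; have [->|x0] := eqVneq x 0; first by rewrite nr0 mulr0 nr_ge0.
have px := nr_gt0 x0; rewrite -(ler_pM2r px); apply: le_trans (ip_le _ _).
have qr : ip (Q x) x = (complex.Re (ip (Q x) x))%:C%C.
  by have := pQ x; rewrite lecE /=; case: (ip _ _) => a b /= /andP[/eqP -> _].
pose t := complex.Re (ip (Q x) x) / nr x ^+ 2.
have t0 : 0 <= t.
  by apply: divr_ge0; [have := pQ x; rewrite lecE => /andP[]|exact: sqr_ge0].
have -> : ip (x - l *: Q x) x = (nr x ^+ 2)%:C%C * (1 - l * t%:C%C).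
  rewrite ipBl ipZl ip_sq qr /t mulrBr mulr1 mulrCA; congr (_ - _ * _).
  rewrite -rmorphM /=; congr (_%:C%C).
  by rewrite mulrC divfK // expf_neq0 // gt_eqF.
rewrite (_ : _ * nr x * nr x = nr x ^+ 2 * (Num.min 1 kappa / 2)); last by ring.
rewrite cabsM cabs_real (ger0_norm (sqr_ge0 _)).
by rewrite ler_pM2l ?exprn_gt0 //; exact: sector_dist.
Qed.

Lemma range_dense y (e : R) : 0 < e -> exists z, nr (Q z - y) < e.
Proof.
move=> e0; have [lQ _] := cQ.
have [|h ho|_ [z _ <-] lt] := @dense_of_orth _ _ (range Q) _ _ y e e0.
- split; first by exists 0 => //; rewrite (lin0 lQ).
  by move=> a _ _ [u _ <-] [v _ <-]; exists (a *: u + v) => //; rewrite lQ.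
- apply: iQ; apply: nr_eq0; apply/eqP; rewrite -sqrf_eq0 nr_sqE sQ ho //.
by exists z.
Qed.

(* Otherwise there are unit vectors [x n] and [l n -> oo] outside the sector with
   [x + K x - l Q x -> 0]; if [K (x n)] clusters at [y] and [Q z] approximates
   [- y], then [x n + z / l n] contradicts [free_lower_bound]. *)
Lemma outside_sector_bound (kappa : R) : 0 < kappa ->
  exists r C : R, [/\ 0 < r, 0 < C & forall l x, r <= cabs l -> ~ sector kappa l ->
    nr x <= C * nr (x + K x - l *: Q x)].
Proof.
move=> k0; have [lK _] := cK; have [lQ _] := cQ; apply: contrapT => no.
have /boolp.choice[p pP] (n : nat) : exists p : R[i] * X, [/\ n.+1%:R <= cabs p.1,
    ~ sector kappa p.1, nr p.2 = 1 & nr (p.2 + K p.2 - p.1 *: Q p.2) < n.+1%:R^-1].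
  apply: contrapT => h; apply: no; exists n.+1%:R, n.+1%:R; split; rewrite ?ltr0n //.
  move=> l x nl ns; have [->|x0] := eqVneq x 0; first by rewrite nr0 mulr_ge0 ?nr_ge0.
  rewrite leNgt; apply/negP => lt; apply: h.
  exists (l, (nr x)^-1%:C%C *: x); split=> //=; first exact: nr_normalize.
  rewrite (linZ lK) (linZ lQ).
  rewrite (_ : _ - _ = (nr x)^-1%:C%C *: (x + K x - l *: Q x)); last by vec.
  rewrite nrZ cabs_real ger0_norm ?invr_ge0 ?nr_ge0 // mulrC.
  by rewrite ltr_pdivrMr ?nr_gt0 // [_^-1 * _]mulrC ltr_pdivlMr ?ltr0n // mulrC.
have [|y yP] := cptop_seq (c := 1) (u := fun n => (p n).2) cK.
  by move=> n; case: (pP n) => _ _ ->.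
pose c := Num.min 1 kappa / 2.
have c0 : 0 < c by rewrite divr_gt0 // lt_min ltr01 k0.
have c1 : c <= 1 / 2 by rewrite ler_pM2r // ge_min lexx.
(* Four errors of size [c / 8] add up to [c / 2], which would force a norm of at most 1/2 on a
   vector within [c / 8] of a unit vector. *)
have c8 : 0 < c / 8 by lra.
have [z zP] := range_dense (- y) c8.
have z1 : 0 < nr z + 1 by rewrite ltr_wpDl ?nr_ge0.
have [N NP] := @inv_natS_lt R (c / 8 / (nr z + 1)) (divr_gt0 c8 z1).
have [n Nn yn] := yP (c / 8) N c8; have [nl ns x1 small] := pP n.
move: nl ns x1 small yn; case: (p n) => l x /= nl ns x1 small yn.
have n0 : (0 : R) < n.+1%:R by rewrite ltr0n.
have lp : 0 < cabs l by lra.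
have l0 : l != 0 by apply: contraTneq lp => ->; rewrite cabs0 ltxx.
have inv_l : (cabs l)^-1 <= n.+1%:R^-1 by rewrite lef_pV2.
have Nn1 := NP n Nn; rewrite ltr_pdivlMr // in Nn1.
have zl : nr (l^-1 *: z) <= c / 8.
  rewrite nrZ cabsV; apply: le_trans (ltW Nn1).
  by apply: ler_pM; rewrite ?invr_ge0 ?cabs_ge0 ?nr_ge0 // lerDl.
have sn : n.+1%:R^-1 <= c / 8.
  apply: le_trans (ltW Nn1); rewrite ler_peMr ?invr_ge0 ?(ltW n0) //.
  by rewrite lerDr nr_ge0.
have low := free_lower_bound (x + l^-1 *: z) k0 ns; rewrite -/c in low.
have E : x + l^-1 *: z - l *: Q (x + l^-1 *: z) =
    (x + K x - l *: Q x) - (K x - y) - (Q z - - y) + l^-1 *: z.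
  by rewrite (linD lQ) (linZ lQ) scalerDr scalerA divff // scale1r; vec.
have up : nr (x + l^-1 *: z - l *: Q (x + l^-1 *: z)) <= c / 8 + c / 8 + c / 8 + c / 8.
  rewrite E; apply: le_trans (nrD _ _) _; apply: lerD => //.
  apply: le_trans (nrB _ _) _; apply: lerD; last exact: ltW.
  apply: le_trans (nrB _ _) _; apply: lerD; last exact: ltW.
  exact: le_trans (ltW small) sn.
have h1 := nr_subr x (- (l^-1 *: z)); rewrite opprK nrN x1 in h1.
have : c * nr (x + l^-1 *: z) <= c * (1 / 2) by apply: le_trans low _; lra.
rewrite ler_pM2l //; lra.
Qed.

Lemma pencil_inverse (kappa r C : R) l : 
  (forall l x, r <= cabs l -> ~ sector kappa l -> nr x <= C * nr (x + K x - l *: Q x)) ->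
  r <= cabs l -> ~ sector kappa l ->
  exists2 G : X -> X, blin G &
    (forall x, G (x + K x - l *: Q x) = x) /\
    (forall y, G y + K (G y) - l *: Q (G y) = y).
Proof.
move=> bnd rl ns.
have cF : cptop (fun x => l *: Q x + -1 *: K x).
  by apply: cptop_add; exact: cptop_scale.
have FE x : x - (l *: Q x + -1 *: K x) = x + K x - l *: Q x by vec.
have [x xE|G bG [GK1 GK2]] := fredholm cF.
  have := bnd l x rl ns; rewrite -FE -xE subrr nr0 mulr0 => h.
  by apply: nr_eq0; apply/eqP; rewrite eq_le h nr_ge0.
by exists G => //; split=> [x|y]; rewrite -FE.
Qed.

(** [a] is so large that the disc of radius [r] around it lies inside the sector; moreover the
    sector translated by [a] is contained in the sector. *)
Lemma shifted_sector (kappa r : R) : 0 < kappa -> 0 < r -> exists2 a : R, 0 < a &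
  forall l, ~ sector kappa l -> r <= cabs (l - a%:C%C) /\ ~ sector kappa (l - a%:C%C).
Proof.
move=> k0 r0; exists (r + r / kappa + 1) => [|l ns].
  by rewrite !addr_gt0 // divr_gt0.
set a := _ + 1; have rk : 0 < r / kappa by rewrite divr_gt0.
have a0 : 0 < a by rewrite /a; lra.
have Rel : complex.Re (l - a%:C%C) = complex.Re l - a by rewrite ReD ReN.
have Iml : complex.Im (l - a%:C%C) = complex.Im l by case: l {ns Rel} => x y /=; rewrite oppr0 addr0.
split.
  rewrite leNgt; apply/negP => lt; apply: ns.
  have h1 := le_lt_trans (Re_cabs _) lt; have h2 := le_lt_trans (Im_cabs _) lt.
  rewrite Rel ltr_norml in h1; rewrite Iml in h2; case/andP: h1 => h1 _.
  have h3 : r / kappa < complex.Re l by rewrite /a in h1; lra.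
  split; first lra.
  by apply: lt_trans h2 _; rewrite mulrC -ltr_pdivrMr.
rewrite /sector /= Rel Iml => -[h1 h2]; apply: ns; split; first lra.
by apply: lt_trans h2 _; rewrite ltr_pM2l //; lra.
Qed.

Lemma sector_conj (kappa : R) l : sector kappa l^* -> sector kappa l.
Proof. by rewrite /sector /= ReJ ImJ normrN. Qed.

Variables (s : nat -> R) (q : nat) (S : R).
Hypotheses (sQs : s_numbers Q s) (s0 : forall e : R, 0 < e -> exists n, s n < e)
  (sS : forall n, \sum_(k < n) s k ^+ (2 ^ q) <= S).

Definition root_vector (B : X -> X) : set X := [set y | exists (mu : R[i]) n,
  mu != 0 /\ iter n (fun x => B x - mu *: x) y = 0].

Theorem keldysh : exists (a : R) (G : X -> X), [/\ blin G,
  forall x, G (x + K x + a%:C%C *: Q x) = x,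
  forall y, G y + K (G y) + a%:C%C *: Q (G y) = y &
  forall h, orth (root_vector (Q \o G)) h -> h = 0].
Proof.
set m := (2 ^ q)%N.
have [lK _] := cK; have [lQ _] := cQ.
(* The largest slope that [phragmen_lindelof] admits for growth of order [m]. *)
pose kappa : R := (3 * m.+1%:R)^-1.
have m1 : (0 : R) < m.+1%:R by rewrite ltr0n.
have k0 : 0 < kappa by rewrite invr_gt0 mulr_gt0.
have km : 3 * m.+1%:R * kappa <= 1 by rewrite /kappa divff // gt_eqF // mulr_gt0.
have [r [C [r0 C0 bnd]]] := outside_sector_bound k0.
have [a a0 aP] := shifted_sector k0 r0.
have ns0 : ~ sector kappa 0 by case=> /=; rewrite ltxx.
have [G bG [GK1 GK2]] : exists2 G : X -> X, blin G &
    (forall x, G (x + K x - (0 - a%:C%C) *: Q x) = x) /\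
    (forall y, G y + K (G y) - (0 - a%:C%C) *: Q (G y) = y).
  by have [h1 h2] := aP 0 ns0; exact: (pencil_inverse bnd).
have pen (u : X) : u + K u - (0 - a%:C%C) *: Q u = u + K u + a%:C%C *: Q u by vec.
exists a, G; split=> // [x|y|h ho]; [by rewrite -pen|by rewrite -pen|].
pose B := Q \o G; have cB : cptop B by exact: cptop_compr.
have bB := cptop_blin cB; have [lB _] := bB.
have [Gs bGs Gadj] := blin_adjoint bG; have [lGs [g g0 Gsg]] := bGs.
pose Bs := Gs \o Q; have cBs : cptop Bs by exact: cptop_compl.
have [lBs _] := cBs.
have adj x y : ip (B x) y = ip x (Bs y) by rewrite /B /Bs /= sQ Gadj.
have adj2 x y : ip x (B y) = ip (Bs x) y by rewrite ipC adj -ipC.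
have injBs x : Bs x = 0 -> x = 0.
  move=> Bx; apply: iQ; apply: nr_eq0; apply/eqP; rewrite -sqrf_eq0 nr_sqE.
  by rewrite -{1}(GK1 (Q x)) Gadj -[Gs (Q x)]/(Bs x) Bx ip0r.
set Y := orth (root_vector B) in ho.
have sY : subspace Y := orth_subspace _.
have cY : closed_set Y := @orth_closed _ _ _.
have [P [lP PY Po Pid Ple]] := closed_projector sY cY.
have bP : blin P by split=> //; exists 1 => // x; rewrite mul1r.
have BsY y : Y y -> Y (Bs y).
  move=> Yy b [mu [n [mu0 bE]]]; rewrite -adj2; apply: Yy.
  exists mu, n; split=> //; rewrite -chain_const chain_comm // chain_const bE.
  exact: lin0.
(* The adjoint of [B], compressed to the orthogonal complement [Y] of its root
   vectors. *)
pose V := Bs \o P; have cV : cptop V by exact: cptop_compr.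
have [lV _] := cV; have bV := cptop_blin cV.
have VY x : Y (V x) by apply: BsY.
have injV (z : R[i]) x : x = z *: V x -> x = 0.
  have [->|z0] := eqVneq z 0; first by rewrite scale0r.
  move=> xE; have Yx : Y x by rewrite xE; exact: (subspaceZ _ sY (VY x)).
  have Bx : Bs x = z^-1 *: x.
    by rewrite {2}xE scalerA mulVf // scale1r /V /= Pid.
  apply: (@root_vectors_orthogonal _ _ B Bs (z^-1)^*) => //.
  - by rewrite conjC_eq0 invr_eq0.
  - by rewrite conjCK.
  move=> n y yE; apply: Yx; exists (z^-1)^*, n; split=> //.
  by rewrite conjC_eq0 invr_eq0.
have [e [e1 eQ eN]] := schmidt_expansion cQ sQs.
have sP n : 0 <= s n.+1 <= s n by have [? [? []]] := sQs.
pose tail n x := x - \sum_(i < n) ip x (e i) *: e i.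
have ltail n : linear (tail n).
  move=> b x y; rewrite /tail scalerBr scaler_sumr addrACA -opprD; congr (_ - _).
  rewrite -big_split; apply: eq_bigr => i _ /=.
  by rewrite ipDl ipZl scalerDl scalerA.
have Psa x y : ip (P x) y = ip x (P y).
  have h1 : ip (x - P x) (P y) = 0 by exact: Po.
  have h2 : ip (P x) (y - P y) = 0 by rewrite ipC Po ?conjC0.
  move: h1 h2; rewrite ipBl ipBr => /eqP + /eqP; rewrite !subr_eq0.
  by move=> /eqP -> /eqP ->.
have sge0 n : 0 <= s n by have /andP[h1 h2] := sP n; exact: le_trans h2.
have [c c0 growth] : exists2 c : R, 0 <= c & forall (z : R[i]) x,
    nr x <= expR (c * (1 + cabs z) ^+ m) * nr (x - z *: V x).
  (* Inside [V], which is [Gs \o Q \o P], the Schmidt terms of [Q] are removed one at a time; the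
     differences have rank one, and [Psa] moves [P] onto [e n]. *)
  apply: (@volterra_growth _ _ V (fun n x => Gs (Q (tail n (P x))))
     (fun n => P (e n)) (fun n => Gs (Q (e n))) s g S q) => //.
  - by move=> x; rewrite /tail big_ord0 subr0.
  - by move=> n b x y; rewrite lP ltail lQ lGs.
  - move=> n x; apply: le_trans (Gsg _) _; rewrite -mulrA ler_wpM2l //.
    by apply: le_trans (eQ n (P x)) _; rewrite ler_wpM2l.
  - move=> n x; rewrite -(linB lGs) -(linB lQ) -Psa.
    rewrite -(linZ lGs) -(linZ lQ); congr (Gs (Q _)).
    by rewrite /tail big_ord_recr /=; vec.
  move=> n; rewrite mulrC; apply: le_trans (_ : (g * s n) * 1 <= _); last by rewrite mulr1.
  apply: ler_pM; rewrite ?nr_ge0 //; last exact: le_trans (Ple _) (e1 n).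
  by apply: le_trans (Gsg _) _; rewrite ler_wpM2l.
have sol (z : R[i]) : exists2 Gz : X -> X, blin Gz &
    (forall x, Gz (x - z *: V x) = x) /\ (forall y, Gz y - z *: V (Gz y) = y).
  by have [|Gz bGz GzK] := fredholm (cptop_scale z cV); [exact: injV|exists Gz].
have /boolp.choice[f fE] (z : R[i]) : exists x, x - z *: V x = h.
  by have [Gz _ [_ GzK]] := sol z; exists (Gz h).
have dq (A : X -> X) (z0 : R[i]) k : blin A -> hdquot k (fun z : R[i] => A (f z)) z0.
  move=> bA; apply: (@resolvent_dquot _ _ V f h) => // z.
  by have [Gz bGz [GzK _]] := sol z; exists Gz.
have fY (z : R[i]) : Y (f z).
  rewrite -[f z](subrK (z *: V (f z))) fE.
  by apply: (subspaceD sY) => //; exact: (subspaceZ _ sY (VY _)).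
have [b b0 bb] : exists2 b : R, 0 <= b & forall u, nr (u + K u + a%:C%C *: Q u) <= b * nr u.
  have : blin (fun u => u + K u + a%:C%C *: Q u).
    apply: blin_add; last by apply: blin_scale; exact: cptop_blin.
    by apply: blin_add; [exact: blin_id|exact: cptop_blin].
  by case.
have fout (z : R[i]) : ~ sector kappa z -> nr (f z) <= b * C * nr h.
  move=> ns; have ns' : ~ sector kappa z^* by move=> /sector_conj.
  have [h1 h2] := aP _ ns'.
  have [Gz _ [_ GzK]] := pencil_inverse bnd h1 h2.
  (* [G x0] is [w], and [x0 - z^* *: B x0] is the pencil at [z^* - a] applied to [w], that is [f z];
     the pencil bound controls [x0] by [f z]. Taking adjoints, as [V] is [Bs] on [Y], the square of
     [nr (f z)] becomes [ip h x0]. *)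
  pose w := Gz (f z); pose x0 := w + K w + a%:C%C *: Q w.
  have Gx0 : G x0 = w by rewrite /x0 -pen GK1.
  have x0E : x0 - z^* *: B x0 = f z.
    by rewrite /B /= Gx0 -[RHS]GzK -/w /x0; vec.
  have nw : nr w <= C * nr (f z).
    by have := bnd _ w h1 h2; rewrite GzK.
  have nx0 : nr x0 <= b * C * nr (f z).
    by apply: le_trans (bb w) _; rewrite -mulrA ler_wpM2l.
  have key : ip (f z) (f z) = ip h x0.
    rewrite -{2}x0E ipBr ipZr conjCK adj2 -ipZl -ipBl; congr (ip _ x0).
    by rewrite -(fE z) /V /= (Pid (f z)).
  have [f0|f0] := eqVneq (f z) 0.
    by rewrite f0 nr0 !mulr_ge0 ?nr_ge0 // ltW.
  rewrite -(ler_pM2l (nr_gt0 f0)) -expr2 nr_sqE key.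
  apply: le_trans (le_trans (ler_norm _) (Re_cabs _)) _; apply: le_trans (ip_le _ _) _.
  rewrite mulrC [leRHS]mulrA ler_wpM2r ?nr_ge0 // mulrC //.
pose M := (b * C + 1) * nr h.
have bC0 : 0 <= b * C by rewrite mulr_ge0 // ltW.
have M0 : 0 <= M by rewrite mulr_ge0 ?nr_ge0 // addr_ge0.
have fM (z : R[i]) : nr (f z) <= M.
  apply: (@phragmen_lindelof _ _ f M c kappa m) => //.
  - by move=> z0; apply: (dq id); exact: blin_id.
  - by move=> z0 /fout /le_trans; apply; rewrite ler_wpM2r ?nr_ge0 // lerDl.
  move=> z0; apply: le_trans (growth z0 (f z0)) _; rewrite fE mulrC.
  by rewrite ler_wpM2r ?expR_ge0 // ler_peMl ?nr_ge0 // lerDr.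
have f0 : f 0 = h by rewrite -(fE 0) scale0r subr0.
have Vh : V (f 0) = 0.
  apply: (@vanishing_at_infinity _ _ (fun z : R[i] => V (f z)) (M + nr h)).
  - by rewrite addr_ge0 ?nr_ge0.
  - by move=> z0; exact: dq.
  move=> z0; rewrite -nrZ (_ : z0 *: V (f z0) = f z0 - h); last first.
    by rewrite -(fE z0); vec.
  by apply: le_trans (nrB _ _) _; rewrite lerD2r.
by apply: injBs; rewrite -Vh f0 /V /= Pid.
Qed.

End keldysh.

Lemma schatten_power_sums (R : realType) (s : nat -> R) (p S : R) (q : nat) :
  0 < p -> p <= (2 ^ q)%:R -> (forall k, 0 <= s k.+1 <= s k) ->
  (forall n, \sum_(k < n) s k `^ p <= S) ->
  (forall e : R, 0 < e -> exists n, s n < e) /\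
  exists S', forall n, \sum_(k < n) s k ^+ (2 ^ q) <= S'.
Proof.
move=> p0 pq sP sS; have sge0 k : 0 <= s k by have /andP[h1 h2] := sP k; exact: le_trans h2.
have smono k : s k <= s 0%N.
  by elim: k => [//|k ih]; apply: le_trans ih; have /andP[] := sP k.
split.
  move=> e e0; apply: contrapT => h.
  have he n : e <= s n by rewrite leNgt; apply/negP => lt; apply: h; exists n.
  have ep : 0 < e `^ p by rewrite powR_gt0.
  have hn n : n%:R * e `^ p <= S.
    apply: le_trans (sS n); rewrite mulr_natl -[X in _ *+ X]card_ord -sumr_const.
    by apply: ler_sum => k _; rewrite ge0_ler_powR ?nnegrE // ltW.
  have S0 : 0 <= S by have := sS 0%N; rewrite big_ord0.
  have := hn (Num.truncn (S / e `^ p)).+1; rewrite -ler_pdivlMr //.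
  by rewrite leNgt truncnS_gt.
exists (s 0%N `^ ((2 ^ q)%:R - p) * S) => n.
apply: le_trans (ler_wpM2l (powR_ge0 _ _) (sS n)); rewrite mulr_sumr.
apply: ler_sum => k _; have [->|sk] := eqVneq (s k) 0.
  by rewrite expr0n expn_eq0 /= mulr_ge0 ?powR_ge0.
rewrite -powR_mulrn // -[X in s k `^ X](subrK p) powRD; last by rewrite sk implybT.
rewrite ler_wpM2r ?powR_ge0 // ge0_ler_powR ?nnegrE // subr_ge0 //.
Qed.

(** * Measurability of open sets *)

Section lebesgue_open.
Context {R : realType} {n : nat}.
Notation E := 'rV[R]_n.+1.
Local Open Scope ereal_scope.

Definition cut (a : E) (i : 'I_n.+1) (c : R) : E :=
  \row_k if k == i then c else a 0%R k.

Lemma cutE a i c k : cut a i c 0%R k = if k == i then c else a 0%R k.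
Proof. by rewrite mxE. Qed.

Lemma box_volume_cut (a b : E) i (c : R) :
  (box_volume a (cut b i (Num.min (b 0 i) c)) +
   box_volume (cut a i (Num.max (a 0 i) c)) b <= box_volume a b)%R.
Proof.
have bv u v : box_volume u v = (Num.max 0 (v 0%R i - u 0%R i) *
    \prod_(k < n.+1 | k != i) Num.max 0 (v 0%R k - u 0%R k))%R :> R.
  exact: bigD1.
rewrite !bv !cutE eqxx.
rewrite [X in (_ * X + _)%R](eq_bigr (fun k => Num.max 0 (b 0 k - a 0 k))%R); last first.
  by move=> k /negbTE ki; rewrite cutE ki.
rewrite [X in (_ + _ * X)%R](eq_bigr (fun k => Num.max 0 (b 0 k - a 0 k))%R); last first.
  by move=> k /negbTE ki; rewrite cutE ki.
rewrite -mulrDl ler_wpM2r //.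
  by apply: prodr_ge0 => k _; rewrite le_max lexx.
move: (a 0%R i) (b 0%R i) => x y.
rewrite /Num.max /Num.min; do 8?[case: ltP => ?]; lra.
Qed.

Lemma box_gauge_cut (F : set E) i (c : R) :
  box_gauge (F `&` [set x | (x 0 i <= c)%R]) +
  box_gauge (F `&` ~` [set x | (x 0 i <= c)%R]) <= box_gauge F.
Proof.
apply: le_ereal_inf_tmp => _ [a [b [Fab ->]]].
apply: le_trans (_ : (box_volume a (cut b i (Num.min (b 0 i) c)))%:E +
  (box_volume (cut a i (Num.max (a 0 i) c)) b)%:E <= _)%E; last first.
  by rewrite -EFinD lee_fin box_volume_cut.
apply: leeD; apply: ereal_inf_lbound; do 2 eexists; (split; last reflexivity).
  move=> x [Fx xc] k; have /(_ k)/andP[h1 h2] := Fab x Fx; rewrite h1 cutE.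
  by case: eqP h2 => [-> h2|//]; rewrite le_min h2.
move=> x [Fx /negP]; rewrite -ltNge => xc k; have /(_ k)/andP[h1 h2] := Fab x Fx.
rewrite h2 cutE andbT; case: eqP h1 => [-> h1|//].
by rewrite ge_max h1 ltW.
Qed.

(* Cutting a box by a coordinate hyperplane preserves the total volume. *)
Lemma halfspace_measurable i (c : R) :
  measurable ([set x | (x 0%R i <= c)%R] :
    set (caratheodory_type (@lebesgue_outer_measure R n))).
Proof.
apply: le_caratheodory_measurable => X; set S := [set x | _].
apply: le_ereal_inf_tmp => _ [F XF <-].
apply: le_trans (_ : \sum_(k <oo) box_gauge (F k `&` S) +
  \sum_(k <oo) box_gauge (F k `&` ~` S) <= _).
  apply: leeD; apply: ereal_inf_lbound; eexists; try reflexivity;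
    by move=> x [/XF[k _ Fk] Sx]; exists k.
rewrite -nneseriesD; try by move=> *; exact: box_gauge_ge0.
apply: lee_nneseries => [k _ _|k _]; last exact: box_gauge_cut.
by rewrite adde_ge0 ?box_gauge_ge0.
Qed.

Lemma open_vol_measurable (D : set E) : open D ->
  measurable (D : set (caratheodory_type (@lebesgue_outer_measure R n))).
Proof.
move=> oD.
(* Boxes with rational centre and half-width [p.2.+1%:R^-1], open on the lower side only, as they
   are cut out by half-spaces [x i <= c] and their complements. *)
pose lo (p : 'rV[rat]_n.+1 * nat) i : R := (ratr (p.1 0 i) - p.2.+1%:R^-1)%R.
pose hi (p : 'rV[rat]_n.+1 * nat) i : R := (ratr (p.1 0 i) + p.2.+1%:R^-1)%R.
pose B (p : 'rV[rat]_n.+1 * nat) : set E := \bigcap_(i in [set: 'I_n.+1])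
  ([set x | (x 0%R i <= hi p i)%R] `&` ~` [set x | (x 0%R i <= lo p i)%R]).
have mB p : measurable (B p : set (caratheodory_type (@lebesgue_outer_measure R n))).
  apply: fin_bigcap_measurable => [|i _]; first exact: finite_finset.
  by apply: measurableI; [|apply: measurableC]; exact: halfspace_measurable.
have -> : D = \bigcup_(p in [set: 'rV[rat]_n.+1 * nat]) (if `[< B p `<=` D >] then B p else set0).
  apply/seteqP; split=> [x Dx|x [p _]]; last by case: ifPn => // /asboolP; apply.
  have /nbhs_ballP[e /= e0 eD] : nbhs x D by exact: open_nbhs_nbhs.
  have e2 : (0 < e / 2)%R by rewrite divr_gt0.
  have [N NP] := @inv_natS_lt R _ e2; have {}NP := NP N (leqnn N).
  have N0 : (0 < N.+1%:R^-1 :> R)%R by rewrite invr_gt0 ltr0n.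
  have /boolp.choice[q qP] (i : 'I_n.+1) : exists q : rat,
      (x 0 i < ratr q < x 0 i + N.+1%:R^-1)%R.
    by have [|q] := @rat_in_itvoo R (x 0%R i) (x 0%R i + N.+1%:R^-1)%R;
      [rewrite ltrDl|rewrite in_itv; exists q].
  pose p : 'rV[rat]_n.+1 * nat := (\row_i q i, N).
  have loE i : lo p i = (ratr (q i) - N.+1%:R^-1)%R by rewrite /lo mxE.
  have hiE i : hi p i = (ratr (q i) + N.+1%:R^-1)%R by rewrite /hi mxE.
  exists p => //; rewrite ifT.
    move=> i _; have /andP[h1 h2] := qP i; split=> /=; rewrite ?hiE ?loE.
      by rewrite ler_wpDr // ltW.
    by apply/negP; rewrite -ltNge ltrBlDr.
  apply/asboolP => y By; apply: eD; split=> // k i; rewrite (ord1 k) /ball /=.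
  have [/= h1 /negP] := By i I; rewrite -ltNge => h2.
  have /andP[h3 h4] := qP i; rewrite hiE in h1; rewrite loE in h2.
  move: (N.+1%:R^-1)%R N0 NP h1 h2 h4 => t N0 NP h1 h2 h4.
  by rewrite ltr_norml; apply/andP; split; lra.
apply: countable_bigcupT_measurable; first exact: countableP.
by move=> p; case: ifP => _; [exact: mB|exact: measurable0].
Qed.

End lebesgue_open.

(** * The space L^2 *)

Section L2_space.
Context d (T : measurableType d) (R : realType).
Variables (mu : {measure set T -> \bar R}) (D : set T).
Hypothesis mD : measurable D.
Notation V := (T -> R[i]^o).
Implicit Types (f g h : V) (z w : R[i]).

Lemma abs2E z : abs2 z = cabs z ^+ 2. Proof. by rewrite sqr_cabs. Qed.

Lemma abs2_ge0 z : 0 <= abs2 z. Proof. by rewrite abs2E sqr_ge0. Qed.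

Lemma abs2B z w : abs2 (z - w) =
  (complex.Re z - complex.Re w) ^+ 2 + (complex.Im z - complex.Im w) ^+ 2.
Proof. by case: z w => [? ?] [? ?]. Qed.

Lemma abs2D z w : abs2 (z + w) <= 2 * abs2 z + 2 * abs2 w.
Proof.
rewrite !abs2E; have h := cabsD z w.
have h2 : cabs (z + w) ^+ 2 <= (cabs z + cabs w) ^+ 2.
  by rewrite ler_pXn2r ?nnegrE ?addr_ge0 ?cabs_ge0.
apply: le_trans h2 _; have := sqr_ge0 (cabs z - cabs w).
rewrite sqrrB sqrrD !mulr_natl; lra.
Qed.

Lemma cmeasurable_lin z f g : cmeasurable D f -> cmeasurable D g ->
  cmeasurable D (z *: f + g).
Proof.
move=> [f1 f2] [g1 g2]; split.
  rewrite (_ : (fun x => _) = (fun x => complex.Re z * complex.Re (f x) -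
    complex.Im z * complex.Im (f x) + complex.Re (g x))); last first.
    by apply/funext => x; rewrite ReD ReM.
  by apply: measurable_funD => //; apply: measurable_funB; apply: measurable_funM.
rewrite (_ : (fun x => _) = (fun x => complex.Re z * complex.Im (f x) +
  complex.Im z * complex.Re (f x) + complex.Im (g x))); last first.
  by apply/funext => x; rewrite ImD ImM.
by apply: measurable_funD => //; apply: measurable_funD; apply: measurable_funM.
Qed.

Lemma cmeasurable_mulJ f g : cmeasurable D f -> cmeasurable D g ->
  cmeasurable D (fun x => f x * (g x)^*).
Proof.
move=> [f1 f2] [g1 g2]; split.
  rewrite (_ : (fun x => _) = (fun x => complex.Re (f x) * complex.Re (g x) +
    complex.Im (f x) * complex.Im (g x))); last first.
    by apply/funext => x; rewrite ReM ReJ ImJ mulrN opprK.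
  by apply: measurable_funD; apply: measurable_funM.
rewrite (_ : (fun x => _) = (fun x => complex.Im (f x) * complex.Re (g x) -
  complex.Re (f x) * complex.Im (g x))); last first.
  by apply/funext => x; rewrite ImM ReJ ImJ mulrN addrC.
by apply: measurable_funB; apply: measurable_funM.
Qed.

Lemma measurable_abs2 f : cmeasurable D f ->
  measurable_fun D (EFin \o (fun x => abs2 (f x))).
Proof.
move=> [f1 f2]; apply/measurable_EFinP; rewrite /abs2.
by apply: measurable_funD; exact: measurable_funX.
Qed.

Lemma sqnorm2_ge0 f : (0 <= sqnorm2 mu D f)%E.
Proof. by apply: integral_ge0 => x _; rewrite lee_fin abs2_ge0. Qed.

Lemma le_sqnorm2D f g : cmeasurable D f -> cmeasurable D g ->
  (sqnorm2 mu D (f + g)%R <= 2%:E * sqnorm2 mu D f + 2%:E * sqnorm2 mu D g)%E.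
Proof.
move=> mf mg; rewrite /sqnorm2 -!ge0_integralZl //; do ?exact: measurable_abs2;
  do ?by move=> *; rewrite lee_fin abs2_ge0.
rewrite -ge0_integralD //; do ?by apply: measurable_funeM; exact: measurable_abs2.
- apply: ge0_le_integral => //.
  + by move=> x _; rewrite lee_fin abs2_ge0.
  + by have := cmeasurable_lin 1 mf mg; rewrite scale1r => /measurable_abs2.
  + by apply: emeasurable_funD; apply: measurable_funeM; exact: measurable_abs2.
  + by move=> x _; rewrite -!EFinM -EFinD lee_fin abs2D.
- by move=> x _; rewrite -EFinM lee_fin mulr_ge0 ?abs2_ge0.
- by move=> x _; rewrite -EFinM lee_fin mulr_ge0 ?abs2_ge0.
Qed.

Lemma L2_lin z f g : L2 mu D f -> L2 mu D g -> L2 mu D (z *: f + g).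
Proof.
move=> [mf if2] [mg ig2]; split; first exact: cmeasurable_lin.
have mzf : cmeasurable D (z *: f).
  by rewrite -[z *: f]addr0; apply: cmeasurable_lin.
apply: le_lt_trans (le_sqnorm2D mzf mg) _; apply: lte_add_pinfty; last first.
  by rewrite lte_mul_pinfty ?sqnorm2_ge0.
rewrite lte_mul_pinfty ?sqnorm2_ge0 //.
rewrite /sqnorm2 (eq_integral (fun x => (abs2 z)%:E * (abs2 (f x))%:E)%E); last first.
  by move=> x _; rewrite -EFinM !abs2E cabsM exprMn.
rewrite ge0_integralZl ?lee_fin ?abs2_ge0 //.
- by rewrite lte_mul_pinfty ?lee_fin ?abs2_ge0 //; exact: sqnorm2_ge0.
- exact: measurable_abs2.
- by move=> x _; rewrite lee_fin abs2_ge0.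
Qed.

Lemma L2_0 : L2 mu D (0 : V).
Proof.
split; first by split; exact: measurable_cst.
rewrite /sqnorm2 integral0_eq // => x _.
by rewrite abs2E cabs0 expr0n.
Qed.

Lemma L2_abs2_integrable f : L2 mu D f -> mu.-integrable D (EFin \o (fun x => abs2 (f x))).
Proof.
move=> [mf if2]; apply/integrableP; split; first exact: measurable_abs2.
rewrite (eq_integral (fun x => (abs2 (f x))%:E)) // => x _.
by rewrite gee0_abs // lee_fin abs2_ge0.
Qed.

Lemma L2_mul_integrable f g : L2 mu D f -> L2 mu D g ->
  cintegrable mu D (fun x => f x * (g x)^*).
Proof.
move=> Lf Lg; have [m1 m2] := cmeasurable_mulJ Lf.1 Lg.1.
have dom (k : R[i] -> R) : (forall z, `|k z| <= cabs z) ->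
    measurable_fun D (fun x => k (f x * (g x)^*)) ->
    mu.-integrable D (fun x => (k (f x * (g x)^*))%:E).
  move=> kP mk.
  apply: (@le_integrable _ _ _ _ _ mD _ (fun x => (abs2 (f x))%:E + (abs2 (g x))%:E)%E).
  - exact/measurable_EFinP.
  - move=> x _; rewrite -EFinD !abse_EFin lee_fin.
    apply: le_trans (kP _) _; apply: le_trans (ler_norm _).
    rewrite cabsM cabsJ !abs2E.
    have := sqr_ge0 (cabs (f x) - cabs (g x)).
    have := mulr_ge0 (cabs_ge0 (f x)) (cabs_ge0 (g x)).
    by rewrite sqrrB mulr2n; lra.
  - by apply: integrableD => //; exact: L2_abs2_integrable.
by split; apply: dom => //; [exact: Re_cabs|exact: Im_cabs].
Qed.

Lemma L2dot_lin z f g h : L2 mu D f -> L2 mu D g -> L2 mu D h ->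
  L2dot mu D (z *: f + g) h = z * L2dot mu D f h + L2dot mu D g h.
Proof.
move=> Lf Lg Lh.
have [f1 f2] := L2_mul_integrable Lf Lh; have [g1 g2] := L2_mul_integrable Lg Lh.
have Zi (k : R[i] -> R) (c : R) : mu.-integrable D (fun x => (k (f x * (h x)^*))%:E) ->
    mu.-integrable D (fun x => (c * k (f x * (h x)^*))%:E).
  by move=> ik; under eq_fun do rewrite EFinM; exact: integrableZl.
apply/eqP; rewrite eq_complex; apply/andP; split; apply/eqP.
  rewrite ReD ReM /L2dot /cint /=.
  under eq_Rintegral.
    move=> x _; rewrite mulrDl -mulrA ReD ReM; over.
  rewrite RintegralD //; last first.
    by rewrite /comp; under eq_fun do rewrite EFinB; apply: integrableB => //; exact: Zi.
  by rewrite RintegralB ?RintegralZl //; exact: Zi.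
rewrite ImD ImM /L2dot /cint /=.
under eq_Rintegral.
  move=> x _; rewrite mulrDl -mulrA ImD ImM; over.
rewrite RintegralD //; last first.
  by rewrite /comp; under eq_fun do rewrite EFinD; apply: integrableD => //; exact: Zi.
by rewrite RintegralD ?RintegralZl //; exact: Zi.
Qed.

Lemma L2dotC f g : L2 mu D f -> L2 mu D g -> L2dot mu D g f = (L2dot mu D f g)^*.
Proof.
move=> Lf Lg; have [i1 i2] := L2_mul_integrable Lf Lg.
apply/eqP; rewrite eq_complex ReJ ImJ; apply/andP; split; apply/eqP.
  rewrite /L2dot /cint /=; apply: eq_Rintegral => x _.
  by rewrite !ReM !ReJ !ImJ !mulrN !opprK mulrC; congr (_ + _); rewrite mulrC.
rewrite /L2dot /cint /= -mulN1r -RintegralZl //; apply: eq_Rintegral => x _.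
by rewrite mulN1r !ImM !ReJ !ImJ !mulrN opprD opprK addrC mulrC; congr (_ + _); rewrite mulrC.
Qed.

Lemma L2dot_norm f : L2 mu D f -> L2dot mu D f f = (fine (sqnorm2 mu D f))%:C%C.
Proof.
move=> Lf; rewrite /L2dot /cint; congr Complex.
  rewrite /sqnorm2; congr fine; apply: eq_integral => x _; congr (_%:E).
  by rewrite mulrJ_cabs /= abs2E.
rewrite (@eq_Rintegral _ _ _ _ _ (cst 0)) ?Rintegral_cst ?mul0r // => x _.
by rewrite mulrJ_cabs.
Qed.

Lemma L2dot_ge0 f : L2 mu D f -> 0 <= L2dot mu D f f.
Proof. by move=> Lf; rewrite L2dot_norm // ler0c fine_ge0 // sqnorm2_ge0. Qed.

Definition L2norm := seminorm (L2dot mu D : V -> V -> R[i]).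

Lemma sqnorm2E f : L2 mu D f -> sqnorm2 mu D f = (L2norm f ^+ 2)%:E.
Proof.
move=> Lf; rewrite /L2norm /seminorm L2dot_norm //= sqr_sqrtr; last first.
  by rewrite fine_ge0 // sqnorm2_ge0.
by rewrite fineK // ge0_fin_numE ?sqnorm2_ge0 //; case: Lf.
Qed.

Lemma cvg_fast (a : nat -> R) (M : R) :
  (forall k, `|a k.+1 - a k| <= M / 2 ^+ k.+1) -> cvgn a.
Proof.
move=> aM; have M0 : 0 <= M.
  by have := le_trans (normr_ge0 _) (aM 0%N); rewrite pmulr_lge0 // invr_gt0 exprn_gt0.
have ct : cvgn (series (telescope a)).
  apply: normed_cvg; apply: (@series_le_cvg _ _ (geometric (M / 2) 2^-1)).
  - by move=> n /=.
  - by move=> n /=; rewrite mulr_ge0 ?exprn_ge0 ?divr_ge0.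
  - move=> n /=; apply: le_trans (aM n) _.
    by rewrite exprS invfM exprVn mulrA.
  by apply: is_cvg_geometric_series; rewrite ger0_norm ?invr_ge0 // invf_lt1 // ltr1n.
rewrite (_ : a = cst (a 0%N) + series (telescope a)).
  by apply: is_cvgD => //; exact: is_cvg_cst.
by apply/funext => n; rewrite [LHS]eq_sum_telescope.
Qed.

Lemma half_power_sum n : \sum_(0 <= k < n) 2^-1 ^+ k.+1 <= 1 :> R.
Proof.
suff -> : \sum_(0 <= k < n) 2^-1 ^+ k.+1 = 1 - 2^-1 ^+ n :> R.
  by rewrite lerBlDr lerDl exprn_ge0 // invr_ge0.
elim: n => [|n ih]; first by rewrite big_nil expr0 subrr.
rewrite big_nat_recr //= ih !exprS; move: (_ ^+ n) => t; lra.
Qed.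

(** Weighted by [8 ^+ k.+1], the squared increments have integrals at most [2^-1 ^+ k.+1]. Their sum
    [h] is thus finite almost everywhere, and there the increments are at most
    [sqrt h / 2 ^+ k.+1]. *)
Lemma L2_ae_cvg (v : nat -> V) : (forall k, L2 mu D (v k)) ->
  (forall k, L2norm (v k.+1 - v k) <= 4^-1 ^+ k.+1) ->
  exists2 f : V, cmeasurable D f & {ae mu, forall x, D x ->
    (complex.Re (v k x) @[k --> \oo] --> complex.Re (f x)) /\
    (complex.Im (v k x) @[k --> \oo] --> complex.Im (f x))}.
Proof.
move=> Lv vfast; pose dv k := v k.+1 - v k.
have Ldv k : L2 mu D (dv k).
  by rewrite /dv addrC -scaleN1r; exact: L2_lin.
pose b k (x : T) : \bar R := ((8 ^+ k.+1)%:E * (abs2 (dv k x))%:E)%E.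
have b0 k x : (0 <= b k x)%E by rewrite mule_ge0 // lee_fin ?exprn_ge0 ?abs2_ge0.
have mb k : measurable_fun D (b k).
  by apply: measurable_funeM; apply: measurable_abs2; case: (Ldv k).
pose h (x : T) : \bar R := (\sum_(k <oo) b k x)%E.
have h0 x : (0 <= h x)%E by apply: nneseries_ge0.
have ih : mu.-integrable D h.
  apply/integrableP; split.
    have := @ge0_emeasurable_sum _ _ _ D b xpredT (fun k x _ _ => b0 k x) (fun k _ => mb k).
    by apply: eq_measurable_fun => x _; apply: eq_eseriesl.
  under eq_integral do rewrite gee0_abs //.
  rewrite integral_nneseries //.
  apply: (@le_lt_trans _ _ (1%:E)); last exact: ltry.
  apply: lime_le; first by apply: is_cvg_nneseries => *; exact: integral_ge0.
  apply: nearW => n; apply: (@le_trans _ _ ((\sum_(0 <= k < n) 2^-1 ^+ k.+1)%:E)).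
    rewrite -sumEFin; apply: lee_sum => k _.
    rewrite ge0_integralZl ?lee_fin ?exprn_ge0 //; last 2 first.
    - by apply: measurable_abs2; case: (Ldv k).
    - by move=> x _; rewrite lee_fin abs2_ge0.
    rewrite -/(sqnorm2 mu D (dv k)) sqnorm2E // -EFinM lee_fin.
    apply: (@le_trans _ _ (8 ^+ k.+1 * (4^-1 ^+ k.+1) ^+ 2)).
      rewrite ler_pM2l ?exprn_gt0 // ler_pXn2r ?nnegrE ?seminorm_ge0 ?exprn_ge0 //.
      exact: vfast.
    rewrite -exprM mulnC exprM -exprMn.
    by rewrite (_ : 8 * 4^-1 ^+ 2 = 2^-1 :> R) //; field.
  by rewrite lee_fin half_power_sum.
(* Upper limits make [f] defined and measurable without reference to convergence, and agree with the
   limits where these exist. *)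
pose f (x : T) : R[i] := Complex (fine (limn_esup (fun k => (complex.Re (v k x))%:E)))
  (fine (limn_esup (fun k => (complex.Im (v k x))%:E))).
exists f.
  split; rewrite /f /=; (apply: measurableT_comp => //; apply: measurable_fun_limn_esup => k;
    apply/measurable_EFinP); by case: (Lv k) => -[].
have key (p : R[i] -> R) : (forall z w, p (z - w) = p z - p w) ->
    (forall z, `|p z| <= cabs z) -> forall x, h x \is a fin_num ->
    p (v k x) @[k --> \oo] --> fine (limn_esup (fun k => (p (v k x))%:E)).
  move=> pB pc x hx.
  have cv : cvgn (fun k => p (v k x)).
    apply: (@cvg_fast _ (Num.sqrt (fine (h x)))) => k.
    rewrite -pB; apply: le_trans (pc _) _.
    rewrite -(ler_pXn2r (n := 2)) ?nnegrE ?cabs_ge0 ?divr_ge0 ?sqrtr_ge0 ?exprn_ge0 //.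
    rewrite exprMn sqr_sqrtr ?fine_ge0 // -abs2E exprVn -exprM mulnC exprM.
    rewrite ler_pdivlMr ?exprn_gt0 // mulrC.
    apply: (@le_trans _ _ (8 ^+ k.+1 * abs2 (dv k x))).
      by apply: ler_wpM2r; rewrite ?abs2_ge0 // ler_pXn2r ?nnegrE ?exprn_ge0 //; lra.
    rewrite -lee_fin fineK // EFinM -/(b k x).
    apply: le_trans (nneseries_lim_ge k.+1 (fun i _ _ => b0 i x)).
    rewrite big_nat_recr //= lee_paddl //; exact: sume_ge0.
  case/cvg_ex: (cv) => l vl.
  suff -> : limn_esup (fun k => (p (v k x))%:E) = l%:E by [].
  by have /cvg_limn_einf_sup[] : (p (v k x))%:E @[k --> \oo] --> l%:E
    by apply/fine_cvgP; split => //; exact: nearW.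
apply: filterS (integrable_ae mD ih) => x hx Dx; split; apply: key => //.
- by move=> z w; rewrite ReD ReN.
- exact: Re_cabs.
- exact: hx.
- by move=> [? ?] [? ?].
- exact: Im_cabs.
- exact: hx.
Qed.

Lemma L2_complete (u : nat -> V) : (forall n, L2 mu D (u n)) ->
  (forall e : R, 0 < e -> exists N, forall m n, (N <= m)%N -> (N <= n)%N ->
     L2norm (u m - u n) < e) ->
  exists2 f, L2 mu D f & forall e : R, 0 < e -> exists N, forall n, (N <= n)%N ->
     L2norm (u n - f) < e.
Proof.
move=> Lu cau.
have Lsub (f g : V) : L2 mu D f -> L2 mu D g -> L2 mu D (f - g).
  by move=> Lf Lg; rewrite addrC -scaleN1r; exact: L2_lin.
have /boolp.choice[N NP] (k : nat) : exists N, forall m n, (N <= m)%N -> (N <= n)%N ->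
    L2norm (u m - u n) < 4^-1 ^+ k.+1.
  by apply: cau; rewrite exprn_gt0.
(* Increasing indices with [N k <= phi k], which makes consecutive terms geometrically close, and
   with [k <= phi k], needed when passing to the limit. *)
pose phi k := (k + \sum_(j < k.+1) N j)%N.
have phiS k : (phi k <= phi k.+1)%N.
  by rewrite /phi [in leqRHS]big_ord_recr leq_add ?leq_addr.
have phiN k : (N k <= phi k)%N by rewrite /phi big_ord_recr /= addnA leq_addl.
pose v k := u (phi k).
have [|k|f mf fv] := @L2_ae_cvg v; first by move=> k; exact: Lu.
  by apply/ltW/NP => //; exact: leq_trans (phiS k).
(* Fatou's lemma along the subsequence [v]; it also shows that [f] is square integrable. *)
have bound n (e : R) : 0 <= e -> (forall k, (n <= k)%N -> L2norm (u n - u k) <= e) ->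
    (sqnorm2 mu D (u n - f)%R <= (e ^+ 2)%:E)%E.
  move=> e0 ue.
  pose F k (x : T) : \bar R := (abs2 ((u n - v k) x))%:E.
  have mF k : measurable_fun D (F k).
    by apply: measurable_abs2; case: (Lsub _ _ (Lu n) (Lu (phi k))).
  have F0 k x : D x -> (0 <= F k x)%E by move=> _; rewrite lee_fin abs2_ge0.
  have munf : cmeasurable D (u n - f).
    rewrite addrC -scaleN1r; apply: cmeasurable_lin => //; by case: (Lu n).
  apply: (@le_trans _ _ (\int[mu]_(x in D) limn_einf (F^~ x))%E).
    apply: ae_ge0_le_integral => //.
    - by move=> x _; rewrite lee_fin abs2_ge0.
    - exact: measurable_abs2.
    - move=> x Dx; rewrite limn_einf_lim; apply: lime_ge; first exact: is_cvg_einfs.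
      by apply: nearW => k; apply: le_ereal_inf_tmp => _ [i _ <-]; exact: F0.
    - rewrite /limn_einf; apply: measurableT_comp => //.
      by apply: measurable_fun_limn_esup => k; exact: measurableT_comp.
    apply: filterS fv => x /[apply] -[cr ci].
    suff cF : F k x @[k --> \oo] --> (abs2 ((u n - f) x))%:E.
      by have [-> _] := cvg_limn_einf_sup cF.
    apply/fine_cvgP; split; first exact: nearW.
    rewrite (_ : fine \o _ = (fun k => (complex.Re (u n x) - complex.Re (v k x)) ^+ 2 +
      (complex.Im (u n x) - complex.Im (v k x)) ^+ 2)); last first.
      by apply/funext => k; exact: abs2B.
    rewrite (abs2B (u n x) (f x)).
    by apply: cvgD; apply: cvgM; apply: cvgB => //; exact: cvg_cst.
  apply: le_trans (fatou mu mD mF F0) _.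
  rewrite limn_einf_lim.
  apply: lime_le; first exact: is_cvg_einfs.
  apply: nearW => k; apply: le_trans (ereal_inf_lbound _) _.
    by exists (maxn k n); [rewrite /= leq_maxl|reflexivity].
  rewrite -/(sqnorm2 mu D (u n - v (maxn k n))%R) sqnorm2E; last first.
    exact: (Lsub _ _ (Lu n) (Lu (phi (maxn k n)))).
  rewrite lee_fin ler_pXn2r ?nnegrE ?seminorm_ge0 //; apply: ue.
  by apply: leq_trans (leq_maxr k n) _; rewrite leq_addr.
have Lf : L2 mu D f.
  have [n0 n0P] := cau 1 ltr01.
  have Lnf : L2 mu D (u n0 - f).
    split; first by rewrite addrC -scaleN1r; apply: cmeasurable_lin => //; by case: (Lu n0).
    apply: (@le_lt_trans _ _ ((1 ^+ 2)%:E)); last exact: ltry.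
    by apply: bound => // k k0; exact: ltW (n0P _ _ _ _).
  by rewrite -[f](subKr (u n0)); exact: Lsub.
exists f => // e e0.
have e2 : 0 < e / 2 by rewrite divr_gt0.
have [n0 n0P] := cau (e / 2) e2; exists n0 => n n0n.
have := bound n (e / 2) (ltW e2) (fun k nk => ltW (n0P n k n0n (leq_trans n0n nk))).
rewrite sqnorm2E; last exact: Lsub.
rewrite lee_fin ler_pXn2r ?nnegrE ?seminorm_ge0 ?(ltW e2) // => /le_lt_trans; apply.
by rewrite ltr_pdivrMr // mulr_natr mulr2n ltrDl.
Qed.

End L2_space.

(** * Closed operators with compact resolvent *)

Section completeness_criterion.
Context {R : realType}.
Implicit Types X Y : hilbert R.

Lemma blin_continuous X Y (f : X -> Y) : blin f -> continuous f.
Proof.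
move=> [lf [c c0 fc]] x0; apply/cvgrPdist_lt => e e0.
have c1 : 0 < (c + 1)%:C%C by rewrite -(rmorph0 (real_complex R)) ltcR ltr_wpDl.
have d0 : 0 < e / (c + 1)%:C%C by rewrite divr_gt0.
near=> x; rewrite -(linB lf) nr_norm.
apply: (@le_lt_trans _ _ ((c + 1)%:C%C * `|x0 - x|)).
  rewrite nr_norm -rmorphM lecR; apply: le_trans (fc _) _.
  by rewrite ler_wpM2r ?nr_ge0 // lerDl.
by rewrite mulrC -ltr_pdivlMr //; near: x; exact: cvgr_dist_lt.
Unshelve. all: by end_near. Qed.

Lemma span_subspace (V : lmodType R[i]) (A : set V) : Defs.span A 0 /\
  forall a x y, Defs.span A x -> Defs.span A y -> Defs.span A (a *: x + y).
Proof.
split.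
  exists 0%N, (fun=> 0), (fun=> 0); split; first by case.
  by rewrite big_ord0.
move=> a _ _ [k [c [v [Av ->]]]] [k' [c' [v' [Av' ->]]]].
exists (k + k')%N, (fun i => match fintype.split i with inl i => a * c i | inr i => c' i end),
  (fun i => match fintype.split i with inl i => v i | inr i => v' i end).
split; first by move=> i; case: fintype.split.
rewrite big_split_ord scaler_sumr /=; congr (_ + _); apply: eq_bigr => i _.
  by rewrite (unsplitK (inl i)) scalerA.
by rewrite (unsplitK (inr i)).
Qed.

Lemma span_dense X (A : set X) : (forall h, orth A h -> h = 0) ->
  forall x (e : R), 0 < e -> exists2 y, Defs.span A y & nr (y - x) < e.
Proof.
move=> oA; apply: dense_of_orth => [|h ho]; first exact: span_subspace.
apply: oA => a Aa; apply: ho; exists 1%N, (fun=> 1), (fun=> a).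
by split=> //; rewrite big_ord1 scale1r.
Qed.

Lemma complete_of_orth X (A : set X) : (forall h, orth A h -> h = 0) ->
  complete_system A.
Proof.
move=> oA; apply/seteqP; split=> // x _ U /nbhs_ballP[e /= e0 eU].
have e1 : 0 < complex.Re e by move: e0; rewrite ltcE => /andP[].
have [y Ay yx] := span_dense oA x e1; exists y; split=> //.
apply: eU; rewrite -ball_normE /= nr_norm nrBC.
by move: e0; rewrite !ltcE /= => /andP[/eqP <- _]; rewrite eqxx.
Qed.

End completeness_criterion.

(** Lets [B y] replace [y] in the argument for [H]: it is visibly the image of an element of [H]. *)
Lemma root_vector_image (R : realType) (X : hilbert R) (B : X -> X) y : linear B ->
  root_vector B y -> root_vector B (B y).
Proof.
move=> lB [mu [n [mu0 yn]]]; exists mu, n; split=> //.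
suff -> x : iter n (fun x => B x - mu *: x) (B x) =
    B (iter n (fun x => B x - mu *: x) x) by rewrite yn (lin0 lB).
by elim: n {yn} => [//|n ih]; rewrite !iterS ih (linB lB) (linZ lB).
Qed.

Section closed_operator.
Context {R : realType} {X : hilbert R}.
Variables (Q K : X -> X) (T : unbounded X) (a : R) (G : X -> X).
Hypotheses (cQ : cptop Q) (iQ : forall x, Q x = 0 -> x = 0) (bG : blin G)
  (GK1 : forall x, G (x + K x + a%:C%C *: Q x) = x)
  (GK2 : forall y, G y + K (G y) + a%:C%C *: Q (G y) = y)
  (domT : op_dom T = range Q) (TQ : forall f, T (Q f) = f + K f).
Implicit Types (x y : X).

Let B := Q \o G.

Let cB : cptop B. Proof. exact: cptop_compr. Qed.
Let lB : linear B. Proof. by case: cB. Qed.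

Let TB y : T (B y) = y - a%:C%C *: B y.
Proof.
by rewrite /B /= TQ -[X in _ = X - _](GK2 y) addrK.
Qed.

Lemma resolvent_pencil : resolvent_set T (- a%:C%C).
Proof.
pose Bl : {linear X -> X} := HB.pack B (GRing.isLinear.Build _ _ _ _ B lB).
exists Bl; first exact: (blin_continuous (cptop_blin cB)).
rewrite -[Bl : X -> X]/B; split=> [y|x].
  by split; [rewrite domT; exists (G y)|rewrite TB; vec].
rewrite domT => -[f _ <-]; rewrite TQ scaleNr opprK.
by rewrite /B /= GK1.
Qed.

Let shift mu x := B x - mu *: x.

Lemma root_vector_range n (mu : R[i]) y : mu != 0 -> iter n (shift mu) y = 0 ->
  exists w, y = B w.
Proof.
move=> mu0; elim: n y => [|n ih] y; first by move=> /= ->; exists 0; rewrite (lin0 lB).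
rewrite iterSr => /ih[w wE]; exists (mu^-1 *: (y - w)).
rewrite (linZ lB) (linB lB) -wE /shift opprB addrC subrK.
by rewrite scalerA mulVf // scale1r.
Qed.

(** On the range of [B] the operator [T] is [B^-1 - a], so [T - (mu^-1 - a)] is
    [- mu^-1 (B - mu) B^-1], which lowers the order of a root vector by one. *)
Lemma root_vector_step n (mu : R[i]) y : mu != 0 -> iter n.+1 (shift mu) y = 0 ->
  op_dom T y /\ iter n (shift mu) (T y - (mu^-1 - a%:C%C) *: y) = 0.
Proof.
move=> mu0 yn; have [w wE] := root_vector_range mu0 yn.
have lS : linear (shift mu).
  by move=> b x z; rewrite /shift lB; vec.
have lI k : linear (iter k (shift mu)) by exact: iter_linear.
have iB k x : iter k (shift mu) (B x) = B (iter k (shift mu) x).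
  elim: k => [//|k ih]; rewrite /= ih /shift.
  by rewrite (linB lB) (linZ lB).
have injB x : B x = 0 -> x = 0.
  move=> Bx; have := TB x; have := TB 0.
  by rewrite Bx (lin0 lB) !scaler0 !subr0 => -> ->.
have wn : iter n.+1 (shift mu) w = 0.
  by apply: injB; rewrite -iB -wE.
split; first by rewrite domT wE; exists (G w).
have -> : T y - (mu^-1 - a%:C%C) *: y = (- mu^-1) *: shift mu w.
  rewrite wE TB /shift scalerBr scalerA mulNr mulVf // scaleN1r.
  by vec.
by rewrite (linZ (lI n)) -iterSr wn scaler0.
Qed.

Lemma root_vector_function y : root_vector B y -> y != 0 -> root_functions T y.
Proof.
move=> [mu [n [mu0 yn]]] y0.
pose l := mu^-1 - a%:C%C; pose N x := T x - l *: x.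
have iN m k x : (k <= m)%N -> iter m (shift mu) x = 0 ->
    iter (m - k) (shift mu) (iter k N x) = 0.
  elim: k => [|k ih] km xm; first by rewrite subn0.
  have := ih (ltnW km) xm; rewrite -(subnSK km) => /(root_vector_step mu0)[_].
  by rewrite iterS.
have dN m k x : (k < m)%N -> iter m (shift mu) x = 0 -> op_dom T (iter k N x).
  move=> km xm; have := iN m k x (ltnW km) xm.
  by rewrite -(subnSK km) => /(root_vector_step mu0)[].
have n0 : (0 < n)%N by case: n yn => // /= yE; rewrite yE eqxx in y0.
have Nn : iter n N y = 0 by have := iN n n y (leqnn n) yn; rewrite subnn.
exists l; last first.
  split; first exact: (dN n 0%N).
  by exists n; split=> // j /andP[_ jn]; exact: (dN n j).
(* The last nonzero iterate of [y] under [N] is the eigenvector that makes [l] an eigenvalue of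
   [T]. *)
have [k kP kmin] := @ex_minnP (fun k => iter k N y == 0) (ex_intro _ n (introT eqP Nn)).
case: k kP kmin => [|k] kP kmin; first by rewrite (negbTE y0) in kP.
have kn : (k < n)%N by apply: kmin; apply/eqP.
exists (iter k N y); split; first exact: (dN n k).
  by apply/negP => h; have := kmin k h; rewrite ltnn.
by move: kP; rewrite iterS /N subr_eq0 => /eqP.
Qed.

(** An eigenvalue [l] outside [S] has modulus below [r], so [(l + a)^-1] is an eigenvalue of the
    compact [B] of modulus at least [d]; there are finitely many of these. *)
Lemma eigenvalues_outside (r C : R) (S : set R[i]) :
  (forall l x, r <= cabs l -> ~ S l -> nr x <= C * nr (x + K x - l *: Q x)) ->
  finite_set (eigenvalues T `\` S).
Proof.
move=> bnd; pose d := (`|r| + `|a| + 1)^-1.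
have ra : 0 < `|r| + `|a| + 1 by rewrite ltr_wpDl // addr_ge0.
have d0 : 0 < d by rewrite invr_gt0.
apply: sub_finite_set (finite_image (fun mu : R[i] => mu^-1 - a%:C%C)
  (cptop_eigenvalues_finite cB d0)).
move=> l [[x [+ x0 Tx]] nS]; rewrite domT => -[f _ fx].
have f0 : f != 0 by apply: contra_neq x0 => f0; rewrite -fx f0 (lin0 cQ.1).
have pf : f + K f = l *: Q f by rewrite -TQ fx.
have lr : cabs l < r.
  rewrite ltNge; apply/negP => rl; have := bnd l f rl nS.
  rewrite pf subrr nr0 mulr0 => h; have := nr_gt0 f0; lra.
have fG : f = (l + a%:C%C) *: G (Q f).
  by rewrite -{1}(GK1 f) pf -scalerDl (linZ bG.1).
have la : l + a%:C%C != 0 by apply: contra_neq f0 => la; rewrite fG la scale0r.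
exists (l + a%:C%C)^-1; last by rewrite invrK addrK.
split.
  rewrite cabsV lef_pV2 ?posrE ?cabs_gt0 //.
  apply: le_trans (cabsD _ _) _; rewrite cabs_real.
  have := ler_norm r; lra.
exists x => //; rewrite -fx {2}fG (linZ cQ.1) scalerA mulVf //.
by rewrite scale1r.
Qed.

End closed_operator.

(** * Slopes of sectors and angles of corners *)

Lemma corner_sector (R : realType) (eps : R) : 0 < eps ->
  exists2 kappa : R, 0 < kappa & sector kappa `<=` corner eps.
Proof.
(* Capping the angle at 1 keeps it below [pi / 2], where [tan] is positive and inverted by
   [atan]. *)
move=> e0; pose th := Num.min eps 1.
have th0 : 0 < th by rewrite lt_min e0 ltr01.
have thp : th < pi / 2.
  apply: le_lt_trans (_ : 1 < _); first by rewrite ge_min lexx orbT.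
  have := @pihalf_ge1 R; rewrite le_eqVlt => /orP[/eqP h|//].
  by have := cos_pihalf R; rewrite -h; have := @cos1_gt0 R; lra.
have thE : atan (tan th) = th.
  by rewrite tanK // in_itv /= thp andbT; have := @pi_gt0 R; lra.
exists (tan th).
  rewrite ltNge; apply/negP => /le_atan; rewrite thE atan0; lra.
move=> [x y] [/= x0 yx]; pose t := y / x.
have tt : `|t| < tan th.
  by rewrite /t normrM normfV (gtr0_norm x0) ltr_pdivrMr.
have s0 : 0 < Num.sqrt (1 + t ^+ 2).
  by rewrite sqrtr_gt0 ltr_pwDl // sqr_ge0.
exists (x * Num.sqrt (1 + t ^+ 2)), (atan t); split.
- exact: mulr_gt0.
- apply: (@lt_le_trans _ _ th); last by rewrite ge_min lexx.
  move: tt; rewrite !ltr_norml => /andP[/lt_atan h1 /lt_atan h2].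
  by rewrite atanN thE in h1; rewrite thE in h2; rewrite h1.
have cE : x * Num.sqrt (1 + t ^+ 2) * cos (atan t) = x.
  by rewrite cos_atan -mulrA divff ?mulr1 // gt_eqF.
congr Complex; first by rewrite cE.
have cn : cos (atan t) != 0 by rewrite cos_atan invr_eq0 gt_eqF.
have -> : sin (atan t) = cos (atan t) * t.
  by rewrite -{3}[t]atanK /tan mulrC divfK.
by rewrite mulrA cE /t mulrC divfK // gt_eqF.
Qed.

(** * Completeness in L^2 *)

Lemma span_sub (R : realType) (V : lmodType R[i]) (A M : set V) : A `<=` M -> M 0 ->
  (forall a x y, M x -> M y -> M (a *: x + y)) -> Defs.span A `<=` M.
Proof.
move=> AM M0 MP _ [k [c [v [Av ->]]]].
apply: (big_ind M) => // [x y Mx My|i _]; first by rewrite -[x]scale1r; exact: MP.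
by rewrite -[_ *: _]addr0; apply: MP => //; exact: AM.
Qed.

Lemma ae_onS d (T : measurableType d) (R : realType) (mu : {measure set T -> \bar R})
  (D : set T) (p q : T -> Prop) : (forall x, p x -> q x) -> ae_on mu D p -> ae_on mu D q.
Proof. by move=> pq; rewrite /ae_on; apply: filterS => x /[apply]; exact: pq. Qed.

Lemma ae_onI d (T : measurableType d) (R : realType) (mu : {measure set T -> \bar R})
  (D : set T) (p q : T -> Prop) : ae_on mu D p -> ae_on mu D q ->
  ae_on mu D (fun x => p x /\ q x).
Proof. by rewrite /ae_on; apply: filterS2 => x hp hq Dx; split; [exact: hp|exact: hq]. Qed.

Lemma sqnorm2_ae d (T : measurableType d) (R : realType) (mu : {measure set T -> \bar R})
  (D : set T) (f g : T -> R[i]^o) : measurable D -> cmeasurable D f -> cmeasurable D g ->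
  ae_on mu D (fun x => f x = g x) -> sqnorm2 mu D f = sqnorm2 mu D g.
Proof.
move=> mD mf mg fg; apply: ge0_ae_eq_integral => //; try exact: measurable_abs2.
- by move=> x _; rewrite lee_fin abs2_ge0.
- by move=> x _; rewrite lee_fin abs2_ge0.
by apply: (ae_onS _ fg) => x ->.
Qed.

Section inclusion.
Context d (T : measurableType d) (R : realType) (mu : {measure set T -> \bar R}).
Variables (D : set T) (H : hilbert R) (iota : H -> T -> R[i]^o).
Hypotheses (mD : measurable D) (iota_L2 : forall v, L2 mu D (iota v))
  (iota_lin : forall (c : R[i]) v w,
     ae_on mu D (fun x => iota (c *: v + w) x = c * iota v x + iota w x)).
Notation V := (T -> R[i]^o).

Lemma L2_sub (g h : V) : L2 mu D g -> L2 mu D h -> L2 mu D (g - h).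
Proof. by move=> Lg Lh; rewrite addrC -scaleN1r; exact: L2_lin. Qed.

Lemma iota0 : ae_on mu D (fun x => iota 0 x = 0).
Proof.
by apply: (ae_onS _ (iota_lin (-1) 0 0)) => x; rewrite scaler0 addr0 mulN1r addNr.
Qed.

Lemma iota_dense : (forall w : V, L2 mu D w -> (forall v, L2dot mu D (iota v) w = 0) ->
    ae_on mu D (fun x => w x = 0)) ->
  forall (f : V) (e : R), L2 mu D f -> 0 < e ->
  exists v, (sqnorm2 mu D (f - iota v)%R < e%:E)%E.
Proof.
move=> orth0 f e Lf e0.
(* The range of [iota] has to be closed up under equality almost everywhere, since [iota] is linear
   only in that sense. *)
pose Y : set V := [set g | L2 mu D g /\ exists v, ae_on mu D (fun x => g x = iota v x)].
have YL : Y `<=` (L2 mu D : set V) by move=> g [].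
have Y0 : Y 0.
  split; first exact: L2_0.
  by exists 0; apply: (ae_onS _ iota0) => x ->.
have YP a (g h : V) : Y g -> Y h -> Y (a *: g + h).
  move=> [Lg [v gv]] [Lh [w hw]]; split; first exact: L2_lin.
  exists (a *: v + w); apply: (ae_onS _ (ae_onI (ae_onI gv hw) (iota_lin a v w))).
  by move=> x [[gx hx] ->]; rewrite -gx -hx.
have [p [Lp pY] po] := projection (L2_0 mu D) (L2_lin mD) (L2dot_lin mD) (L2dotC mD)
  (L2dot_ge0 mD) (L2_complete mD) YL Y0 YP Lf.
have Lfp := L2_sub Lf Lp.
have fp : ae_on mu D (fun x => (f - p) x = 0).
  apply: orth0 => // v; rewrite (L2dotC mD Lfp (iota_L2 v)) po ?conjC0 //.
  by split; [exact: iota_L2|exists v; exact: aeW].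
have [y [Ly [v yv]] yp] := pY (Num.sqrt e) (eqbRL (sqrtr_gt0 e) e0).
exists v; rewrite (@sqnorm2_ae _ _ _ mu D (f - iota v) (p - y)) //.
- rewrite sqnorm2E; [|exact: mD|exact: L2_sub].
  rewrite lte_fin -(sqr_sqrtr (ltW e0)) ltr_pXn2r ?nnegrE ?seminorm_ge0 ?sqrtr_ge0 //.
  by rewrite -(opprB y p) /L2norm (seminormN (L2_0 mu D) (L2_lin mD) (L2dot_lin mD)
    (L2dotC mD) (L2dot_ge0 mD)) //; exact: L2_sub.
- by case: (L2_sub Lf (iota_L2 v)).
- by case: (L2_sub Lp Ly).
apply: (ae_onS _ (ae_onI fp yv)) => x [/eqP]; rewrite subr_eq0 => /eqP fpx yx.
by rewrite -[(p - y) x]/(p x - y x) yx -fpx.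
Qed.

Lemma complete_in_L2_of_orth (M : R) (A : set H) :
  (forall w : V, L2 mu D w -> (forall v, L2dot mu D (iota v) w = 0) ->
    ae_on mu D (fun x => w x = 0)) ->
  (forall v, (sqnorm2 mu D (iota v) <= (M * nr v ^+ 2)%:E)%E) ->
  (forall h, orth A h -> h = 0) ->
  complete_in_L2 mu D (iota @` A).
Proof.
move=> orth0 bM oA f Lf e e0; have e4 : 0 < e / 4 by rewrite divr_gt0.
have [v fv] := iota_dense orth0 Lf e4.
have M1 : 0 < `|M| + 1 by rewrite ltr_wpDl.
have d0 : 0 < e / 4 / (`|M| + 1) by rewrite divr_gt0.
have [y Ay yv] := span_dense oA v (eqbRL (sqrtr_gt0 _) d0).
(* Completeness asks for an honest combination of the functions [iota u]; it agrees with [iota y]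
   only almost everywhere. *)
have [g [Sg Lg gy]] : exists g : V, [/\ Defs.span (iota @` A) g, L2 mu D g &
    ae_on mu D (fun x => g x = iota y x)].
  have [S0 SP] := span_subspace (iota @` A : set V).
  move: y Ay {yv}; apply: span_sub => [u Au||c u w [g [Sg Lg gu]] [h [Sh Lh hw]]].
  - exists (iota u); split; [|exact: iota_L2|exact: aeW].
    exists 1%N, (fun=> 1), (fun=> iota u); split; first by exists u.
    by rewrite big_ord1 scale1r.
  - exists 0; split=> //; first exact: L2_0.
    by apply: (ae_onS _ iota0) => x ->.
  - exists (c *: g + h); split; [exact: SP|exact: L2_lin|].
    apply: (ae_onS _ (ae_onI (ae_onI gu hw) (iota_lin c u w))).
    by move=> x [[gx hx] ->]; rewrite -gx -hx.
exists g => //; have Lvg := L2_sub (iota_L2 v) Lg.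
have vg : (sqnorm2 mu D (iota v - g)%R < (e / 4)%:E)%E.
  rewrite (@sqnorm2_ae _ _ _ mu D _ (iota (-1 *: y + v))) //.
  - apply: le_lt_trans (bM _) _; rewrite lte_fin scaleN1r addrC nrBC.
    apply: (@le_lt_trans _ _ ((`|M| + 1) * nr (y - v) ^+ 2)).
      rewrite ler_wpM2r ?sqr_ge0 //; apply: le_trans (ler_norm M) _.
      by rewrite lerDl.
    rewrite mulrC -ltr_pdivlMr // -(sqr_sqrtr (ltW d0)).
    by rewrite ltr_pXn2r ?nnegrE ?nr_ge0 ?sqrtr_ge0.
  - by case: Lvg.
  - by case: (iota_L2 (-1 *: y + v)).
  apply: (ae_onS _ (ae_onI gy (iota_lin (-1) y v))) => x [gx ->].
  by rewrite mulN1r -gx addrC.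
have -> : (fun x => f x - g x) = (f - iota v) + (iota v - g) by rewrite subrKA.
have Lfv := L2_sub Lf (iota_L2 v).
apply: le_lt_trans (le_sqnorm2D mu mD Lfv.1 Lvg.1) _.
move: fv vg; rewrite (sqnorm2E mD Lfv) (sqnorm2E mD Lvg) -!EFinM -EFinD !lte_fin.
by move: (L2norm _ _ _ ^+ 2) (L2norm _ _ _ ^+ 2) => s t; lra.
Qed.

End inclusion.

(** * Transfer between the negative space, the energy space and L^2 *)

Theorem theorem3p4 (R : realType) (n : nat) (P : SL_data R n)
    (hP : SL_coefficients P) (hnorm : SL_norm P)
    (H Hm : hilbert R)
    (j : ('rV[R]_n.+1 -> R[i]) -> H) (hj : SL_completion P j)
    (iota : H -> 'rV[R]_n.+1 -> R[i]) (hiota : L2_inclusion P j iota)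
    (jm : ('rV[R]_n.+1 -> R[i]) -> Hm) (hjm : neg_completion P jm)
    (pair : H -> Hm -> R[i]) (hpair : is_pairing P iota jm pair)
    (iota' : ('rV[R]_n.+1 -> R[i]) -> Hm)
    (hiota' : dual_embedding P iota pair iota')
    (L0 : H -> Hm) (hL0 : forall u v : H, pair v (L0 u) = hdot H v u)
    (L0inv : Hm -> H) (hL0K : cancel L0 L0inv) (hL0invK : cancel L0inv L0)
    (hdotm : forall f g : Hm, hdot Hm f g = pair (L0inv f) g)
    (dL : H -> Hm) (hdL : compact_operator dL)
    (hQ1 : finite_order (fun f : Hm => iota' (iota (L0inv f))))
    (T : unbounded Hm)
    (hTdom : op_dom T = range (fun u : H => iota' (iota u)))
    (hT : forall u : H, T (iota' (iota u)) = L0 u + dL u) :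
  let rootH := [set u : H | root_functions T (iota' (iota u))] in
  [/\ spectrum T <> setT,
      complete_system (root_functions T),
      complete_in_L2 (vol R n) (dom P) (iota @` rootH),
      complete_system rootH
    & forall eps : R, 0 < eps ->
        finite_set (eigenvalues T `\` corner eps)].
Proof.
move=> rootH.
have oD : open (dom P) by case: (SL_domain hP).
have mD := open_vol_measurable oD.
(* This makes [L0] the adjoint of [L0inv], whence [L0inv] is linear and isometric. *)
have L0dot f u : ip f (L0 u) = hdot H (L0inv f) u by rewrite hdotm hL0.
have lL0inv : linear L0inv.
  move=> c f g; apply: ip_inj => u.
  by rewrite -L0dot ipDl ipZl !L0dot -ipZl -ipDl.
have nL0inv f : nr (L0inv f) = nr f.
  by rewrite /nr /seminorm -L0dot hL0invK.
have bL0inv : blin L0inv.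
  by split=> //; exists 1 => // f; rewrite mul1r nL0inv.
pose K := dL \o L0inv.
have cK : cptop K by apply: cptop_compr => //; exact: compact_operator_cptop.
case: hQ1 => p p0 [coQ [s sQ sp]].
pose Q (f : Hm) := iota' (iota (L0inv f)).
have cQ : cptop Q by exact: compact_operator_cptop.
have LI v : L2 (vol R n) (dom P) (iota v) by exact: L2i_L2 hiota v.
have QE f g : ip f (Q g) = L2dot (vol R n) (dom P) (iota (L0inv f)) (iota (L0inv g)).
  by rewrite hdotm (de_pair hiota').
have QC f g : ip (Q f) g = ip f (Q g).
  by rewrite (ipC g) !QE (L2dotC mD (LI _) (LI _)) conjCK.
have pQ f : 0 <= ip (Q f) f.
  by rewrite QC QE; have := L2dot_ge0 mD (LI (L0inv f)).
have iQ f : Q f = 0 -> f = 0.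
  move=> /(de_injective hiota' (LI _)) /(L2i_injective hiota) f0.
  by apply: nr_eq0; rewrite -nL0inv f0 nr0.
have sP k : 0 <= s k.+1 <= s k by case: sQ => [? [? []]].
have [S sS] : exists S, forall m, \sum_(k < m) s k `^ p <= S.
  exists (fine (\sum_(0 <= k <oo) (s k `^ p)%:E)%E) => m.
  rewrite -lee_fin fineK; last first.
    by rewrite ge0_fin_numE // nneseries_ge0 // => k _ _; rewrite lee_fin powR_ge0.
  rewrite -sumEFin -(big_mkord xpredT (fun k => (s k `^ p)%:E)).
  by apply: nneseries_lim_ge => k _ _; rewrite lee_fin powR_ge0.
have [q pq] : exists q, p <= (2 ^ q)%:R.
  exists (Num.truncn p).+1; apply: le_trans (ltW (truncnS_gt p)) _.
  by rewrite ler_nat ltnW // ltn_expl.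
have [s0 [S' sS']] := schatten_power_sums p0 pq sP sS.
have [a [G [bG GK1 GK2 complete]]] := keldysh cQ QC pQ iQ cK sQ s0 sS'.
have domT : op_dom T = range Q.
  rewrite hTdom; apply/seteqP; split=> _ [u _ <-].
    by exists (L0 u) => //; rewrite /Q hL0K.
  by exists (L0inv u).
have TQ f : T (Q f) = f + K f by rewrite hT hL0invK.
have rootP y : root_vector (Q \o G) y -> y != 0 -> root_functions T y.
  exact: (root_vector_function cQ bG GK2 domT TQ).
have orthT h : orth (root_functions T) h -> h = 0.
  move=> ho; apply: complete => y ry; have [->|y0] := eqVneq y 0; first exact: ip0r.
  by apply: ho; exact: rootP.

(* For a root vector [y] of [B], [B y] is [iota' (iota (L0inv (G y)))] and is again a root vector,
   so [L0inv (G y)] lies in [rootH] unless it is 0. By [L0dot], [Gs (L0 h)] is then orthogonal to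
   all root vectors of [B], hence 0; [Gs] is injective because [G] is onto. *)
have orthH h : orth rootH h -> h = 0.
  move=> ho; have [Gs bGs Gadj] := blin_adjoint bG.
  have Gh : Gs (L0 h) = 0.
    apply: complete => y ry; rewrite ipC -Gadj L0dot.
    have [By|By] := eqVneq (Q (G y)) 0.
      by rewrite (iQ _ By) (lin0 lL0inv) ip0l conjC0.
    rewrite -ipC ho // /rootH /=; apply: rootP => //.
    exact: root_vector_image (cptop_compr cQ bG).1 ry.
  have L0h : L0 h = 0.
    apply: nr_eq0; apply/eqP; rewrite -sqrf_eq0 nr_sqE.
    by rewrite -{1}(GK1 (L0 h)) Gadj Gh ip0r.
  by rewrite -(hL0K h) L0h (lin0 lL0inv).
split.
- move=> E; have : spectrum T (- a%:C%C) by rewrite E.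
  by apply; exact: (resolvent_pencil cQ bG GK1 GK2 domT TQ).
- exact: complete_of_orth.
- have [M MP] := L2i_bounded hiota.
  apply: (@complete_in_L2_of_orth _ _ R (vol R n) (dom P) H iota mD LI
    (L2i_linear hiota) M rootH) => //.
  (* The squared norm of [iota' w] is an L^2 product of some [iota v] with [w], namely for
     [v = L0inv (iota' w)]. *)
  + move=> w Lw wo; apply: (de_injective hiota') => //.
    apply: nr_eq0; apply/eqP; rewrite -sqrf_eq0 nr_sqE hdotm (de_pair hiota') //.
    by rewrite wo.
  + by move=> v; have := MP v; rewrite nr_norm.
- exact: complete_of_orth.
move=> eps eps0; have [kappa k0 kS] := corner_sector eps0.
have [r [C [r0 C0 bnd]]] := outside_sector_bound cQ QC pQ iQ cK k0.
apply: (eigenvalues_outside cQ bG GK1 domT TQ (r := r) (C := C)) => l x rl ns.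
by apply: bnd => // /kS.
Qed.
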